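(* Let $(\phi_n,T_n,U_n)$ be the solution of the discrete problem (a)--(d) below, with the internal stage values $\phi_{n-1,i},T_{n-1,i},\mu_{n-1,i}$, $i=1,\dots,q$, known. Assume that the $q$-stage Runge--Kutta method with Butcher coefficients $\mathcal{A}=(\alpha_{ij})$, $\boldsymbol\beta=(\beta_i)$, $\boldsymbol\gamma=(\gamma_i)$, where $\gamma_i=\sum_{j=1}^q\alpha_{ij}$, is algebraically stable, i.e. it satisfies: (1) $\mathcal{A}$ is non-singular; (2) $\beta_i>0$ for $i=1,\dots,q$; (3) $\gamma_i\ne\gamma_j$ whenever $i\neq j$; (4) the symmetric matrix $M=(m_{ij})\in\mathbb{R}^{q\times q}$, $m_{ij}=\beta_i\alpha_{ij}+\beta_j\alpha_{ji}-\beta_i\beta_j$, is positive semidefinite; (5) $\sum_{i=1}^q\beta_i\gamma_i^{\ell-1}=\frac1\ell$ for $\ell=1,\dots,p$, for some $p\ge q$; (6) $\sum_{j=1}^q\alpha_{ij}\gamma_j^{\ell-1}=\frac{\gamma_i^\ell}{\ell}$ for $\ell=1,\dots,q$ and $i=1,\dots,q$. The scheme, with step $\Delta t>0$, reads as follows: for $i=1,\dots,q$, (a) $\mu_{ni}=C_1\Delta\phi_{ni}-\dfrac{C_2}{\varepsilon^2}\phi_{ni}-U_{ni}G(\Pi_{n-1}\phi_{ni})-U_{ni}H(\Pi_{n-1}\phi_{ni},\Pi_{n-1}T_{ni})$, $\qquad \phi_{ni}=\phi_n+\dfrac{\Delta t}{\tau}\sum_{j=1}^q\alpha_{ij}\mu_{nj}$;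 (b) $\dot U_{ni}=\dfrac12\big(G(\Pi_{n-1}\phi_{ni}),\tfrac1\tau\mu_{ni}\big)+\dfrac1{2\tau}\big(H(\Pi_{n-1}\phi_{ni},\Pi_{n-1}T_{ni}),\mu_{ni}\big)-\dfrac{\lambda}{2\varepsilon K}\big(P(\Pi_{n-1}\phi_{ni},\Pi_{n-1}\mu_{ni}),T_{ni}\big)$, $\qquad U_{ni}=U_n+\Delta t\sum_{j=1}^q\alpha_{ij}\dot U_{nj}$; (c) $\dot T_{ni}=D\Delta T_{ni}+U_{ni}P(\Pi_{n-1}\phi_{ni},\Pi_{n-1}\mu_{ni})$, $\qquad T_{ni}=T_n+\Delta t\sum_{j=1}^q\alpha_{ij}\dot T_{nj}$; (d) $\phi_{n+1}=\phi_n+\dfrac{\Delta t}{\tau}\sum_{i=1}^q\beta_i\mu_{ni}$, $\quad U_{n+1}=U_n+\Delta t\sum_{i=1}^q\beta_i\dot U_{ni}$, $\quad T_{n+1}=T_n+\Delta t\sum_{i=1}^q\beta_i\dot T_{ni}$. Then the scheme admits a unique solution with $\phi_{n+1},T_{n+1},\phi_{ni},T_{ni}\in H^1(\Omega)$, $i=1,\dots,q$, and $U_{n+1}\in\mathbb{R}$. Moreover, the discrete energy law $$\mathcal{E}^{n+1}-\mathcal{E}^n\le 0,\qquad n=0,1,\ldots,$$ holds, where $$\mathcal{E}^n=\frac{C_1}{2}\|\nabla \phi_n\|^2+\frac{C_2}{2 \varepsilon^2}\|\phi_n\|^2+\frac{\lambda}{2 \varepsilon K}\|T_n\|^2+|U_{n}|^2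 .$$
   Context: Setting: $\Omega\subset\mathbb{R}^d$, $d=2,3$, is a bounded domain with periodic boundary conditions (e.g. $\Omega=(0,2\pi)^d$); $(\cdot,\cdot)$ and $\|\cdot\|$ are the $L^2(\Omega)$ inner product and norm. The scheme discretizes in time the anisotropic phase-field dendritic crystal growth model for the phase variable $\phi$ and scaled temperature $T$, using an auxiliary scalar $U(t)=\sqrt{E_1(\phi)}$. There is no spatial discretization and there are no external forces. Time grid and extrapolation: $\Delta t=t_{n+1}-t_n$ is uniform, with internal nodes $t_{ni}=t_n+\gamma_i\Delta t$, $i=1,\dots,q$; $\phi_{ni},\mu_{ni},T_{ni}$ are functions on $\Omega$ and $U_{ni}\in\mathbb{R}$ approximating the solution at $t_{ni}$. For given stage values $v_{n-1,1},\dots,v_{n-1,q}$ on the previous step, $(\Pi_{n-1}v_{n-1})(t)$ denotes the polynomial in $t$ of degree at most $q-1$ with $(\Pi_{n-1}v_{n-1})(t_{n-1,i})=v_{n-1,i}$, $i=1,\dots,q$, where $t_{n-1,i}=t_{n-1}+\gamma_i\Delta t$; the abbreviation $\Pi_{n-1}v_{ni}:=(\Pi_{n-1}v_{n-1})(t_{ni})$ denotes its (extrapolated) value at $t_{ni}$. The nodal values $\phi_n,T_n,U_n$ and the stage values with index $n-1$ are given when solving for step $n$ (for $n=0$ the needed starting stage data are assumed given); the previously computed data are assumed regular enough that all expressions make sense. Constants: $\tau,\varepsilon,\lambda,K,D>0$ (mobility, interface width, linear kinetic coefficient, latent heat coefficient, diffusion rate), $\epsilon_4\in[0,1)$ (anisotropic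 strength), $0<C_1<(1-\epsilon_4)^2$, $C_2>0$, and $C_0$ a constant chosen large enough that $E_1(\phi)>0$, where $$E_1(\phi)=\int_{\Omega}\Big(\tfrac{1}{2}\big(\kappa^2(\nabla \phi)-C_1\big)|\nabla \phi|^2+\tfrac{1}{\varepsilon^2}\big(F(\phi)-\tfrac{C_2}{2} \phi^2\big)+C_0\Big)\, d\boldsymbol{x}.$$ Functions: $F(\phi)=\frac14(\phi^2-1)^2$ and $h(\phi)=\frac15\phi^5-\frac23\phi^3+\phi$. The anisotropy coefficient in 2D is $\kappa(\nabla\phi)=1+\epsilon_4\cos(m(\theta-\theta_0))$, with $\theta=\arctan(\phi_y/\phi_x)$, $m$ the anisotropy mode number and $\theta_0$ a given angle; its variational derivative is $\zeta(\phi)=-m\epsilon_4\frac{\sin(m(\theta-\theta_0))}{|\nabla\phi|^2}(-\phi_y,\phi_x)$. In 3D (with $m=4$, $\theta_0=0^\circ$), $\kappa(\nabla\phi)=1-3\epsilon_4+4\epsilon_4\frac{\phi_x^4+\phi_y^4+\phi_z^4}{|\nabla\phi|^4}$ and $$\zeta(\phi)=\tfrac{16\epsilon_4}{|\nabla\phi|^6}\big(\phi_x^3\phi_y^2+\phi_x^3\phi_z^2-\phi_x\phi_y^4-\phi_x\phi_z^4,\ \phi_x^2\phi_y^3+\phi_y^3\phi_z^2-\phi_x^4\phi_y-\phi_y\phi_z^4,\ \phi_x^2\phi_z^3+\phi_y^2\phi_z^3-\phi_x^4\phi_z-\phi_y^4\phi_z\big).$$ Operators: $$G(\phi)=\frac{g(\phi)}{\sqrt{E_1(\phi)}},\qquad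 H(\phi,T)=\frac{\lambda h'(\phi)T}{\varepsilon\sqrt{E_1(\phi)}},\qquad P(\phi,\mu)=\frac{K h'(\phi)\mu}{\tau\sqrt{E_1(\phi)}},$$ $$g(\phi)=-\nabla\cdot\Big(\big(\kappa^2(\nabla\phi)-C_1\big)\nabla\phi+\kappa(\nabla\phi)|\nabla\phi|^2\zeta(\phi)\Big)+\frac{1}{\varepsilon^2}\big(F'(\phi)-C_2\phi\big).$$ *)

(* Defs.v *)
From HB Require Import structures.
From mathcomp Require Import all_boot all_order all_algebra.
From mathcomp Require Import all_classical all_reals all_analysis.

Set Implicit Arguments.
Unset Strict Implicit.
Unset Printing Implicit Defensive.
Import Order.TTheory GRing.Theory Num.Theory.
Import numFieldNormedType.Exports.

Local Open Scope classical_set_scope.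
Local Open Scope ring_scope.

(* 'rV[R]_n carries the sigma-algebra generated by its coordinates, exactly as
   the library does for n.-tuple; it is the Borel sigma-algebra of R^n. *)
Section measurable_rV.
Variables (R : realType) (n : nat).

Definition rV_coord (i : 'I_n) (x : 'rV[R]_n) : R := x ord0 i.

Let rV_set0 : g_sigma_preimage rV_coord set0.
Proof. exact: sigma_algebra0. Qed.

Let rV_setC A : g_sigma_preimage rV_coord A -> g_sigma_preimage rV_coord (~` A).
Proof. exact: sigma_algebraC. Qed.

Let rV_bigcup (F : _^nat) : (forall i, g_sigma_preimage rV_coord (F i)) ->
  g_sigma_preimage rV_coord (\bigcup_i (F i)).
Proof. exact: sigma_algebra_bigcup. Qed.

HB.instance Definition _ :=
  @isMeasurable.Build (measure_tuple_display default_measure_display)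
    'rV[R]_n (g_sigma_preimage rV_coord) rV_set0 rV_setC rV_bigcup.

Lemma measurable_rV_coord (i : 'I_n) : measurable_fun setT (rV_coord i).
Proof.
move=> _ Y mY; rewrite setTI; apply: sub_sigma_algebra => /=.
rewrite -bigcup_seq/=; exists i => /=; first by rewrite mem_index_enum.
by exists Y => //; rewrite setTI.
Qed.

Lemma measurable_fun_rVP d (T : measurableType d) (f : T -> 'rV[R]_n) :
  measurable_fun setT f <->
  forall i, measurable_fun setT (fun x => f x ord0 i).
Proof.
split=> [mf i|mf]; first exact: measurableT_comp (measurable_rV_coord i) mf.
move=> _ Y mY; rewrite setTI.
have : preimage_set_system setT f (g_sigma_preimage rV_coord) (f @^-1` Y).
  by exists Y => //; rewrite setTI.
rewrite -g_sigma_preimage_comp; apply: smallest_sub => //.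
  exact: sigma_algebra_measurable.
move=> A; rewrite -bigcup_seq/= => -[i _ [B mB <-]].
exact: mf.
Qed.

End measurable_rV.

Section rV_cons.
Variables (R : realType) (n : nat).

Definition rV_cons (x : measurableTypeR R * 'rV[R]_n) : 'rV[R]_n.+1 :=
  row_mx (x.1 : R)%:M x.2 : 'rV[R]_(1 + n).

Definition rV_behead (x : 'rV[R]_n.+1) : 'rV[R]_n :=
  \row_i x ord0 (lift ord0 i).

Lemma rV_cons0 x : rV_cons x ord0 ord0 = x.1.
Proof.
rewrite /rV_cons (_ : ord0 = lshift n (ord0 : 'I_1)); last exact/val_inj.
by apply: etrans (row_mxEl _ _ _ _) _; rewrite mxE eqxx mulr1n.
Qed.

Lemma rV_consS x i : rV_cons x ord0 (lift ord0 i) = x.2 ord0 i.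
Proof.
rewrite /rV_cons (_ : lift ord0 i = rshift 1 i); last exact/val_inj.
exact: row_mxEr.
Qed.

Lemma measurable_rV_cons : measurable_fun setT rV_cons.
Proof.
apply/measurable_fun_rVP => i; case: (unliftP ord0 i) => [j ->|->].
- under eq_fun do rewrite rV_consS.
  exact: measurableT_comp (measurable_rV_coord j) measurable_snd.
- by under eq_fun do rewrite rV_cons0; exact: measurable_fst.
Qed.

Lemma measurable_rV_behead : measurable_fun setT rV_behead.
Proof.
apply/measurable_fun_rVP => i; under eq_fun do rewrite mxE.
exact: measurable_rV_coord.
Qed.

Variable m : {sigma_finite_measure set 'rV[R]_n -> \bar R}.

Definition lebesgue_cons : set 'rV[R]_n.+1 -> \bar R :=
  pushforward (lebesgue_measure \x m)%E rV_cons.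

Let lebesgue_cons0 : lebesgue_cons set0 = 0%E.
Proof. by rewrite /lebesgue_cons /pushforward preimage_set0 measure0. Qed.

Let lebesgue_cons_ge0 A : (0 <= lebesgue_cons A)%E.
Proof. by rewrite /lebesgue_cons /pushforward; exact: measure_ge0. Qed.

Let lebesgue_cons_sigma_additive : semi_sigma_additive lebesgue_cons.
Proof.
move=> F mF tF mU; rewrite /lebesgue_cons /pushforward preimage_bigcup.
apply: measure_semi_sigma_additive.
- by move=> k; rewrite -[X in measurable X]setTI; exact: measurable_rV_cons.
- apply/trivIsetP => /= i j _ _ ij; rewrite -preimage_setI.
  by move/trivIsetP : tF => ->//; rewrite preimage_set0.
- rewrite -preimage_bigcup -[X in measurable X]setTI.
  exact: measurable_rV_cons.
Qed.

HB.instance Definition _ := isMeasure.Build _ _ _ lebesgue_cons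
  lebesgue_cons0 lebesgue_cons_ge0 lebesgue_cons_sigma_additive.

Let lebesgue_cons_sigma_finite : sigma_finite setT lebesgue_cons.
Proof.
pose uncons (x : 'rV[R]_n.+1) : measurableTypeR R * 'rV[R]_n :=
  (x ord0 ord0, rV_behead x).
have muncons : measurable_fun setT uncons.
  apply: measurable_fun_pair; first exact: measurable_rV_coord.
  exact: measurable_rV_behead.
have unconsK x : uncons (rV_cons x) = x.
  case: x => a v; rewrite /uncons rV_cons0 /=; congr pair.
  by apply/rowP => i; rewrite mxE rV_consS.
have /sigma_finiteP[F [TF ndF Foo]] := sigma_finiteT (@lebesgue_measure R).
have /sigma_finiteP[G [TG ndG Goo]] := sigma_finiteT m.
exists (fun k => uncons @^-1` (F k `*` G k)).
  apply/seteqP; split => // x _.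
  have [k _ Fk] : (\bigcup_k F k) (uncons x).1 by rewrite -TF.
  have [l _ Gl] : (\bigcup_k G k) (uncons x).2 by rewrite -TG.
  exists (maxn k l) => //; split => /=.
  - by move: Fk; exact/subsetPset/ndF/leq_maxl.
  - by move: Gl; exact/subsetPset/ndG/leq_maxr.
move=> k; have [mF Fkoo] := Foo k; have [mG Gkoo] := Goo k; split.
  by rewrite -[X in measurable X]setTI; apply: muncons => //; exact: measurableX.
rewrite /lebesgue_cons /pushforward -comp_preimage.
rewrite (_ : uncons \o _ = id); last by apply/funext => x /=.
by rewrite preimage_id product_measure1E// lte_mul_pinfty// ge0_fin_numE.
Qed.

HB.instance Definition _ := Measure_isSigmaFinite.Build _ _ _ lebesgue_cons
  lebesgue_cons_sigma_finite.

End rV_cons.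

(* R^0 is a point of mass 1, and R^(n+1) = R x R^n carries the product of the
   Lebesgue measures of R and of R^n. *)
Fixpoint lebesgue_rV (R : realType) (n : nat) :
    {sigma_finite_measure set 'rV[R]_n -> \bar R} :=
  match n with
  | 0 => \d_(0 : 'rV[R]_0)
  | n'.+1 => lebesgue_cons (lebesgue_rV R n')
  end.

Section periodic_box.
Variables (R : realType) (d : nat) (a b : 'rV[R]_d).
Implicit Types (u v w psi : 'rV[R]_d -> R) (V : 'rV[R]_d -> 'rV[R]_d).

Definition box : set 'rV[R]_d :=
  [set x | forall i, a ord0 i < x ord0 i < b ord0 i].

Lemma measurable_box : measurable box.
Proof.
have -> : box = \bigcap_(i : 'I_d) (rV_coord i @^-1` `]a ord0 i, b ord0 i[).
  apply/seteqP; split=> x /= xP => [i _|i]; first by rewrite /= in_itv/=; exact: xP.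
  by have /= := xP i I; rewrite in_itv.
apply: fin_bigcap_measurable => // i _; rewrite -[X in measurable X]setTI.
by apply: measurable_rV_coord => //; exact: measurable_itv.
Qed.

Definition box_measure : {measure set 'rV[R]_d -> \bar R} :=
  mrestr (lebesgue_rV R d) measurable_box.

Local Notation mu := box_measure.

(* Square-integrable functions are representatives defined on all of R^d whose
   values outside the box are irrelevant: mu vanishes there. *)
Definition L2 u : Prop := u \in Lfun mu 2%:E.

Definition inner u v : R := \int[mu]_x (u x * v x).

Definition dotv (x y : 'rV[R]_d) : R := \sum_i x ord0 i * y ord0 i.

Definition partial (i : 'I_d) psi (x : 'rV[R]_d) : R :=
  'D_(delta_mx ord0 i) psi x.

(* C^1 test functions define the same weak derivatives as C^infinity ones. *)
Definition test_function psi : Prop :=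
  [/\ forall x, differentiable psi x,
      forall i, continuous (partial i psi) &
      forall i x,
        psi (x + (b ord0 i - a ord0 i) *: delta_mx ord0 i) = psi x].

Definition weak_partial (i : 'I_d) u w : Prop :=
  L2 w /\ forall psi, test_function psi ->
    inner w psi = - inner u (partial i psi).

Definition H1 u : Prop :=
  L2 u /\ forall i, exists w, weak_partial i u w.

(* A choice of representative; weak derivatives are unique a.e. *)
Definition grad u (x : 'rV[R]_d) : 'rV[R]_d :=
  \row_i (xget (cst 0) [set w | weak_partial i u w]) x.

Definition L2v V : Prop := forall i, L2 (fun x => V x ord0 i).

Definition innerv V W : R := \int[mu]_x dotv (V x) (W x).

(* Divergence in the variational sense, with periodic boundary conditions:
   no boundary term appears when testing against periodic H^1 functions. *)
Definition weak_div V w : Prop :=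
  [/\ L2v V, L2 w & forall psi, H1 psi -> inner w psi = - innerv V (grad psi)].

Definition divg V : 'rV[R]_d -> R := xget (cst 0) [set w | weak_div V w].

Definition weak_laplacian u w : Prop := H1 u /\ weak_div (grad u) w.

End periodic_box.

Record model (R : realType) (d : nat) := Model {
  lo : 'rV[R]_d;      (* the domain is the box between the corners lo and hi *)
  hi : 'rV[R]_d;
  tau : R;            (* mobility *)
  eps : R;            (* interface width *)
  lam : R;            (* linear kinetic coefficient *)
  latent : R;         (* latent heat coefficient K *)
  diffu : R;          (* diffusion rate D *)
  eps4 : R;           (* anisotropic strength *)
  C1 : R;
  C2 : R;
  C0 : R;
  mode : nat;         (* anisotropy mode number m, in 2D *)
  theta0 : R          (* reference angle, in 2D *)
}.

Section model_functions.
Variables (R : realType).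

Definition F (s : R) : R := 4^-1 * (s ^+ 2 - 1) ^+ 2.

Definition h (s : R) : R := 5^-1 * s ^+ 5 - 2 / 3 * s ^+ 3 + s.

(* arctan (p_y / p_x), with its limit +-pi/2 where p_x = 0. The value at p = 0
   is immaterial: kappa and zeta only occur multiplied by p or |p|^2. *)
Definition angle (p : 'rV[R]_2) : R :=
  if p 0 0 == 0 then Num.sg (p 0 1) * (pi / 2) else atan (p 0 1 / p 0 0).

Definition kappa2 (e4 : R) (m : nat) (th0 : R) (p : 'rV[R]_2) : R :=
  1 + e4 * cos (m%:R * (angle p - th0)).

Definition zeta2 (e4 : R) (m : nat) (th0 : R) (p : 'rV[R]_2) : 'rV[R]_2 :=
  (- m%:R * e4 * (sin (m%:R * (angle p - th0)) / dotv p p)) *: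
    \row_i (if i == 0 then - p 0 1 else p 0 0).

Definition kappa3 (e4 : R) (p : 'rV[R]_3) : R :=
  1 - 3 * e4 + 4 * e4 * ((\sum_i p 0 i ^+ 4) / dotv p p ^+ 2).

Definition zeta3 (e4 : R) (p : 'rV[R]_3) : 'rV[R]_3 :=
  let x := p 0 0 in let y := p 0 1 in let z := p 0 ord_max in
  (16 * e4 / dotv p p ^+ 3) *:
    \row_i nth 0 [::
      x ^+ 3 * y ^+ 2 + x ^+ 3 * z ^+ 2 - x * y ^+ 4 - x * z ^+ 4;
      x ^+ 2 * y ^+ 3 + y ^+ 3 * z ^+ 2 - x ^+ 4 * y - y * z ^+ 4;
      x ^+ 2 * z ^+ 3 + y ^+ 2 * z ^+ 3 - x ^+ 4 * z - y ^+ 4 * z] i.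

(* Functions of the gradient; only the dimensions 2 and 3 are meaningful. *)
Definition kappa d : model R d -> 'rV[R]_d -> R :=
  match d with
  | 2 => fun P => kappa2 (eps4 P) (mode P) (theta0 P)
  | 3 => fun P => kappa3 (eps4 P)
  | _ => fun _ => cst 0
  end.

Definition zeta d : model R d -> 'rV[R]_d -> 'rV[R]_d :=
  match d with
  | 2 => fun P => zeta2 (eps4 P) (mode P) (theta0 P)
  | 3 => fun P => zeta3 (eps4 P)
  | _ => fun _ => cst 0
  end.

End model_functions.

Section operators.
Variables (R : realType) (d : nat) (P : model R d).
Implicit Types (phi T m : 'rV[R]_d -> R).

Local Notation mu := (box_measure (lo P) (hi P)).
Local Notation "'nabla' u" := (grad (lo P) (hi P) u) (at level 10, u at level 8).

Definition E1_density phi (x : 'rV[R]_d) : R :=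
  2^-1 * (kappa P (nabla phi x) ^+ 2 - C1 P)
    * dotv (nabla phi x) (nabla phi x)
  + (eps P ^+ 2)^-1 * (F (phi x) - C2 P / 2 * phi x ^+ 2) + C0 P.

Definition E1 phi : R := \int[mu]_x E1_density phi x.

Definition flux phi (x : 'rV[R]_d) : 'rV[R]_d :=
  let p := nabla phi x in
  (kappa P p ^+ 2 - C1 P) *: p + (kappa P p * dotv p p) *: zeta P p.

Definition g phi (x : 'rV[R]_d) : R :=
  - divg (lo P) (hi P) (flux phi) x
  + (eps P ^+ 2)^-1 * (derive1 (@F R) (phi x) - C2 P * phi x).

Definition opG phi (x : 'rV[R]_d) : R := g phi x / Num.sqrt (E1 phi).

Definition opH phi T (x : 'rV[R]_d) : R :=
  lam P * derive1 (@h R) (phi x) * T x / (eps P * Num.sqrt (E1 phi)).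

Definition opP phi m (x : 'rV[R]_d) : R :=
  latent P * derive1 (@h R) (phi x) * m x / (tau P * Num.sqrt (E1 phi)).

(* Regularity of the arguments of G, H and P under which E_1, the divergence in
   g, the three operators and their L^2 inner products make sense. *)
Definition admissible phi T m : Prop :=
  [/\ H1 (lo P) (hi P) phi,
      mu.-integrable setT (EFin \o E1_density phi) /\ 0 < E1 phi,
      exists w, weak_div (lo P) (hi P) (flux phi) w &
      [/\ L2 (lo P) (hi P) (opG phi), L2 (lo P) (hi P) (opH phi T) &
          L2 (lo P) (hi P) (opP phi m)]].

Definition energy phi T (U : R) : R :=
  C1 P / 2 * innerv (lo P) (hi P) (grad (lo P) (hi P) phi)
                                  (grad (lo P) (hi P) phi)
  + C2 P / (2 * eps P ^+ 2) * inner (lo P) (hi P) phi phi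
  + lam P / (2 * eps P * latent P) * inner (lo P) (hi P) T T
  + `|U| ^+ 2.

End operators.

Record butcher (R : realType) (q : nat) := Butcher {
  alpha : 'M[R]_q;
  beta : 'I_q -> R
}.

Section runge_kutta.
Variables (R : realType) (q : nat) (rk : butcher R q).

Definition gamma (i : 'I_q) : R := \sum_j alpha rk i j.

Definition stab_mx : 'M[R]_q :=
  \matrix_(i, j) (beta rk i * alpha rk i j + beta rk j * alpha rk j i
                  - beta rk i * beta rk j).

Definition pos_semidef (M : 'M[R]_q) : Prop :=
  forall x : 'cV[R]_q, 0 <= (x^T *m M *m x) ord0 ord0.

Definition algebraically_stable : Prop :=
  [/\ alpha rk \in unitmx,
      forall i, 0 < beta rk i,
      forall i j, i != j -> gamma i != gamma j,
      pos_semidef stab_mx &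
      (exists2 p, (q <= p)%N & forall l, (1 <= l <= p)%N ->
         \sum_i beta rk i * gamma i ^+ l.-1 = l%:R^-1)
      /\ (forall l i, (1 <= l <= q)%N ->
         \sum_j alpha rk i j * gamma j ^+ l.-1 = gamma i ^+ l / l%:R)].

Definition interpolant (s v : 'I_q -> R) : {poly R} :=
  \sum_j v j *: \prod_(k | k != j) ((s j - s k)^-1 *: ('X - (s k)%:P)).

Lemma size_interpolant (s v : 'I_q -> R) : (size (interpolant s v) <= q)%N.
Proof.
apply: (leq_trans (size_sum _ _ _)); apply/bigmax_leqP => j _.
apply: leq_trans (size_scale_leq _ _) _.
apply: leq_trans (size_poly_prod_leq _ _) _.
rewrite leq_subLR; apply: (@leq_trans (\sum_(k | k != j) 2).+1).
  rewrite ltnS; apply: leq_sum => k _; apply: leq_trans (size_scale_leq _ _) _.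
  by rewrite size_XsubC.
rewrite sum_nat_const (_ : #|_| = q.-1); last first.
  by rewrite -[q in RHS]card_ord -(cardC1 j); apply: eq_card => k; rewrite !inE.
by case: q j => [[]|n _] //=; rewrite muln2 -addnn addnS.
Qed.

Lemma interpolantE (s v : 'I_q -> R) (i : 'I_q) : injective s ->
  (interpolant s v).[s i] = v i.
Proof.
move=> sI; rewrite horner_sum (bigD1 i)//= [X in _ + X]big1 ?addr0; last first.
  move=> j ji; rewrite hornerZ horner_prod (bigD1 i)/=; last by rewrite eq_sym.
  by rewrite hornerZ hornerXsubC subrr !(mulr0, mul0r).
rewrite hornerZ horner_prod big1 ?mulr1// => k ki.
rewrite hornerZ !hornerE mulVf// subr_eq0.
by apply: contraNneq ki => /sI ->.
Qed.

End runge_kutta.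

Section scheme.
Variables (R : realType) (d q : nat) (P : model R d) (rk : butcher R q).
Variables (t0 dt : R) (n : nat).

Local Notation field := ('rV[R]_d -> R).
Local Notation mu := (box_measure (lo P) (hi P)).

Definition time (k : nat) : R := t0 + k%:R * dt.

(* Pi_{n-1} v_{ni}: the previous step starts at t_{n-1} = t_n - dt, also when
   n = 0. *)
Definition extrapolate (v : 'I_q -> field) (i : 'I_q) : field := fun x =>
  (interpolant (fun j => (time n - dt) + gamma rk j * dt) (fun j => v j x)).[
    time n + gamma rk i * dt].

Record step_data := StepData {
  phi_st : 'I_q -> field;
  mu_st : 'I_q -> field;
  T_st : 'I_q -> field;
  Tdot_st : 'I_q -> field;
  U_st : 'I_q -> R;
  Udot_st : 'I_q -> R;
  phi_next : field;
  T_next : field;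
  U_next : R
}.

Variables (phip Tp mup : 'I_q -> field) (phin Tn : field) (Un : R).

Local Notation Phi := (extrapolate phip).
Local Notation Th := (extrapolate Tp).
Local Notation Mu := (extrapolate mup).
Local Notation ip := (inner (lo P) (hi P)).

(* Equalities between functions hold a.e. in the domain, and Laplacians are
   L^2 functions satisfying the variational identity with periodic boundary
   conditions. *)
Definition scheme (s : step_data) : Prop :=
  [/\ forall i,
        (exists2 lap, weak_laplacian (lo P) (hi P) (phi_st s i) lap &
           mu_st s i = (fun x => C1 P * lap x
             - C2 P / eps P ^+ 2 * phi_st s i x
             - U_st s i * opG P (Phi i) x
             - U_st s i * opH P (Phi i) (Th i) x) %[ae mu])
        /\ phi_st s i = (fun x => phin x + dt / tau P *
             \sum_j alpha rk i j * mu_st s j x) %[ae mu],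
      forall i,
        Udot_st s i =
          2^-1 * ip (opG P (Phi i)) (fun x => (tau P)^-1 * mu_st s i x)
          + (2 * tau P)^-1 * ip (opH P (Phi i) (Th i)) (mu_st s i)
          - lam P / (2 * eps P * latent P) *
              ip (opP P (Phi i) (Mu i)) (T_st s i)
        /\ U_st s i = Un + dt * \sum_j alpha rk i j * Udot_st s j,
      forall i,
        (exists2 lap, weak_laplacian (lo P) (hi P) (T_st s i) lap &
           Tdot_st s i = (fun x => diffu P * lap x
             + U_st s i * opP P (Phi i) (Mu i) x) %[ae mu])
        /\ T_st s i = (fun x => Tn x + dt *
             \sum_j alpha rk i j * Tdot_st s j x) %[ae mu] &
      [/\ phi_next s = (fun x => phin x + dt / tau P *
            \sum_i beta rk i * mu_st s i x) %[ae mu],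
          U_next s = Un + dt * \sum_i beta rk i * Udot_st s i &
          T_next s = (fun x => Tn x + dt *
            \sum_i beta rk i * Tdot_st s i x) %[ae mu]]].

(* The regularity class of solutions. Square integrability of the stage values
   mu_{ni} and of the stage derivatives of T gives a meaning to the inner
   products of the scheme. *)
Definition H1_class (s : step_data) : Prop :=
  [/\ H1 (lo P) (hi P) (phi_next s), H1 (lo P) (hi P) (T_next s),
      forall i, H1 (lo P) (hi P) (phi_st s i) /\ H1 (lo P) (hi P) (T_st s i) &
      forall i, L2 (lo P) (hi P) (mu_st s i) /\ L2 (lo P) (hi P) (Tdot_st s i)].

Definition same_step (s s' : step_data) : Prop :=
  [/\ [/\ phi_next s = phi_next s' %[ae mu], T_next s = T_next s' %[ae mu] &
          U_next s = U_next s'],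
      forall i, [/\ phi_st s i = phi_st s' i %[ae mu],
                    mu_st s i = mu_st s' i %[ae mu],
                    T_st s i = T_st s' i %[ae mu] &
                    Tdot_st s i = Tdot_st s' i %[ae mu]] &
      forall i, U_st s i = U_st s' i /\ Udot_st s i = Udot_st s' i].

End scheme.

(* Main.v *)
(* The stage derivatives (mu_ni, dT_ni, dU_ni) are taken as the unknowns, in
   (H^1)^q x (H^1)^q x R^q. Testing the first stage equation with mu_ni, the
   third with T_ni and multiplying the second by 2 U_ni makes the couplings
   through U G, U H and U P cancel. With the weights beta_i the remainder is
   minus the dissipation and a nonnegative form in the matrix M, which is the
   energy law. With the weights beta_i / gamma_i the same computation makes the
   linear system coercive, so that Lax-Milgram gives existence and uniqueness:
   M >= 0 raises the order of the quadrature rule from q to 2q - 1, hence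
   gamma_i > 0, and if z_i = sum_j alpha_ij w_j is written gamma_i v(gamma_i)
   with v a polynomial of degree < q, then exactness of the rule on (t v^2)'
   gives sum_i (beta_i / gamma_i) z_i w_i
   = (sum_i beta_i v(gamma_i)^2 + v(1)^2) / 2.
   The Hilbert space H^1 requires the completeness of L^2 and the uniqueness of
   weak derivatives, i.e. the density of the periodic test functions. *)
Require Import Defs.
From mathcomp Require Import all_boot all_order all_algebra.
From mathcomp Require Import all_classical all_reals all_analysis.
From mathcomp Require Import measurable_realfun.
From mathcomp Require Import ring lra zify.
From mathcomp.real_closed Require Import polyrcf.

Import Order.TTheory GRing.Theory Num.Theory.
Import numFieldNormedType.Exports.

Local Open Scope classical_set_scope.
Local Open Scope ring_scope.

Set Implicit Arguments.
Unset Strict Implicit.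
Unset Printing Implicit Defensive.

(** * Semidefinite Hilbert spaces and the Riesz theorem *)

(** The weights beta_i alone cannot give existence: sum beta_i z_i w_i is half of the M-form plus
    half of (sum beta_i w_i)^2, which may vanish for a nonzero w (for Gauss methods M = 0). Dividing
    by gamma_i removes this degeneracy, at the price of proving gamma_i > 0, where the quadrature
    rule has to be used one degree beyond its exact range. Scalar stage inequalities are read as
    positivity of a q x q matrix; they pass to fields because such a matrix form is nonnegative
    pointwise under the integral. The unknowns lie in H^1 although the solution class asks only L^2
    of the stage derivatives: A is invertible, so H^1 stage values force H^1 derivatives.
    Conversely, the weak stage equations themselves exhibit each Laplacian as an L^2 function.
    Fields are representatives and [grad] is a choice, linear only up to null sets; hence the
    semidefinite inner products, the domain predicates and uniqueness in the a.e. sense. *)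

Lemma le0_of_small (R : realType) (K x : R) :
  0 <= K -> (forall e, 0 < e -> x <= K * e) -> x <= 0.
Proof.
move=> K0 xK; rewrite leNgt; apply/negP => x0.
have K1 : 0 < K + 1 by lra.
have := xK (x / (K + 1)) (divr_gt0 x0 K1).
rewrite leNgt => /negP; apply.
by rewrite mulrCA -ltr_pdivlMl// mulVf ?gt_eqF// ltr_pdivrMr// mul1r; lra.
Qed.

(** The discriminant criterion, evaluated at the minimiser [- b / c]. It is the common source of the
    Cauchy-Schwarz inequalities for [ip], the stability form and the Dirichlet form. *)
Lemma quadratic_ge0_discr (R : realType) (a b c : R) : 0 <= a -> 0 <= c ->
  (forall t, 0 <= a + 2 * t * b + t ^+ 2 * c) -> b ^+ 2 <= a * c.
Proof.
move=> a0 c0 H; have [c_eq0|c_neq0] := eqVneq c 0.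
  have [->|b0] := eqVneq b 0; first by rewrite expr0n mulr_ge0.
  (* For [c = 0] the expression is affine in t, and this t gives it the value -1. *)
  have := H (- (a + 1) / (2 * b)).
  rewrite c_eq0 mulr0 addr0.
  have -> : 2 * (- (a + 1) / (2 * b)) * b = - (a + 1) by field.
  by lra.
have cp : 0 < c by rewrite lt_def c_neq0.
have := H (- b / c).
have -> : a + 2 * (- b / c) * b + (- b / c) ^+ 2 * c = a - b ^+ 2 / c by field.
by rewrite subr_ge0 ler_pdivrMr.
Qed.

(* Elements of a [hspace] are representatives: [ip] is only positive
   semidefinite, so limits and Riesz representatives are unique up to null
   vectors. *)
Record hspace (R : realType) (V : lmodType R) := HSpace {
  hdom : V -> Prop;
  ip : V -> V -> R;
  hdom0 : hdom 0;
  hdomP : forall a u v, hdom u -> hdom v -> hdom (a *: u + v);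
  ipP : forall a u v w, hdom u -> hdom v -> hdom w ->
    ip (a *: u + v) w = a * ip u w + ip v w;
  ipC : forall u v, hdom u -> hdom v -> ip u v = ip v u;
  ip_ge0 : forall u, hdom u -> 0 <= ip u u;
  ip_complete : forall u : nat -> V, (forall n, hdom (u n)) ->
    (forall e, 0 < e -> exists N, forall m n, (N <= m)%N -> (N <= n)%N ->
      ip (u m - u n) (u m - u n) < e) ->
    exists2 l, hdom l & forall e, 0 < e -> exists N, forall n, (N <= n)%N ->
      ip (u n - l) (u n - l) < e
}.

Section hspace_theory.
Context (R : realType) (V : lmodType R) (X : hspace V).
Implicit Types u v w : V.

Lemma hdomZ a u : hdom X u -> hdom X (a *: u).
Proof. by move=> uX; rewrite -[_ *: _]addr0; apply: hdomP => //; exact: hdom0. Qed.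

Lemma hdomD u v : hdom X u -> hdom X v -> hdom X (u + v).
Proof. by move=> uX vX; rewrite -[u]scale1r; exact: hdomP. Qed.

Lemma hdomN u : hdom X u -> hdom X (- u).
Proof. by move=> uX; rewrite -scaleN1r; exact: hdomZ. Qed.

Lemma hdomB u v : hdom X u -> hdom X v -> hdom X (u - v).
Proof. by move=> uX vX; apply: hdomD => //; exact: hdomN. Qed.

Lemma ip0l w : hdom X w -> ip X 0 w = 0.
Proof.
move=> wX; have := ipP 1 (hdom0 X) (hdom0 X) wX.
rewrite scale1r addr0 mul1r => /eqP.
by rewrite -subr_eq0 opprD addrA subrr add0r oppr_eq0 => /eqP.
Qed.

Lemma ipZl a u w : hdom X u -> hdom X w -> ip X (a *: u) w = a * ip X u w.
Proof.
move=> uX wX; rewrite -[a *: u]addr0 ipP//; last exact: hdom0.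
by rewrite ip0l// addr0.
Qed.

Lemma ipDl u v w : hdom X u -> hdom X v -> hdom X w ->
  ip X (u + v) w = ip X u w + ip X v w.
Proof. by move=> uX vX wX; rewrite -[u in LHS]scale1r ipP// mul1r. Qed.

Lemma ipBl u v w : hdom X u -> hdom X v -> hdom X w ->
  ip X (u - v) w = ip X u w - ip X v w.
Proof.
move=> uX vX wX; rewrite ipDl//; last exact: hdomN.
by rewrite -scaleN1r ipZl// mulN1r.
Qed.

Lemma ipPr a u v w : hdom X u -> hdom X v -> hdom X w ->
  ip X w (a *: u + v) = a * ip X w u + ip X w v.
Proof.
move=> uX vX wX.
by rewrite ipC ?ipP// ?(@ipC _ _ X _ w)//; exact: hdomP.
Qed.

Lemma ipZr a u w : hdom X u -> hdom X w -> ip X w (a *: u) = a * ip X w u.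
Proof.
by move=> uX wX; rewrite ipC ?ipZl// ?(@ipC _ _ X _ w)//; exact: hdomZ.
Qed.

Lemma ipDr u v w : hdom X u -> hdom X v -> hdom X w ->
  ip X w (u + v) = ip X w u + ip X w v.
Proof.
by move=> uX vX wX; rewrite ipC ?ipDl// ?(@ipC _ _ X _ w)//; exact: hdomD.
Qed.

Lemma ipBr u v w : hdom X u -> hdom X v -> hdom X w ->
  ip X w (u - v) = ip X w u - ip X w v.
Proof.
by move=> uX vX wX; rewrite ipC ?ipBl// ?(@ipC _ _ X _ w)//; exact: hdomB.
Qed.

Lemma ip_sqrD u v : hdom X u -> hdom X v ->
  ip X (u + v) (u + v) = ip X u u + 2 * ip X u v + ip X v v.
Proof.
move=> uX vX; rewrite ipDl ?ipDr// ?(ipC vX uX); first by ring.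
exact: hdomD.
Qed.

Lemma ip_sqrB u v : hdom X u -> hdom X v ->
  ip X (u - v) (u - v) = ip X u u - 2 * ip X u v + ip X v v.
Proof.
move=> uX vX; rewrite ipBl ?ipBr// ?(ipC vX uX); first by ring.
exact: hdomB.
Qed.

Lemma ip_cauchy_schwarz u v : hdom X u -> hdom X v ->
  ip X u v ^+ 2 <= ip X u u * ip X v v.
Proof.
move=> uX vX; apply: quadratic_ge0_discr => [||t]; [exact: ip_ge0..|].
have tvX := hdomZ t vX.
have := ip_ge0 (hdomD uX tvX).
rewrite ip_sqrD// !ipZl// !ipZr//.
by move=> H; apply: le_trans H _; rewrite le_eqVlt; apply/orP; left; apply/eqP; ring.
Qed.

Definition ipnorm u := Num.sqrt (ip X u u).

Lemma ipnorm_ge0 u : 0 <= ipnorm u. Proof. exact: sqrtr_ge0. Qed.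

Lemma ipnorm_sqr u : hdom X u -> ipnorm u ^+ 2 = ip X u u.
Proof. by move=> uX; rewrite sqr_sqrtr//; exact: ip_ge0. Qed.

Lemma ip_le_ipnorm u v : hdom X u -> hdom X v ->
  `|ip X u v| <= ipnorm u * ipnorm v.
Proof.
move=> uX vX; rewrite -ler_sqr ?nnegrE ?mulr_ge0 ?ipnorm_ge0//.
by rewrite -normrX ger0_norm ?sqr_ge0// exprMn !ipnorm_sqr// ip_cauchy_schwarz.
Qed.

Lemma ipnormZ a u : hdom X u -> ipnorm (a *: u) = `|a| * ipnorm u.
Proof.
move=> uX; rewrite /ipnorm ipZl ?ipZr//; last exact: hdomZ.
by rewrite mulrA -expr2 sqrtrM ?sqr_ge0// sqrtr_sqr.
Qed.

Lemma ipnormD u v : hdom X u -> hdom X v -> ipnorm (u + v) <= ipnorm u + ipnorm v.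
Proof.
move=> uX vX; have uvX := hdomD uX vX.
rewrite -ler_sqr ?nnegrE ?addr_ge0 ?ipnorm_ge0// sqrrD !ipnorm_sqr//.
rewrite ip_sqrD//.
have := ler_norm (ip X u v); have := ip_le_ipnorm uX vX.
set n := ipnorm u * ipnorm v; set m := ip X u v; set m' := `|m|.
by move=> *; rewrite mulr2n; lra.
Qed.

(** The representative is a limit of a minimising sequence of [J u = ip u u - 2 * l u], which the
    bound on [l] keeps above [- C]. That bound is stated with squares to avoid norms. *)
Theorem riesz (l : V -> R) (C : R) :
  (forall a u v, hdom X u -> hdom X v -> l (a *: u + v) = a * l u + l v) ->
  (forall u, hdom X u -> l u ^+ 2 <= C * ip X u u) -> 0 <= C ->
  exists2 w, hdom X w & forall v, hdom X v -> ip X w v = l v.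
Proof.
move=> lP lC C0.
pose J u := ip X u u - 2 * l u.
have J_ge u : hdom X u -> - C <= J u.
  move=> uX; have := lC _ uX; have := ip_ge0 uX; rewrite /J.
  set i := ip X u u; set x := l u => i0 xC.
  have [x0|x0] := leP x 0; first by lra.
  have : (2 * x) ^+ 2 <= (i + C) ^+ 2.
    by apply: (@le_trans _ _ (4 * C * i)); [nra|have := sqr_ge0 (i - C); nra].
  by rewrite ler_sqr ?nnegrE ?addr_ge0//; lra.
pose m := inf [set J u | u in hdom X].
have Jlb : has_lbound [set J u | u in hdom X].
  by exists (- C) => _ [u uX <-]; exact: J_ge.
have Jm u : hdom X u -> m <= J u by move=> uX; apply: ge_inf => //; exists u.
have /(_ _)/cid2 appr k : exists2 u, hdom X u & J u < m + k.+1%:R^-1.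
  have hinf : has_inf [set J u | u in hdom X].
    by split=> //; exists (J 0); exists 0 => //; exact: hdom0.
  by have [_ [u uX <-] Ju] := inf_adherent [gt0 of k.+1%:R^-1 : R] hinf; exists u.
pose u k := sval (appr k).
have uX k : hdom X (u k) by rewrite /u; case: (appr k).
have uJ k : J (u k) < m + k.+1%:R^-1 by rewrite /u; case: (appr k).
(* Parallelogram identity: the left side equals 2 J(u p) + 2 J(u q) - 4 J(midpoint), and J is at
   least m at the midpoint. *)
have uC p q : ip X (u p - u q) (u p - u q) <= 2 * p.+1%:R^-1 + 2 * q.+1%:R^-1.
  have := Jm _ (hdomZ 2^-1 (hdomD (uX p) (uX q))).
  have := uJ p; have := uJ q; rewrite /J.
  have l2 : l (2^-1 *: (u p + u q)) = 2^-1 * (l (u p) + l (u q)).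
    rewrite -[2^-1 *: _]addr0 lP; [|exact: hdomD|exact: hdom0].
    rewrite -[u p in LHS]scale1r lP// mul1r.
    have := lP 1 0 0 (hdom0 X) (hdom0 X).
    by rewrite scale1r addr0 mul1r => ?; lra.
  have pq := hdomD (uX p) (uX q).
  rewrite ip_sqrB// l2 ipZl ?ipZr ?ip_sqrD//; last exact: hdomZ.
  by move: p.+1%:R^-1 q.+1%:R^-1 => rp rq; lra.
have inv_small (e : R) : 0 < e -> exists N, forall k, (N <= k)%N -> k.+1%:R^-1 < e.
  move=> e0; have [N _ HN] := (near_infty_natSinv_lt (PosNum e0)).
  by exists N => k Nk; exact: HN.
have [w wX uw] : exists2 w, hdom X w & forall e, 0 < e ->
    exists N, forall n, (N <= n)%N -> ip X (u n - w) (u n - w) < e.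
  apply: ip_complete => // e e0.
  have [N HN] := inv_small _ (divr_gt0 e0 (ltr0n _ 4)).
  exists N => p q Np Nq; apply: le_lt_trans (uC p q) _.
  by move: (HN _ Np) (HN _ Nq); move: p.+1%:R^-1 q.+1%:R^-1 => rp rq; lra.
exists w => // v vX.
(* Approximate Euler equation: J(u k + t v) >= m for every t, while J(u k) exceeds m by less than
   1/(k+1), so the discriminant of the resulting quadratic in t is controlled. *)
have beta k : (ip X (u k) v - l v) ^+ 2 <= k.+1%:R^-1 * ip X v v.
  apply: quadratic_ge0_discr => // [|t]; first exact: ip_ge0.
  have tvX := hdomZ t vX.
  have := Jm _ (hdomP t vX (uX k)); have := uJ k; rewrite /J lP//.
  rewrite ip_sqrD// !ipZl// !ipZr// (ipC vX (uX k)).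
  by move: k.+1%:R^-1 => r; nra.
apply/eqP; rewrite -subr_eq0 -sqrf_eq0 eq_le sqr_ge0 andbT.
(* 4 = 2 + 2: the squared defect is at most twice the Euler defect of [u k] squared plus twice the
   square of [ip (u k - w) v], each square being at most [e * ip v v]. *)
apply: (@le0_of_small _ (4 * ip X v v)); first by rewrite mulr_ge0// ip_ge0.
move=> e e0; have [N1 HN1] := inv_small _ e0; have [N2 HN2] := uw _ e0.
pose k := maxn N1 N2.
have k1 := HN1 k (leq_maxl _ _); have k2 := HN2 k (leq_maxr _ _).
have := ip_cauchy_schwarz (hdomB (uX k) wX) vX; have := beta k.
rewrite ipBl//; have := ip_ge0 vX.
set x := ip X (u k) v; set y := ip X w v; set nv := ip X v v.
set z := ip X _ _ in k2 *; set r := _^-1 in k1 *; set lv := l v.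
move=> nv0 h1 h2.
have : (y - lv) ^+ 2 <= 2 * (x - lv) ^+ 2 + 2 * (x - y) ^+ 2.
  by have := sqr_ge0 ((x - lv) + (x - y)); nra.
have : r * nv <= e * nv by rewrite ler_wpM2r// ltW.
have : z * nv <= e * nv by rewrite ler_wpM2r// ltW.
by lra.
Qed.

End hspace_theory.

(** * Bounded forms and the Lax-Milgram theorem *)

Section bounded_maps.
Context (R : realType).

Definition blin (V W : lmodType R) (X : hspace V) (Y : hspace W) (f : V -> W) :=
  [/\ forall u, hdom X u -> hdom Y (f u),
      forall a u v, hdom X u -> hdom X v -> f (a *: u + v) = a *: f u + f v &
      exists2 C, 0 <= C & forall u, hdom X u -> ipnorm Y (f u) <= C * ipnorm X u].

Definition bform (V W : lmodType R) (X : hspace V) (Y : hspace W)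
    (b : V -> W -> R) :=
  [/\ forall a u v w, hdom X u -> hdom X v -> hdom Y w ->
        b (a *: u + v) w = a * b u w + b v w,
      forall a u v w, hdom X u -> hdom Y v -> hdom Y w ->
        b u (a *: v + w) = a * b u v + b u w &
      exists2 C, 0 <= C & forall u v, hdom X u -> hdom Y v ->
        `|b u v| <= C * (ipnorm X u * ipnorm Y v)].

Lemma blin_comp (V W Z : lmodType R) (X : hspace V) (Y : hspace W)
    (S : hspace Z) f g : blin X Y f -> blin Y S g -> blin X S (g \o f).
Proof.
move=> [fd fl [C C0 fC]] [gd gl [D D0 gD]]; split=> [u uX|a u v uX vX|] /=.
- exact/gd/fd.
- by rewrite fl// gl//; exact: fd.
- exists (D * C) => [|u uX /=]; first exact: mulr_ge0.
  by rewrite -mulrA; apply: le_trans (gD _ (fd _ uX)) _; rewrite ler_wpM2l// fC.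
Qed.

Lemma blin_add (V W : lmodType R) (X : hspace V) (Y : hspace W) f g :
  blin X Y f -> blin X Y g -> blin X Y (fun u => f u + g u).
Proof.
move=> [fd fl [C C0 fC]] [gd gl [D D0 gD]]; split=> [u uX|a u v uX vX|].
- by apply: hdomD; [exact: fd|exact: gd].
- by rewrite fl// gl// scalerDr addrACA.
- exists (C + D) => [|u uX /=]; first exact: addr_ge0.
  apply: le_trans (ipnormD (fd _ uX) (gd _ uX)) _.
  by rewrite mulrDl lerD ?fC ?gD.
Qed.

Lemma blin_scale (V W : lmodType R) (X : hspace V) (Y : hspace W) f k :
  blin X Y f -> blin X Y (fun u => k *: f u).
Proof.
move=> [fd fl [C C0 fC]]; split=> [u uX|a u v uX vX|].
- by apply: hdomZ; exact: fd.
- by rewrite fl// scalerDr !scalerA mulrC.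
- exists (`|k| * C) => [|u uX]; first exact: mulr_ge0.
  rewrite ipnormZ; last exact: fd.
  by rewrite -mulrA ler_wpM2l// fC.
Qed.

Lemma blin_sum (V W : lmodType R) (X : hspace V) (Y : hspace W) (I : Type)
    (r : seq I) (f : I -> V -> W) :
  (forall i, blin X Y (f i)) -> blin X Y (fun u => \sum_(i <- r) f i u).
Proof.
move=> fb; elim: r => [|i r IH].
  split=> [u uX|a u v uX vX|]; first by rewrite big_nil; exact: hdom0.
    by rewrite !big_nil scaler0 addr0.
  exists 0 => // u uX; rewrite big_nil mul0r.
  by rewrite /ipnorm ip0l ?sqrtr0//; exact: hdom0.
under eq_fun do rewrite big_cons.
exact: blin_add.
Qed.

Lemma bform_add (V W : lmodType R) (X : hspace V) (Y : hspace W) b c :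
  bform X Y b -> bform X Y c -> bform X Y (fun u v => b u v + c u v).
Proof.
move=> [bl br [C C0 bC]] [cl cr [D D0 cD]]; split=> [a u v w uX vX wY|a u v w uX vY wY|].
- by rewrite bl// cl//; ring.
- by rewrite br// cr//; ring.
- exists (C + D) => [|u v uX vY]; first exact: addr_ge0.
  by rewrite mulrDl; apply: le_trans (ler_normD _ _) (lerD _ _); [exact: bC|exact: cD].
Qed.

Lemma bform_scale (V W : lmodType R) (X : hspace V) (Y : hspace W) k b :
  bform X Y b -> bform X Y (fun u v => k * b u v).
Proof.
move=> [bl br [C C0 bC]]; split=> [a u v w uX vX wY|a u v w uX vY wY|].
- by rewrite bl//; ring.
- by rewrite br//; ring.
- exists (`|k| * C) => [|u v uX vY]; first exact: mulr_ge0.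
  by rewrite normrM -mulrA ler_wpM2l// bC.
Qed.

Lemma bform_sum (V W : lmodType R) (X : hspace V) (Y : hspace W) (I : Type)
    (r : seq I) (b : I -> V -> W -> R) :
  (forall i, bform X Y (b i)) -> bform X Y (fun u v => \sum_(i <- r) b i u v).
Proof.
move=> bb; elim: r => [|i r IH].
  split=> [a u v w uX vX wY|a u v w uX vY wY|].
  - by rewrite !big_nil mulr0 addr0.
  - by rewrite !big_nil mulr0 addr0.
  - by exists 0 => // u v uX vY; rewrite big_nil mul0r normr0.
rewrite (_ : (fun u v => _) = fun u v => b i u v + \sum_(j <- r) b j u v).
  exact: bform_add.
by apply/funext => u; apply/funext => v; rewrite big_cons.
Qed.

Lemma bform_comp (V W V' W' : lmodType R) (X : hspace V) (Y : hspace W)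
    (X' : hspace V') (Y' : hspace W') f g b :
  blin X X' f -> blin Y Y' g -> bform X' Y' b ->
  bform X Y (fun u v => b (f u) (g v)).
Proof.
move=> [fd fl [C C0 fC]] [gd gl [D D0 gD]] [bl br [E E0 bE]].
split=> [a u v w uX vX wY|a u v w uX vY wY|].
- by rewrite fl// bl//; [exact: fd..|exact: gd].
- by rewrite gl// br//; [exact: fd|exact: gd..].
- exists (E * (C * D)) => [|u v uX vY]; first by rewrite !mulr_ge0.
  apply: le_trans (bE _ _ (fd _ uX) (gd _ vY)) _.
  rewrite -mulrA ler_wpM2l// mulrACA ler_pM ?ipnorm_ge0//; first exact: fC.
  exact: gD.
Qed.

Lemma bform_ip (V : lmodType R) (X : hspace V) : bform X X (ip X).
Proof.
split=> [a u v w uX vX wX|a u v w uX vX wX|].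
- exact: ipP.
- exact: ipPr.
- by exists 1 => // u v uX vX; rewrite mul1r; exact: ip_le_ipnorm.
Qed.

(* Let B represent b, i.e. ip (B u) v = b u v. Riesz for ip (B u) (B v) gives u
   with B u - f orthogonal to the range of B; by coercivity of b on B u - f, this
   vector is null. *)
Theorem lax_milgram (V : lmodType R) (X : hspace V) (b : V -> V -> R)
    (l : V -> R) (c C : R) :
  bform X X b -> 0 < c -> (forall u, hdom X u -> c * ip X u u <= b u u) ->
  (forall a u v, hdom X u -> hdom X v -> l (a *: u + v) = a * l u + l v) ->
  0 <= C -> (forall u, hdom X u -> `|l u| <= C * ipnorm X u) ->
  exists2 u, hdom X u & forall v, hdom X v -> b u v = l v.
Proof.
move=> [bl br [D D0 bD]] c0 bc ll C0 lC.
have sqr_bound (K : R) (h : V -> R) : 0 <= K ->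
    (forall v, hdom X v -> `|h v| <= K * ipnorm X v) ->
    forall v, hdom X v -> h v ^+ 2 <= K ^+ 2 * ip X v v.
  move=> K0 hK v vX; rewrite -ipnorm_sqr// -exprMn -[leLHS]ger0_norm ?sqr_ge0//.
  by rewrite normrX ler_sqr ?nnegrE ?mulr_ge0 ?ipnorm_ge0// hK.
have [f fX fl] : exists2 f, hdom X f & forall v, hdom X v -> ip X f v = l v.
  by apply: (@riesz _ _ X l (C ^+ 2) ll); [exact: sqr_bound|exact: sqr_ge0].
have /choice[B BP] : forall u, exists w, hdom X u ->
    hdom X w /\ forall v, hdom X v -> ip X w v = b u v.
  move=> u; case: (pselect (hdom X u)) => [uX|nuX]; last by exists 0 => /nuX.
  have [|||w wX wb] := @riesz _ _ X (b u) ((D * ipnorm X u) ^+ 2); last 1 first.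
  - by exists w.
  - by move=> a v w vX wX; rewrite br.
  - apply: sqr_bound => [|v vX]; first by rewrite mulr_ge0 ?ipnorm_ge0.
    by rewrite -mulrA bD.
  - exact: sqr_ge0.
have BX u : hdom X u -> hdom X (B u) by move=> /BP[].
have BE u v : hdom X u -> hdom X v -> ip X (B u) v = b u v by move=> /BP[_]; apply.
(* [B] is a mere choice, not shown to be linear; [s] is nevertheless linear on the left because
   [s u v = b u (B v)], and it is symmetric. By [s_ge] and [s_le] it is equivalent to [ip], hence
   complete, so that [riesz] applies to it. *)
pose s u v := ip X (B u) (B v).
have sE u v : hdom X u -> hdom X v -> s u v = b u (B v).
  by move=> uX vX; rewrite /s BE//; exact: BX.
have sC u v : hdom X u -> hdom X v -> s u v = s v u.
  by move=> uX vX; rewrite /s ipC//; exact: BX.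
have s_ge u : hdom X u -> c ^+ 2 * ip X u u <= s u u.
  move=> uX; have := ip_cauchy_schwarz (BX _ uX) uX; rewrite BE// -/(s u u).
  have s0 : 0 <= s u u by apply: ip_ge0; exact: BX.
  have := bc _ uX; have := ip_ge0 uX; rewrite le_eqVlt => /orP[/eqP<-|i0].
    by rewrite !mulr0.
  move=> h1 h2; rewrite -(ler_pM2r i0) -mulrA -expr2 -exprMn.
  by apply: le_trans h2; rewrite ler_sqr ?nnegrE//; [nra|apply: le_trans h1; nra].
have s_le u : hdom X u -> s u u <= D ^+ 2 * ip X u u.
  move=> uX; have := bD _ _ uX (BX _ uX); rewrite -sE//.
  have s0 : 0 <= s u u by apply: ip_ge0; exact: BX.
  rewrite ger0_norm// mulrA; move: (s0); rewrite /s -!ipnorm_sqr//; last exact: BX.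
  have := ipnorm_ge0 X (B u); have := ipnorm_ge0 X u.
  move: (ipnorm X (B u)) (ipnorm X u) => x y y0.
  rewrite le_eqVlt => /orP[/eqP<- _ _|x0 _]; first by rewrite expr0n /= mulr_ge0 ?sqr_ge0.
  rewrite expr2 ler_pM2r// => xy.
  by rewrite -[D ^+ 2 * _]exprMn ler_pM// ltW.
have [S [SX SE]] : exists S : hspace V, hdom S = hdom X /\ ip S = s.
  unshelve eexists.
    refine (@HSpace R V (hdom X) s (hdom0 X) (@hdomP _ _ X) _ sC _ _).
  - by move=> a u v w uX vX wX; rewrite !sE ?bl//; [exact: BX|exact: hdomP].
  - by move=> u uX; apply: ip_ge0; exact: BX.
  - move=> u uX uC.
    have [e e0|w wX uw] := @ip_complete _ _ X u uX.
      have [N HN] := uC (c ^+ 2 * e) (mulr_gt0 (exprn_gt0 2 c0) e0).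
      exists N => m n Nm Nn; have := HN _ _ Nm Nn.
      have := s_ge _ (hdomB (uX m) (uX n)) => h1 h2.
      by have := le_lt_trans h1 h2; rewrite ltr_pM2l// exprn_gt0.
    exists w => // e e0.
    have D1 : 0 < D ^+ 2 + 1 by rewrite ltr_wpDl// sqr_ge0.
    have [N HN] := uw (e / (D ^+ 2 + 1)) (divr_gt0 e0 D1).
    exists N => n Nn; have := HN _ Nn; rewrite ltr_pdivlMr// => h.
    apply: le_lt_trans (s_le _ (hdomB (uX n) wX)) _; apply: le_lt_trans h.
    by have := ip_ge0 (hdomB (uX n) wX); nra.
  by split.
have [|||u uX us] := @riesz _ _ S (fun v => b v f) (ip X f f);
  rewrite ?SX ?SE.
- by move=> a u v uX vX; rewrite bl.
- move=> u uX; rewrite -BE// mulrC; apply: ip_cauchy_schwarz => //; exact: BX.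
- exact: ip_ge0.
rewrite SX in uX; exists u => // v vX.
have zX : hdom X (B u - f) by apply: hdomB => //; exact: BX.
have zz : ip X (B u - f) (B u - f) = 0.
  apply/eqP; rewrite eq_le ip_ge0// andbT.
  rewrite -(pmulr_rle0 _ c0); apply: le_trans (bc _ zX) _.
  have uz : s u (B u - f) = b (B u - f) f.
    by have := us; rewrite SX SE; apply.
  rewrite -BE// ipBr ?BE//; [|exact: BX..].
  by rewrite -sE// sC// uz subrr.
have := ip_cauchy_schwarz zX vX; rewrite zz mul0r.
rewrite le_eqVlt ltNge sqr_ge0 orbF sqrf_eq0 ipBl//; last exact: BX.
by rewrite BE// fl// subr_eq0 => /eqP.
Qed.

End bounded_maps.

(** * Products of Hilbert spaces *)

Section hspace_constructions.
Context (R : realType).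

Lemma real_ip_complete (u : nat -> R) :
  (forall e, 0 < e -> exists N, forall m n, (N <= m)%N -> (N <= n)%N ->
     (u m - u n) * (u m - u n) < e) ->
  exists l, forall e, 0 < e -> exists N, forall n, (N <= n)%N ->
    (u n - l) * (u n - l) < e.
Proof.
have sqr_lt (x e : R) : 0 < e -> x * x < e ^+ 2 -> `|x| < e.
  move=> e0; rewrite -expr2 -[X in X < _]ger0_norm ?sqr_ge0// normrX.
  by rewrite ltr_sqr ?nnegrE// ltW.
move=> uC; have ucvg : cvgn u.
  apply/cauchy_cvgP/cauchy_exP => e e0.
  have [N HN] := uC _ (exprn_gt0 2 e0).
  exists (u N), N => // n /= Nn; rewrite /ball /=; apply: sqr_lt => //.
  exact: HN.
exists (limn u) => e e0.
have e1 : 0 < Num.sqrt e by rewrite sqrtr_gt0.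
have /cvgrPdist_lt/(_ _ e1)[N _ HN] := ucvg.
exists N => n Nn; have := HN n Nn; rewrite distrC => h.
by rewrite -expr2 -real_normK ?num_real// -[ltRHS](sqr_sqrtr (ltW e0)) ltr_sqr ?nnegrE ?sqrtr_ge0.
Qed.

Definition hreal : hspace (R : lmodType R).
Proof.
apply: (@HSpace R R (fun=> True) (fun x y => x * y)) => //.
- by move=> a u v w _ _ _ /=; rewrite mulrDl -mulrA.
- by move=> u v _ _; exact: mulrC.
- by move=> u _; rewrite -expr2 sqr_ge0.
- by move=> u _ /real_ip_complete[l ul]; exists l.
Defined.

Section hfun.
Context (I : finType) (V : lmodType R) (X : hspace V).

Definition hfun_dom (u : I -> V) := forall i, hdom X (u i).
Definition hfun_ip (u v : I -> V) := \sum_i ip X (u i) (v i).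

Definition hfun : hspace (I -> V).
Proof.
apply: (@HSpace R (I -> V) hfun_dom hfun_ip).
- by move=> i; exact: hdom0.
- by move=> a u v uX vX i; exact: hdomP.
- move=> a u v w uX vX wX; rewrite /hfun_ip mulr_sumr -big_split/=.
  by apply: eq_bigr => i _; rewrite ipP.
- by move=> u v uX vX; apply: eq_bigr => i _; rewrite ipC.
- by move=> u uX; apply: sumr_ge0 => i _; exact: ip_ge0.
- move=> u uX uC.
  have comp i : exists w, hdom X w /\ forall e, 0 < e -> exists N, forall n,
      (N <= n)%N -> ip X (u n i - w) (u n i - w) < e.
    have [|e e0|w wX uw] := @ip_complete _ _ X (fun n => u n i).
    - by move=> n; exact: uX.
    - have [N HN] := uC _ e0; exists N => m n Nm Nn.
      apply: le_lt_trans (HN _ _ Nm Nn); rewrite /hfun_ip (bigD1 i)//= lerDl.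
      by apply: sumr_ge0 => j _; apply/ip_ge0/hdomB; exact: uX.
    - by exists w.
  have /choice[w wP] := comp; exists w => [i|e e0]; first by have [] := wP i.
  have I1 : 0 < #|I|%:R + 1 :> R by rewrite ltr_wpDl.
  have /choice[N HN] : forall i, exists N, forall n, (N <= n)%N ->
      ip X (u n i - w i) (u n i - w i) < e / (#|I|%:R + 1).
    by move=> i; have [_ +] := wP i; apply; exact: divr_gt0.
  exists (\max_i N i)%N => n Nn.
  apply: (@le_lt_trans _ _ (\sum_(i : I) e / (#|I|%:R + 1))).
    apply: ler_sum => i _; apply/ltW/HN; apply: leq_trans Nn.
    exact: leq_bigmax.
  rewrite sumr_const -[ltLHS]mulr_natr -mulrA -[ltRHS]mulr1 ltr_pM2l//.
  by rewrite mulrC ltr_pdivrMr// mul1r ltrDl.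
Defined.

Lemma blin_proj i : blin hfun X (fun u => u i).
Proof.
split=> [u|a u v|]; [exact|by []|].
exists 1 => // u uX; rewrite mul1r ler_wsqrtr// /= /hfun_ip (bigD1 i)//= lerDl.
by apply: sumr_ge0 => j _; exact: ip_ge0.
Qed.

End hfun.

Section hprod.
Context (V W : lmodType R) (X : hspace V) (Y : hspace W).

Definition hprod_dom (u : V * W) := hdom X u.1 /\ hdom Y u.2.
Definition hprod_ip (u v : V * W) := ip X u.1 v.1 + ip Y u.2 v.2.

Definition hprod : hspace (V * W)%type.
Proof.
apply: (@HSpace R (V * W)%type hprod_dom hprod_ip).
- by split; exact: hdom0.
- by move=> a u v [? ?] [? ?]; split; exact: hdomP.
- move=> a u v w [? ?] [? ?] [? ?]; rewrite /hprod_ip/= !ipP//; by ring.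
- by move=> u v [? ?] [? ?]; congr +%R; rewrite ipC.
- by move=> u [? ?]; apply: addr_ge0; exact: ip_ge0.
- move=> u uX uC.
  have [|e e0|w wX uw] := @ip_complete _ _ X (fun n => (u n).1).
  - by move=> n; have [] := uX n.
  - have [N HN] := uC _ e0; exists N => m n Nm Nn.
    apply: le_lt_trans (HN _ _ Nm Nn); rewrite /hprod_ip/= lerDl.
    by apply/ip_ge0/hdomB; [have [] := uX m|have [] := uX n].
  have [|e e0|z zX uz] := @ip_complete _ _ Y (fun n => (u n).2).
  - by move=> n; have [] := uX n.
  - have [N HN] := uC _ e0; exists N => m n Nm Nn.
    apply: le_lt_trans (HN _ _ Nm Nn); rewrite /hprod_ip/= lerDr.
    by apply/ip_ge0/hdomB; [have [] := uX m|have [] := uX n].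
  exists (w, z) => // e e0; have e2 : 0 < e / 2 by rewrite divr_gt0.
  have [M HM] := uw _ e2; have [N HN] := uz _ e2.
  exists (maxn M N) => n; rewrite geq_max => /andP[Mn Nn].
  by rewrite [ltRHS]splitr ltrD ?HM ?HN.
Defined.

Lemma blin_fst : blin hprod X fst.
Proof.
split=> [u []|a u v|]; [exact|by []|].
exists 1 => // u [uX uY]; rewrite mul1r ler_wsqrtr// lerDl; exact: ip_ge0.
Qed.

Lemma blin_snd : blin hprod Y snd.
Proof.
split=> [u []|a u v|]; [by []|by []|].
exists 1 => // u [uX uY]; rewrite mul1r ler_wsqrtr// lerDr; exact: ip_ge0.
Qed.

End hprod.
End hspace_constructions.

(** * Algebraically stable Runge-Kutta methods *)

Section stable_runge_kutta.
Context (R : realType) (q : nat) (rk : butcher R q).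
Hypotheses (q0 : (0 < q)%N) (hrk : algebraically_stable rk).

Local Notation A := (alpha rk).
Local Notation b := (beta rk).
Local Notation gam := (gamma rk).

Definition rk_sum (w : 'I_q -> R) (i : 'I_q) := \sum_j A i j * w j.

(** The bilinear form of the matrix M, written through Runge-Kutta sums so that the order conditions
    evaluate it on powers of the nodes. *)
Definition stab_form (x y : 'I_q -> R) :=
  \sum_i b i * x i * rk_sum y i + \sum_i b i * y i * rk_sum x i
  - (\sum_i b i * x i) * (\sum_i b i * y i).

Lemma stab_formE x y :
  stab_form x y = \sum_i \sum_j stab_mx rk i j * (x i * y j).
Proof.
rewrite /stab_form mulr_suml (eq_bigr (fun i => \sum_j b i * x i * (A i j * y j))); last first.
  by move=> i _; rewrite /rk_sum mulr_sumr.
rewrite [X in _ + X - _](eq_bigr (fun i => \sum_j b i * y i * (A i j * x j))); last first.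
  by move=> i _; rewrite /rk_sum mulr_sumr.
rewrite [X in _ + X - _]exchange_big/= -big_split -sumrB; apply: eq_bigr => i _.
rewrite mulr_sumr -big_split -sumrB; apply: eq_bigr => j _.
by rewrite /= mxE; ring.
Qed.

Lemma stab_form_ge0 x : 0 <= stab_form x x.
Proof.
have [_ _ _ /(_ (\col_i x i)) + _] := hrk.
rewrite mxE stab_formE => H; apply: le_trans H _.
rewrite le_eqVlt; apply/orP; left; apply/eqP.
rewrite exchange_big/=; apply: eq_bigr => i _.
rewrite [X in X * _]mxE mulr_suml; apply: eq_bigr => j _.
by rewrite !mxE; ring.
Qed.

Lemma stab_form_sqr_le x y :
  stab_form x y ^+ 2 <= stab_form x x * stab_form y y.
Proof.
apply: quadratic_ge0_discr => [||t]; [exact: stab_form_ge0..|].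
have := stab_form_ge0 (fun i => x i + t * y i).
suff -> : stab_form (fun i => x i + t * y i) (fun i => x i + t * y i) =
  stab_form x x + 2 * t * stab_form x y + t ^+ 2 * stab_form y y by [].
have lin u i : rk_sum (fun i => u i + t * y i) i = rk_sum u i + t * rk_sum y i.
  rewrite /rk_sum mulr_sumr -big_split; apply: eq_bigr => j _ /=; ring.
have lin1 : \sum_i b i * (x i + t * y i) = \sum_i b i * x i + t * \sum_i b i * y i.
  by rewrite mulr_sumr -big_split; apply: eq_bigr => j _ /=; ring.
rewrite /stab_form lin1.
have -> : \sum_i b i * (x i + t * y i) * rk_sum (fun i => x i + t * y i) i =
  \sum_i b i * x i * rk_sum x i
  + t * (\sum_i b i * x i * rk_sum y i + \sum_i b i * y i * rk_sum x i)
  + t ^+ 2 * \sum_i b i * y i * rk_sum y i.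
  rewrite mulrDr !mulr_sumr -!big_split; apply: eq_bigr => j _ /=.
  by rewrite lin; ring.
by ring.
Qed.

(** The quadrature rule applied to t^m; it is exact on [0, 1] when the value is 1/(m+1). *)
Definition quad (m : nat) := \sum_i b i * gam i ^+ m.

Lemma rk_sum_exp l i : (l < q)%N ->
  rk_sum (fun j => gam j ^+ l) i = gam i ^+ l.+1 / l.+1%:R.
Proof. by move=> lq; have [_ _ _ _ [_ H]] := hrk; exact: (H l.+1). Qed.

Lemma stab_form_exp k l : (k < q)%N -> (l < q)%N ->
  stab_form (fun i => gam i ^+ k) (fun i => gam i ^+ l) =
  quad (k + l).+1 / l.+1%:R + quad (k + l).+1 / k.+1%:R - quad k * quad l.
Proof.
move=> kq lq; rewrite /stab_form /quad !mulr_suml; congr (_ + _ - _).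
- apply: eq_bigr => i _; rewrite rk_sum_exp// -addnS exprD; ring.
- apply: eq_bigr => i _; rewrite rk_sum_exp// -addSn exprD; ring.
Qed.

Lemma quad_low m : (m < q)%N -> quad m = m.+1%:R^-1.
Proof.
move=> mq; have [_ _ _ _ [[p qp H] _]] := hrk.
by apply: (H m.+1); rewrite /= (leq_trans mq).
Qed.

(* A zero diagonal entry of the positive semidefinite form in the basis of
   monomials forces the whole row to vanish, which raises the quadrature order
   from q to 2q - 1. *)
Lemma quad_exact m : (m < q.*2.-1)%N -> quad m = m.+1%:R^-1.
Proof.
elim/ltn_ind: m => m IH mq2; have [mq|qm] := ltnP m q; first exact: quad_low.
(* With k + l + 1 = m the entry (k, l) of the form contains [quad m], whereas the diagonal entry at
   k contains only [quad] at 2k + 1 and at k, and 2k + 1 < m exactly because m < 2q - 1; so the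
   induction hypothesis makes the diagonal entry vanish. *)
pose k := (m - q)%N; pose l := q.-1.
have kq : (k.+1 < q)%N by rewrite /k; lia.
have kl : (k + l).+1 = m by rewrite /k /l; lia.
have lq : (l < q)%N by rewrite /l; lia.
have kk : stab_form (fun i => gam i ^+ k) (fun i => gam i ^+ k) = 0.
  rewrite stab_form_exp ?(ltnW kq)// (@quad_low k) ?(ltnW kq)// IH; [|lia..].
  have -> : ((k + k).+2)%:R = 2 * k.+1%:R :> R by rewrite -natrM; congr _%:R; lia.
  by field.
have := stab_form_sqr_le (fun i => gam i ^+ k) (fun i => gam i ^+ l).
rewrite kk mul0r le_eqVlt ltNge sqr_ge0 orbF sqrf_eq0 => /eqP.
rewrite stab_form_exp ?(ltnW kq)// kl (@quad_low k) ?(ltnW kq)// (@quad_low l)//.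
have -> : m.+1%:R = l.+1%:R + k.+1%:R :> R by rewrite -natrD; congr _%:R; lia.
have l0 : 0 < l.+1%:R :> R by []. have k0 : 0 < k.+1%:R :> R by [].
move: l.+1%:R k.+1%:R l0 k0 => x y x0 y0 H.
have xy : x + y != 0 by rewrite gt_eqF// addr_gt0.
apply: (mulIf xy); rewrite mulVf//.
have : (quad m / x + quad m / y - y^-1 * x^-1) * (x * y) = 0 by rewrite H mul0r.
have -> : (quad m / x + quad m / y - y^-1 * x^-1) * (x * y) = quad m * (x + y) - 1.
  by field; rewrite !gt_eqF.
by move/eqP; rewrite subr_eq0 => /eqP.
Qed.

(** One degree beyond the exact range a one-sided estimate survives: it is the nonnegativity of the
    diagonal entry of the stability form at the monomial of degree q - 1. *)
Lemma quad_last : q.*2%:R^-1 <= quad q.*2.-1.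
Proof.
have lq : (q.-1 < q)%N by lia.
have := stab_form_ge0 (fun i => gam i ^+ q.-1).
rewrite stab_form_exp// (_ : (q.-1 + q.-1).+1 = q.*2.-1); last lia.
rewrite (quad_low lq) prednK// -muln2 natrM.
have : 0 < q%:R :> R by rewrite ltr0n.
move: q%:R => x x0 /(mulr_ge0 (ltW x0)).
move: (quad _) => y.
have -> : x * (y / x + y / x - x^-1 / x) = 2 * y - x^-1 by field; rewrite gt_eqF.
have -> : (x * 2)^-1 = x^-1 / 2 by field; rewrite gt_eqF.
by lra.
Qed.

(** For p of degree at most 2q, every monomial of the derivative is integrated exactly except
    possibly the one of degree 2q - 1; the last term is its quadrature defect. *)
Lemma quad_deriv (p : {poly R}) : (size p <= q.*2.+1)%N ->
  \sum_i b i * p^`().[gam i] =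
  p.[1] - p.[0] + p`_q.*2 * (q.*2%:R * quad q.*2.-1 - 1).
Proof.
move=> sp.
have -> : \sum_i b i * p^`().[gam i] =
    \sum_(k < q.*2.+1) p`_k * (k%:R * quad k.-1).
  rewrite (eq_bigr (fun i => \sum_(k < q.*2.+1) b i * (p`_k * (k%:R * gam i ^+ k.-1)))).
    rewrite exchange_big/=; apply: eq_bigr => k _.
    by rewrite /quad !mulr_sumr; apply: eq_bigr => i _; ring.
  move=> i _; rewrite -mulr_sumr; congr *%R.
  have {1}-> : p = \sum_(k < q.*2.+1) p`_k *: 'X^k.
    apply/polyP => k; rewrite -poly_def coef_poly; case: ltnP => //.
    by move=> /(leq_trans sp) /(nth_default 0) ->.
  rewrite raddf_sum horner_sum; apply: eq_bigr => k _.
  by rewrite /= derivZ derivXn hornerZ hornerMn hornerXn mulr_natl.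
rewrite (horner_coef_wide 1 sp) (horner_coef_wide 0 sp) -sumrB big_ord_recr.
rewrite [in RHS]big_ord_recr/= expr1n mulr1 expr0n double_eq0 (gtn_eqF q0) mulr0 subr0.
rewrite -addrA -{2}[p`_q.*2]mulr1 -mulrDr; congr (_ + _ * _); last by ring.
apply: eq_bigr => -[[|k] /= kq] _; first by rewrite mul0r mulr0 !expr0 subrr.
rewrite quad_exact; last by lia.
by rewrite mulfV ?pnatr_eq0// mulr1 expr1n expr0n mulr1 mulr0 subr0.
Qed.

Lemma gamma_inj : injective gam.
Proof.
have [_ _ gI _ _] := hrk.
by move=> j k jk; apply/eqP; apply/negPn/negP => /gI; rewrite jk eqxx.
Qed.

(** If gamma_i were 0, the stage conditions would make row i of A annihilate the nodal values of
    every polynomial of degree < q. Lagrange polynomials then force that row to be zero, against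
    invertibility. *)
Lemma gamma_neq0 i : gam i != 0.
Proof.
apply/eqP => gi0; have [Au _ _ _ _] := hrk.
have row0 (p : {poly R}) : (size p <= q)%N -> \sum_j A i j * p.[gam j] = 0.
  move=> sp; rewrite (eq_bigr (fun j => \sum_(k < q) p`_k * (A i j * gam j ^+ k))).
    rewrite exchange_big big1//= => k _; rewrite -mulr_sumr.
    by have := @rk_sum_exp k i (ltn_ord k); rewrite /rk_sum => ->; rewrite gi0 expr0n mul0r mulr0.
  move=> j _; rewrite (horner_coef_wide _ sp) mulr_sumr.
  by apply: eq_bigr => k _; ring.
have ginj := gamma_inj.
have A0 k : A i k = 0.
  have := row0 _ (size_interpolant gam (fun j => (j == k)%:R)).
  rewrite (bigD1 k)//= interpolantE// eqxx mulr1 big1 ?addr0// => j jk.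
  by rewrite interpolantE// (negbTE jk) mulr0.
have : (A *m invmx A) i i = 1 by rewrite mulmxV// mxE eqxx.
rewrite mxE big1 => [/eqP|k _]; last by rewrite A0 mul0r.
by rewrite eq_sym oner_eq0.
Qed.

(* Integrating t l_i(t)^2 >= 0 over [0, 1], where l_i is the i-th Lagrange
   polynomial, by the quadrature rule. *)
Lemma gamma_gt0 i : 0 < gam i.
Proof.
rewrite lt_def gamma_neq0/=; have [_ b0 _ _ _] := hrk.
have ginj := gamma_inj.
pose l := interpolant gam (fun j => (j == i)%:R).
have sl : (size l <= q)%N := size_interpolant _ _.
pose f := 'X * l ^+ 2.
have sf : (size f <= q.*2)%N.
  rewrite /f mulrC; apply: leq_trans (size_polyMleq _ _) _.
  rewrite size_polyX expr2 addn2/=.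
  apply: (@leq_ltn_trans (size l + size l).-1); first exact: size_polyMleq.
  by rewrite -addnn; lia.
(* The antiderivative of [f] vanishing at 0; the coefficient of index 0 is killed by 0^-1 = 0. Since
   [f] may have degree 2q - 1, the quadrature defect has to be shown nonnegative as well. *)
pose p := \poly_(k < q.*2.+1) (f`_k.-1 * k%:R^-1).
have p'E : p^`() = f.
  apply/polyP => k; rewrite coef_deriv coef_poly ltnS /=; case: ltnP => kq.
    by rewrite -[LHS]mulr_natr -mulrA mulVf ?mulr1// pnatr_eq0.
  by rewrite mul0rn nth_default// (leq_trans sf).
have sp : (size p <= q.*2.+1)%N by exact: size_poly.
have := quad_deriv sp; rewrite p'E (bigD1 i)//= big1 ?addr0 => [|j ji]; last first.
  by rewrite /f hornerM hornerX horner_exp interpolantE// (negbTE ji) expr0n/= !mulr0.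
rewrite /f hornerM hornerX horner_exp interpolantE// eqxx expr1n mulr1 => H.
(* The mean value theorem stands in for the integral: p(1) - p(0) = f(c) >= 0 with c in ]0, 1[. *)
have [c c01 Hc] := @poly_mvt R 0 1 p ltr01.
have : 0 <= b i * gam i.
  rewrite H addr_ge0//.
    rewrite Hc p'E subr0 mulr1 /f hornerM hornerX horner_exp.
    by rewrite mulr_ge0 ?sqr_ge0//; move: c01; rewrite in_itv/= => /andP[/ltW].
  rewrite mulr_ge0//.
    rewrite coef_poly ltnSn mulr_ge0 ?invr_ge0 ?ler0n//.
    rewrite /f coefXM; case: eqP => // _.
    (* The coefficient of degree 2q - 2 of [l ^+ 2] is the square of the coefficient of degree q - 1
       of [l], so it is nonnegative. *)
    have -> : (q.*2.-1.-1 = q.-1 + q.-1)%N by lia.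
    rewrite expr2 coefM (bigD1 (Ordinal (leq_addr q.-1 q.-1 : q.-1 < (q.-1 + q.-1).+1)%N))//=.
    rewrite addnK big1 ?addr0 -?expr2 ?sqr_ge0// => -[k kq] /= kn.
    have [k1|k1|k1] := ltngtP k q.-1.
    - by rewrite [X in _ * X]nth_default ?mulr0//; apply: leq_trans sl _; lia.
    - by rewrite [X in X * _]nth_default ?mul0r//; apply: leq_trans sl _; lia.
    - by move: kn; rewrite -val_eqE/= k1 eqxx.
  have q2 : 0 < q.*2%:R :> R by rewrite ltr0n double_gt0.
  by have := quad_last; rewrite -(ler_pM2l q2) mulfV ?gt_eqF// subr_ge0.
by rewrite pmulr_rge0.
Qed.

(* With p the interpolant of w at the nodes and v(t) = t^-1 int_0^t p, the
   stages are rk_sum w i = gamma_i v(gamma_i), and the quadrature rule is exact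
   on (t v^2)'. *)
Lemma rk_sum_ge w :
  2^-1 * \sum_i b i / gam i ^+ 2 * rk_sum w i ^+ 2 <=
  \sum_i b i / gam i * (rk_sum w i * w i).
Proof.
have [_ b0 _ _ _] := hrk.
have ginj := gamma_inj.
pose p := interpolant gam w.
have sp : (size p <= q)%N := size_interpolant _ _.
pose v := \poly_(k < q) (p`_k / k.+1%:R).
have pE : ('X * v)^`() = p.
  apply/polyP => k; rewrite coef_deriv coefXM/= coef_poly; case: ltnP => kq.
    by rewrite -[LHS]mulr_natr -mulrA mulVf ?mulr1// pnatr_eq0.
  by rewrite mul0rn nth_default// (leq_trans sp).
have wE i : w i = v.[gam i] + gam i * v^`().[gam i].
  by rewrite -(interpolantE w i ginj) -/p -pE derivM derivX mul1r hornerD hornerM hornerX.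
have zE i : rk_sum w i = gam i * v.[gam i].
  rewrite /rk_sum (eq_bigr (fun j => \sum_(k < q) p`_k * (A i j * gam j ^+ k))).
    rewrite exchange_big/= (horner_coef_wide _ (size_poly q _)) mulr_sumr.
    apply: eq_bigr => k _; rewrite -mulr_sumr.
    have := @rk_sum_exp k i (ltn_ord k); rewrite /rk_sum => ->.
    by rewrite coef_poly ltn_ord exprS; ring.
  move=> j _; rewrite -(interpolantE w j ginj) -/p (horner_coef_wide _ sp) mulr_sumr.
  by apply: eq_bigr => k _; ring.
pose P := 'X * v ^+ 2.
have sP : (size P <= q.*2)%N.
  rewrite /P mulrC; apply: leq_trans (size_polyMleq _ _) _.
  rewrite size_polyX expr2 addn2/=.
  apply: (@leq_ltn_trans (size v + size v).-1); first exact: size_polyMleq.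
  by have := size_poly q (fun k => p`_k / k.+1%:R); rewrite -/v -addnn; lia.
(* Here [P] has degree at most 2q - 1, so the defect term carries a zero coefficient. *)
have := quad_deriv (leqW sP).
rewrite [P`_ _]nth_default// mul0r addr0 /P !hornerM !hornerX mul0r subr0 mul1r -expr2 => HP.
(* At each node this is v (v + t v') = (v^2 + (t v^2)') / 2. The boundary value v(1)^2 is then
   dropped by its sign. *)
have -> : \sum_i b i / gam i * (rk_sum w i * w i) =
    2^-1 * (\sum_i b i * v.[gam i] ^+ 2 + v.[1] ^+ 2).
  rewrite -HP -big_split/= mulr_sumr; apply: eq_bigr => i _.
  rewrite zE wE derivM derivX mul1r expr2 derivM !(hornerD, hornerM, hornerX).
  by field; exact: gamma_neq0.
rewrite ler_pM2l// ler_wpDr ?sqr_ge0// le_eqVlt; apply/orP; left; apply/eqP.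
by apply: eq_bigr => i _; rewrite zE; field; exact: gamma_neq0.
Qed.

End stable_runge_kutta.

(** * Completeness of L^2 *)

Section square_integrable.
Context d (T : measurableType d) (R : realType) (mu : {measure set T -> \bar R}).
Implicit Types u v w : T -> R.

Local Notation sqi := (fun u => u \in Lfun mu 2%:E).

Lemma Lfun2P u : (u \in Lfun mu 2%:E) <->
  measurable_fun setT u /\ mu.-integrable setT (EFin \o (fun x => u x ^+ 2)).
Proof.
split=> [uL|[mu_ ui]].
  split; last exact: Lfun2_integrable_sqr.
  by move: uL; rewrite inE => /andP[]; rewrite inE.
rewrite inE; apply/andP; split; rewrite inE//= /finite_norm unlock poweR_lty//.
move/integrableP : ui => [_]; apply: le_lt_trans.
rewrite le_eqVlt; apply/orP; left; apply/eqP; apply: eq_integral => x _ /=.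
by rewrite powR_mulrn// normrX.
Qed.

Lemma Lfun2_measurable u : sqi u -> measurable_fun setT u.
Proof. by move=> /Lfun2P[]. Qed.

Lemma Lfun2_mul_integrable u v : sqi u -> sqi v ->
  mu.-integrable setT (EFin \o (fun x => u x * v x)).
Proof. by move=> uL vL; apply/Lfun1_integrable; exact: Lfun2_mul_Lfun1. Qed.

Lemma Lfun2_lin a u v : sqi u -> sqi v -> sqi (a *: u + v).
Proof.
move=> /Lfun2P[mu_ ui] /Lfun2P[mv vi]; apply/Lfun2P.
have muv : measurable_fun setT (a *: u + v).
  by apply: measurable_funD => //; exact: measurable_funM.
split=> //.
apply: (@le_integrable _ _ _ _ _ _ _
  (fun x => ((2 * a ^+ 2)%:E * (u x ^+ 2)%:E + 2%:E * (v x ^+ 2)%:E)%E)) => //.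
- by apply/measurable_EFinP; exact: measurable_funX.
- move=> x _; rewrite -!EFinM -EFinD /= lee_fin ger0_norm ?sqr_ge0//.
  apply: le_trans (ler_norm _).
  have -> : (a *: u + v) x = a * u x + v x by [].
  by have := sqr_ge0 (a * u x - v x); nra.
- by apply: integrableD => //; exact: integrableZl.
Qed.

Lemma Lfun2_0 : sqi (0 : T -> R).
Proof.
apply/Lfun2P; split; first exact: measurable_cst.
rewrite (_ : EFin \o _ = cst 0%E); first exact: integrable0.
by apply/funext => x /=; rewrite expr0n.
Qed.

Definition l2ip u v := \int[mu]_x (u x * v x).

Lemma l2ipC u v : l2ip u v = l2ip v u.
Proof. by apply: eq_Rintegral => x _; rewrite mulrC. Qed.

Lemma l2ipP a u v w : sqi u -> sqi v -> sqi w ->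
  l2ip (a *: u + v) w = a * l2ip u w + l2ip v w.
Proof.
move=> uL vL wL; rewrite /l2ip -RintegralZl//; last exact: Lfun2_mul_integrable.
rewrite -RintegralD//.
- by apply: eq_Rintegral => x _; rewrite mulrDl -mulrA.
- rewrite (_ : EFin \o _ = fun x => (a%:E * (u x * w x)%:E)%E)//.
  by apply: integrableZl => //; exact: Lfun2_mul_integrable.
- exact: Lfun2_mul_integrable.
Qed.

Lemma l2ip_ge0 u : 0 <= l2ip u u.
Proof. by apply: Rintegral_ge0 => x _; rewrite -expr2 sqr_ge0. Qed.

Lemma l2ip_fin u : sqi u -> (\int[mu]_x (u x ^+ 2)%:E = (l2ip u u)%:E)%E.
Proof.
move=> /Lfun2P[mu_ ui]; rewrite /l2ip /Rintegral fineK.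
  by apply: eq_integral => x _; rewrite expr2.
by have := integrable_fin_num measurableT ui; rewrite (eq_integral (EFin \o (fun x => u x ^+ 2))).
Qed.

Lemma l2ip_eq0 u : sqi u -> l2ip u u = 0 -> u = cst 0 %[ae mu].
Proof.
move=> uL u0; have [mu_ ui] := (Lfun2P u).1 uL.
have : (\int[mu]_x `|(u x ^+ 2)%:E| = 0)%E.
  rewrite -[RHS]/(0%:E) -u0 -l2ip_fin//; apply: eq_integral => x _.
  by rewrite gee0_abs// lee_fin sqr_ge0.
have mu2 : measurable_fun setT (EFin \o (fun x => u x ^+ 2)).
  by apply/measurable_EFinP; exact: measurable_funX.
move=> /(ae_eq_integral_abs mu measurableT mu2).
by apply: filterS => x /(_ I) [/eqP]; rewrite sqrf_eq0 => /eqP.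
Qed.

Lemma l2ip_ae u u' v v' : sqi u -> sqi v -> sqi u' -> sqi v' ->
  u = u' %[ae mu] -> v = v' %[ae mu] -> l2ip u v = l2ip u' v'.
Proof.
move=> uL vL u'L v'L uu vv; congr fine; apply: ae_eq_integral => //.
- by have /integrableP[] := Lfun2_mul_integrable uL vL.
- by have /integrableP[] := Lfun2_mul_integrable u'L v'L.
- by apply: filterS2 uu vv => x /(_ I) ux /(_ I) vx _; rewrite ux vx.
Qed.

(* Pointwise, the integrand is the nonnegative value of the quadratic form K. *)
Lemma l2ip_psd n (K : 'I_n -> 'I_n -> R) (u : 'I_n -> T -> R) :
  (forall x : 'I_n -> R, 0 <= \sum_i \sum_j K i j * (x i * x j)) ->
  (forall i, sqi (u i)) ->
  0 <= \sum_i \sum_j K i j * l2ip (u i) (u j).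
Proof.
move=> K0 uL; have intK (s : seq ('I_n * 'I_n)) :
    mu.-integrable setT (EFin \o (fun x => \sum_(k <- s) K k.1 k.2 * (u k.1 x * u k.2 x))) /\
    \sum_(k <- s) K k.1 k.2 * l2ip (u k.1) (u k.2) =
    \int[mu]_x (\sum_(k <- s) K k.1 k.2 * (u k.1 x * u k.2 x)).
  elim: s => [|k s [IHi IH]].
    rewrite big_nil; under [in X in Rintegral _ _ X]eq_fun do rewrite big_nil.
    split; last by rewrite Rintegral_cst// mul0r.
    rewrite (_ : EFin \o _ = cst 0%E); first exact: integrable0.
    by apply/funext => x /=; rewrite big_nil.
  have ki : mu.-integrable setT (EFin \o (fun x => K k.1 k.2 * (u k.1 x * u k.2 x))).
    rewrite (_ : EFin \o _ = fun x => ((K k.1 k.2)%:E * (u k.1 x * u k.2 x)%:E)%E)//.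
    by apply: integrableZl => //; exact: Lfun2_mul_integrable.
  split.
    rewrite (_ : EFin \o _ = fun x => ((K k.1 k.2 * (u k.1 x * u k.2 x))%:E +
        (\sum_(k <- s) K k.1 k.2 * (u k.1 x * u k.2 x))%:E)%E); first exact: integrableD.
    by apply/funext => x /=; rewrite big_cons EFinD.
  rewrite big_cons IH -RintegralZl//; last exact: Lfun2_mul_integrable.
  by rewrite -RintegralD//; apply: eq_Rintegral => x _; rewrite big_cons.
rewrite pair_big/=; have [_ ->] := intK (index_enum _).
apply: Rintegral_ge0 => x _.
have := K0 (fun i => u i x); rewrite pair_big/=; apply.
Qed.

(** Riesz-Fischer. Along a subsequence whose increments D_k have norm at most 2^-k, the series of
    2^k D_k^2 has a finite integral, which gives a.e. absolute convergence of the increments while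
    handling only integrals of squares; Fatou then identifies the L^2 limit. *)
Lemma l2_complete (u : nat -> T -> R) : (forall n, sqi (u n)) ->
  (forall e, 0 < e -> exists N, forall m n, (N <= m)%N -> (N <= n)%N ->
    l2ip (u m - u n) (u m - u n) < e) ->
  exists2 l, sqi l & forall e, 0 < e -> exists N, forall n, (N <= n)%N ->
    l2ip (u n - l) (u n - l) < e.
Proof.
move=> uL uC.
have sqiB f g : sqi f -> sqi g -> sqi (f - g).
  by move=> fL gL; rewrite -[f - g]addrC -scaleN1r; exact: Lfun2_lin.
have /choice[M HM] : forall k, exists N, forall m n, (N <= m)%N -> (N <= n)%N ->
    l2ip (u m - u n) (u m - u n) < (2^-1) ^+ k ^+ 2.
  by move=> k; apply: uC; rewrite !exprn_gt0// invr_gt0.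
(* The inner maximum puts both [phi k] and [phi k.+1] beyond [M k]; the outer one gives
   [phi k >= k], used when the index is sent to infinity. *)
pose phi k := maxn k (\max_(j < k.+1) M j)%N.
have Mphi j k : (j <= k)%N -> (M j <= phi k)%N.
  move=> jk; apply: leq_trans (leq_maxr _ _).
  exact: (leq_bigmax (Ordinal (jk : (j < k.+1)%N))).
pose v k := u (phi k).
have vL k : sqi (v k) := uL _.
pose D k x := v k.+1 x - v k x.
have DL k : sqi (D k) := sqiB _ _ (vL _) (vL _).
have D2 k : l2ip (D k) (D k) <= (2^-1) ^+ k ^+ 2.
  by apply/ltW/HM; apply: Mphi.
pose g k x := (2 ^+ k * D k x ^+ 2)%:E.
have mg k : measurable_fun setT (g k).
  apply/measurable_EFinP; apply: measurable_funM => //.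
  by apply: measurable_funX; exact: Lfun2_measurable.
have pos k (y : R) : 0 <= 2 ^+ k * y ^+ 2.
  by rewrite mulr_ge0 ?sqr_ge0// exprn_ge0.
have g0 k x : (0 <= g k x)%E by rewrite lee_fin pos.
have good : \forall x \ae mu, (\sum_(0 <= k <oo) g k x < +oo)%E.
  have : mu.-integrable setT (fun x => \sum_(0 <= k <oo) g k x)%E.
    apply/integrableP; split.
      by apply: ge0_emeasurable_sum => k *; [exact: g0|exact: mg].
    under eq_integral do rewrite gee0_abs ?nneseries_ge0//.
    rewrite integral_nneseries//.
    apply: (@le_lt_trans _ _ (\sum_(0 <= k <oo) ((2^-1 : R) ^+ k)%:E)%E).
      apply: lee_nneseries => [k _ _|k _].
        by apply: integral_ge0 => x _; exact: g0.
      rewrite /g; under eq_integral do rewrite EFinM.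
      rewrite ge0_integralZl//=; last 2 first.
      - by apply/measurable_EFinP/measurable_funX; exact: Lfun2_measurable.
      - by move=> x _; rewrite lee_fin sqr_ge0.
      rewrite l2ip_fin// -EFinM lee_fin -ler_pdivlMl ?exprn_gt0//.
      by rewrite -exprVn -expr2.
    apply: (@le_lt_trans _ _ (2 : R)%:E); last exact: ltry.
    apply: lime_le.
      by apply: is_cvg_nneseries => k _ _; rewrite lee_fin exprn_ge0// invr_ge0.
    apply: nearW => n; rewrite sumEFin lee_fin big_mkord.
    have -> : \sum_(k < n) (2^-1 : R) ^+ k = 2 - 2 * 2^-1 ^+ n.
      elim: n => [|n IH]; first by rewrite big_ord0 expr0; ring.
      by rewrite big_ord_recr/= IH exprS; field.
    by rewrite lerBlDr lerDl mulr_ge0// exprn_ge0// invr_ge0.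
  move=> /(integrable_ae measurableT); apply: filterS => x /(_ I).
  by rewrite ge0_fin_numE// nneseries_ge0.
(* An upper limit is defined and measurable everywhere, whereas the sequence is known to converge
   only a.e. *)
pose l x := fine (limn_esup (fun k => (v k x)%:E)).
have ml : measurable_fun setT l.
  apply: (measurableT_comp (fine_measurable measurableT)).
  apply: (@measurable_fun_limn_esup _ _ _ _ (fun k x => (v k x)%:E)) => k.
  by apply/measurable_EFinP; exact: Lfun2_measurable.
have vl : \forall x \ae mu, v k x @[k --> \oo] --> l x.
  apply: filterS good => x gx.
  have s_cvg : cvgn (series (fun k => 2 ^+ k * D k x ^+ 2 + 2^-1 ^+ k)).
    rewrite (_ : series _ = series (fun k => 2 ^+ k * D k x ^+ 2) \+
      series (geometric 1 2^-1)); last first.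
      rewrite /series; apply/funext => n /=; rewrite -big_split/=.
      by apply: eq_bigr => k _; rewrite mul1r.
    apply: is_cvgD.
      apply: nnseries_is_cvg gx => k.
      exact: pos.
    by apply: is_cvg_geometric_series; rewrite ger0_norm; lra.
  have v_cvg : cvgn (fun k => v k x).
    have -> : (fun k => v k x) = cst (v 0%N x) \+ series (D^~ x).
      by apply/funext => k; exact: (eq_sum_telescope (v^~ x) k).
    apply: is_cvgD; first exact: is_cvg_cst.
    apply: normed_cvg; apply: series_le_cvg s_cvg => [k|k|k].
    - exact: normr_ge0.
    - by rewrite addr_ge0 ?pos// exprn_ge0// invr_ge0.
    - (* 2 |D_k| <= 2^k D_k^2 + 2^-k *)
      have s0 : 0 < 2 ^+ k :> R by rewrite exprn_gt0.
      rewrite /= exprVn -(ler_pM2l s0) mulrDr mulfV ?gt_eqF// mulrA -expr2 -exprMn.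
      rewrite -real_normK ?num_real// normrM (gtr0_norm s0).
      by have := sqr_ge0 (2 ^+ k * `|D k x| - 1); nra.
  have lE : limn_esup (fun k => (v k x)%:E) = (limn (fun k => v k x))%:E.
    have : (v k x)%:E @[k --> \oo] --> (limn (fun k => v k x))%:E.
      by apply: cvg_EFin; [exact: nearW|exact: v_cvg].
    by move/cvg_limn_einf_sup => [].
  by rewrite /l lE.
(* Fatou applied to (u n - v (k + N))^2 as k grows; the shift by N keeps every index in the Cauchy
   range. Working with the extended integral avoids assuming that [l] is in L^2, which is deduced
   from this bound. *)
have ul e : 0 < e -> exists N, forall n, (N <= n)%N ->
    (\int[mu]_x ((u n x - l x) ^+ 2)%:E <= e%:E)%E.
  move=> e0; have [N HN] := uC _ e0; exists N => n Nn.
  pose f k x := ((u n x - v (k + N)%N x) ^+ 2)%:E.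
  have mf k : measurable_fun setT (f k).
    by apply/measurable_EFinP/measurable_funX/measurable_funB; exact: Lfun2_measurable.
  have -> : (\int[mu]_x ((u n x - l x) ^+ 2)%:E = \int[mu]_x limn_einf (f^~ x))%E.
    apply: ge0_ae_eq_integral => //.
    - apply/measurable_EFinP/measurable_funX/measurable_funB => //.
      exact: Lfun2_measurable.
    - rewrite (_ : (fun x => _) = -%E \o (fun x => limn_esup (fun k => - f k x)))%E.
        apply: measurableT_comp => //.
        apply: (@measurable_fun_limn_esup _ _ _ _ (fun k x => - f k x)%E) => k.
        exact: measurableT_comp.
      apply/funext => x /=; rewrite -limn_einfN; congr limn_einf.
      by apply/funext => k /=; rewrite opprK.
    - by move=> x _; rewrite lee_fin sqr_ge0.
    - move=> x _; rewrite limn_einf_lim; apply: lime_ge; first exact: is_cvg_einfs.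
      apply: nearW => k; apply: le_ereal_inf_tmp => _ [j /= _ <-].
      by rewrite lee_fin sqr_ge0.
    - apply: filterS vl => x vx _.
      have : f k x @[k --> \oo] --> ((u n x - l x) ^+ 2)%:E.
        apply: cvg_EFin; first by apply: nearW.
        have vx' : v (k + N)%N x @[k --> \oo] --> l x by rewrite (@cvg_shiftn N _ (v^~ x)).
        have c : u n x - v (k + N)%N x @[k --> \oo] --> u n x - l x.
          by apply: cvgB => //; exact: cvg_cst.
        exact: (cvgM c c).
      by move=> /cvg_limn_einf_sup[].
  apply: le_trans (fatou mu measurableT mf _) _.
    by move=> k x _; rewrite lee_fin sqr_ge0.
  rewrite limn_einf_lim; apply: lime_le; first exact: is_cvg_einfs.
  apply: nearW => k; apply: (@le_trans _ _ (\int[mu]_x f k x)%E).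
    by apply: ereal_inf_lbound; exists k => /=.
  rewrite (l2ip_fin (sqiB _ _ (uL n) (vL (k + N)%N))) lee_fin.
  apply/ltW/HN => //.
  by apply: leq_trans (leq_maxl _ _); rewrite leq_addl.
have unl N : (\int[mu]_x ((u N x - l x) ^+ 2)%:E < +oo)%E -> sqi (u N - l).
  move=> h; apply/Lfun2P; split.
    by apply: measurable_funB => //; exact: Lfun2_measurable.
  apply/integrableP; split.
    apply/measurable_EFinP/measurable_funX/measurable_funB => //.
    exact: Lfun2_measurable.
  by under eq_integral do rewrite gee0_abs ?lee_fin ?sqr_ge0//.
have lL : sqi l.
  have [N HN] := ul 1 ltr01.
  have := sqiB _ _ (uL N) (unl N (le_lt_trans (HN _ (leqnn N)) (ltry _))).
  by rewrite opprB addrC subrK.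
exists l => // e e0.
have [N HN] := ul (e / 2) (divr_gt0 e0 (ltr0n _ 2)).
exists N => n Nn; rewrite -lte_fin -l2ip_fin; last exact: sqiB.
by apply: le_lt_trans (HN n Nn) _; rewrite lte_fin; lra.
Qed.

Definition hL2 : hspace (T -> R).
Proof.
apply: (@HSpace R (T -> R) sqi l2ip).
- exact: Lfun2_0.
- exact: Lfun2_lin.
- exact: l2ipP.
- by move=> u v _ _; exact: l2ipC.
- by move=> u _; exact: l2ip_ge0.
- exact: l2_complete.
Defined.

End square_integrable.

(** * Lebesgue measure on a box *)

Section rV_measure.
Context (R : realType).

Lemma lebesgue_rV_box_fin n (a b : 'rV[R]_n) : (lebesgue_rV R n (box a b) < +oo)%E.
Proof.
elim: n a b => [|n IH] a b.
  by rewrite /= /dirac/= ltry.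
rewrite /= /lebesgue_cons /pushforward.
have -> : rV_cons (n:=n) @^-1` box a b =
    `]a ord0 ord0, b ord0 ord0[%classic `*` box (rV_behead a) (rV_behead b).
  apply/seteqP; split => -[x y] /=; rewrite in_itv/=.
    move=> H; split=> [|i]; first by have := H ord0; rewrite rV_cons0.
    by have := H (lift ord0 i); rewrite rV_consS !mxE.
  move=> [xab yab] i; case: (unliftP ord0 i) => [j ->|->]; last by rewrite rV_cons0.
  by rewrite rV_consS; have := yab j; rewrite !mxE.
rewrite product_measure1E//; last exact: measurable_box.
rewrite lte_mul_pinfty ?measure_ge0//.
suff : lebesgue_measure `]a ord0 ord0, b ord0 ord0[%classic \is a fin_num by [].
by rewrite lebesgue_measure_itv; case: ifP.
Qed.

(** The sigma-algebra is generated by the coordinates; an open set belongs to it as a countable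
    union of boxes with rational corners. *)
Lemma open_measurable_rV n (A : set 'rV[R]_n) : open A -> measurable A.
Proof.
move=> oA.
pose B (pq : 'rV[rat]_n * 'rV[rat]_n) : set 'rV[R]_n :=
  box (map_mx ratr pq.1) (map_mx ratr pq.2).
have -> : A = \bigcup_(pq in [set pq | B pq `<=` A]) B pq.
  apply/seteqP; split => [x Ax|x [pq /= pqA]]; last exact: pqA.
  have /nbhs_ballP[e /= e0 xeA] := open_nbhs_nbhs (conj oA Ax).
  have /choice[p Hp] (i : 'I_n) : exists p, ratr p \in `]x ord0 i - e, x ord0 i[.
    by apply: rat_in_itvoo; rewrite ltrBlDr ltrDl.
  have /choice[q Hq] (i : 'I_n) : exists q, ratr q \in `]x ord0 i, x ord0 i + e[.
    by apply: rat_in_itvoo; rewrite ltrDl.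
  exists (\row_i p i, \row_i q i) => /=.
    move=> y yB; apply: xeA; split=> // i j; rewrite (ord1 i).
    have := yB j; rewrite !mxE => /andP[py yq].
    have := Hp j; have := Hq j; rewrite !in_itv/= => /andP[xq qe] /andP[ep px].
    by rewrite /ball/= ltr_distlC (lt_trans ep)//= (lt_trans yq).
  move=> i; rewrite !mxE.
  by have := Hp i; have := Hq i; rewrite !in_itv/= => /andP[-> _] /andP[_ ->].
rewrite bigcup_mkcond; apply: countable_bigcupT_measurable => // pq.
by case: ifP => _ //; exact: measurable_box.
Qed.

Lemma continuous_measurable_rV n (f : 'rV[R]_n -> R) :
  continuous f -> measurable_fun setT f.
Proof.
move=> /continuousP cf; apply: (measurability _ (RGenOpens.measurableE R)).
move=> _ [_ [a [b ->] <-]]; rewrite setTI; apply: open_measurable_rV.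
exact/cf/interval_open.
Qed.

End rV_measure.

Section box_functions.
Context (R : realType) (d : nat) (a b : 'rV[R]_d).
Local Notation mu := (box_measure a b).

Lemma box_measure_fin : (mu setT < +oo)%E.
Proof. by rewrite /= /mrestr setTI lebesgue_rV_box_fin. Qed.

Lemma ae_box (Q : 'rV[R]_d -> Prop) : (forall x, box a b x -> Q x) ->
  \forall x \ae mu, Q x.
Proof.
move=> HQ; exists (~` box a b); split.
- by apply: measurableC; exact: measurable_box.
- by rewrite /= /mrestr setICl measure0.
- by move=> x /= nQ bx; apply: nQ; exact: HQ.
Qed.

Lemma continuous_box_bounded (f : 'rV[R]_d -> R) : continuous f ->
  exists2 M, 0 <= M & forall x, box a b x -> `|f x| <= M.
Proof.
move=> cf; pose C := [set x : 'rV[R]_d | forall i, `[a ord0 i, b ord0 i]%classic (x ord0 i)].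
have cC : compact C.
  apply: (@rV_compact R d (fun i => `[a ord0 i, b ord0 i]%classic)) => i.
  exact: segment_compact.
have boxC x : box a b x -> C x.
  by move=> bx i /=; have /andP[? ?] := bx i; rewrite in_itv/= !ltW.
have [C0|/set0P C0] := eqVneq C set0.
  by exists 0 => // x /boxC; rewrite C0.
have [|c _ Hc] := @compact_EVT_max _ R (fun x => `|f x|) C C0 cC.
  apply: continuous_subspaceT => x.
  by apply: (@continuous_comp _ _ _ f (fun y : R => `|y|)); [exact: cf|exact: norm_continuous].
by exists `|f c| => // x /boxC xC; apply: Hc; rewrite inE.
Qed.

Lemma bounded_L2 (f : 'rV[R]_d -> R) (M : R) : measurable_fun setT f ->
  (forall x, box a b x -> `|f x| <= M) -> L2 a b f.
Proof.
move=> mf fM; apply/Lfun2P; split => //; apply/integrableP; split.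
  exact/measurable_EFinP/measurable_funX.
apply: (@le_lt_trans _ _ (\int[mu]_x (cst (M ^+ 2)%:E x))%E).
  apply: ae_ge0_le_integral => //.
  - by apply: measurableT_comp => //; exact/measurable_EFinP/measurable_funX.
  - by move=> x _; rewrite lee_fin sqr_ge0.
  - apply: ae_box => x bx _ /=; rewrite lee_fin normrX.
    by rewrite lerXn2r ?nnegrE// ?fM// (le_trans _ (fM _ bx)).
rewrite integral_cst// lte_mul_pinfty ?lee_fin ?sqr_ge0//.
exact: box_measure_fin.
Qed.

Lemma continuous_L2 (f : 'rV[R]_d -> R) : continuous f -> L2 a b f.
Proof.
move=> cf; have [M _ fM] := continuous_box_bounded cf.
by apply: bounded_L2 fM; exact: continuous_measurable_rV.
Qed.

End box_functions.

(** * Periodic test functions *)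

Section continuously_differentiable.
Context (R : realType).
Implicit Types f g : R -> R.

Definition C1fun f :=
  exists2 f' : R -> R, forall x : R, is_derive x 1 f (f' x) & continuous f'.

Lemma C1_continuous f : C1fun f -> continuous f.
Proof.
move=> [f' df _] x; have [dfx _] := df x.
by apply: differentiable_continuous; exact/derivable1_diffP.
Qed.

Lemma C1_comp f g : C1fun f -> C1fun g -> C1fun (f \o g).
Proof.
move=> [f' df cf] C1g; have cg := C1_continuous C1g; have [g' dg cg'] := C1g.
exists (fun x => f' (g x) * g' x) => [x|x]; first exact: is_derive1_comp.
by apply: cvgM; [apply: continuous_comp; [exact: cg|exact: cf]|exact: cg'].
Qed.

Lemma C1_mul f g : C1fun f -> C1fun g -> C1fun (f * g).
Proof.
move=> C1f C1g; have cf := C1_continuous C1f; have cg := C1_continuous C1g.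
have [f' df cf'] := C1f; have [g' dg cg'] := C1g.
exists (fun x => f x * g' x + g x * f' x) => [x|x]; first exact: is_deriveM.
by apply: cvgD; apply: cvgM; [exact: cf|exact: cg'|exact: cg|exact: cf'].
Qed.

Lemma C1_affine (p s : R) : C1fun (fun x => p * x + s).
Proof.
exists (cst p) => [x|x]; last exact: cvg_cst.
by apply: is_derive_eq; rewrite addr0; exact: mulr1.
Qed.

Lemma C1_sin : C1fun sin.
Proof. by exists cos; [move=> x; exact: is_derive_sin|exact: continuous_cos]. Qed.

Lemma C1_expR : C1fun expR.
Proof. by exists expR; [move=> x; exact: is_derive_expR|exact: continuous_expR]. Qed.

Lemma C1_inv f : (forall x, f x != 0) -> C1fun f -> C1fun (fun x => (f x)^-1).
Proof.
move=> f0 C1f; have cf := C1_continuous C1f; have [f' df cf'] := C1f.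
exists (fun x => - (f x) ^- 2 *: f' x) => [x|x]; first exact: is_deriveV.
apply: cvgM; last exact: cf'.
apply: cvgN; apply: cvgV; first by rewrite expf_neq0.
by apply: cvgM; exact: cf.
Qed.

End continuously_differentiable.

Section test_functions.
Context (R : realType) (d : nat) (a b : 'rV[R]_d).
Implicit Types psi chi : 'rV[R]_d -> R.

Lemma test_cst (c : R) : test_function a b (cst c).
Proof.
split=> [x|i|//]; first exact: differentiable_cst.
rewrite (_ : partial i _ = cst 0); first exact: cst_continuous.
by apply/funext => x; exact: derive_cst.
Qed.

Lemma test_continuous psi : test_function a b psi -> continuous psi.
Proof. by move=> [dpsi _ _] x; exact: differentiable_continuous. Qed.

Lemma test_mul psi chi : test_function a b psi -> test_function a b chi ->
  test_function a b (psi * chi).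
Proof.
move=> tp tc; have cp := test_continuous tp; have cc := test_continuous tc.
have [dp pp perp] := tp; have [dc pc perc] := tc; split=> [x|i|i x].
- exact: differentiableM.
- rewrite (_ : partial i _ = fun x => psi x * partial i chi x + chi x * partial i psi x).
    by move=> x; apply: (@continuousD _ _ _ (fun x => psi x * partial i chi x));
      apply: continuousM; [exact: cp|exact: pc|exact: cc|exact: pp].
  by apply/funext => x; rewrite /partial deriveM//; exact: diff_derivable.
- by have := perp i x; have := perc i x => /= h1 h2; rewrite /GRing.mul/= h1 h2.
Qed.

(** Functions of a single coordinate suffice: together with constants and products they approximate
    the indicators of finite intersections of half-spaces in the box. *)
Lemma test_coord (i : 'I_d) (r : R -> R) : C1fun r ->
  (forall t, r (t + (b ord0 i - a ord0 i)) = r t) ->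
  test_function a b (fun x => r (x ord0 i)).
Proof.
move=> C1r; have [r' dr cr'] := C1r; move=> per; split=> [x|j|j x].
- apply: (@differentiable_comp _ _ _ _ (fun x : 'rV[R]_d => x ord0 i) r).
    exact: differentiable_coord.
  by apply/derivable1_diffP; have [] := dr (x ord0 i).
- have -> : partial j (fun x : 'rV[R]_d => r (x ord0 i)) =
      fun x => (i == j)%:R * r' (x ord0 i).
    apply/funext => x; rewrite /partial.
    have -> : 'D_(delta_mx ord0 j) (fun x : 'rV[R]_d => r (x ord0 i)) x =
        'D_((i == j)%:R : R) r (x ord0 i).
      rewrite /derive; apply: (congr1 (fun F : R -> R => lim (F @ 0^'))).
      apply/funext => h /=.
      by rewrite !mxE eqxx.
    have dx : differentiable r (x ord0 i) by apply/derivable1_diffP; have [] := dr (x ord0 i).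
    case: eqP => _; last by rewrite deriveE// linear0 mul0r.
    by rewrite mul1r; have [_] := dr (x ord0 i).
  move=> x; apply: (@continuousM _ _ (cst (i == j)%:R)); first exact: cst_continuous.
  apply: (@continuous_comp _ _ _ (fun x : 'rV[R]_d => x ord0 i) r'); last exact: cr'.
  exact: coord_continuous.
- rewrite !mxE eqxx/=; case: eqP => [<-|_]; first by rewrite mulr1 per.
  by rewrite mulr0 addr0.
Qed.

End test_functions.

Lemma cvg_invS (R : realType) (u : nat -> R) (l C : R) :
  (forall k, `|u k - l| <= C * k.+1%:R^-1) -> u k @[k --> \oo] --> l.
Proof.
move=> uC; apply/cvgrPdist_le => e e0.
have C0 : 0 <= C by have := uC 0%N; rewrite invr1 mulr1; exact: le_trans.
have C1 : 0 < C + 1 by rewrite ltr_wpDl.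
have [N _ HN] := near_infty_natSinv_lt (PosNum (divr_gt0 e0 C1)).
exists N => // k /= Nk; rewrite distrC; apply: le_trans (uC k) _.
have := HN k Nk => /=; rewrite ltr_pdivlMr// => h.
by apply: le_trans (ltW h); rewrite mulrC ler_wpM2l ?invr_ge0// lerDl.
Qed.

(** * Density of the periodic test functions in L^2 of the box *)

Section density.
Context (R : realType) (d : nat) (a b : 'rV[R]_d).
Hypothesis ab : forall i, a ord0 i < b ord0 i.
Local Notation mu := (box_measure a b).

Section bump.
Variables (p s c : R).
Hypotheses (ps : p < s) (pc : p < c).

(* Both factors change sign under t -> t + (s - p); on ]p, s[ the first one is
   positive and the second one has the sign of c - t. *)
Definition hump (t : R) : R :=
  sin (pi / (s - p) * (t - p)) * sin (pi / (s - p) * (c - t)).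

(** A logistic function of [hump], tending to 1 where [hump > 0] and to 0 where [hump <= 0]. The
    factor [k.+1] in front of the exponential forces the limit 0 at [hump t = 0] too, hence at t =
    c, so that the limit is the indicator of an open half-line. *)
Definition bump (k : nat) (t : R) : R :=
  (1 + k.+1%:R * expR (- k.+1%:R * hump t))^-1.

Lemma bump_den_gt0 k t : 0 < 1 + k.+1%:R * expR (- k.+1%:R * hump t).
Proof. by rewrite ltr_wpDr// mulr_ge0// expR_ge0. Qed.

Lemma bump01 k t : 0 <= bump k t <= 1.
Proof.
rewrite /bump invr_ge0 ltW ?bump_den_gt0//= invf_le1 ?bump_den_gt0// lerDl.
by rewrite mulr_ge0// expR_ge0.
Qed.

Lemma bump_periodic k t : bump k (t + (s - p)) = bump k t.
Proof.
have sp : s - p != 0 by rewrite subr_eq0 gt_eqF.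
suff: hump (t + (s - p)) = hump t by rewrite /bump => ->.
rewrite /hump.
have -> : pi / (s - p) * (t + (s - p) - p) = pi / (s - p) * (t - p) + pi by field.
have -> : pi / (s - p) * (c - (t + (s - p))) = pi / (s - p) * (c - t) - pi by field.
have sinBpi y : sin (y - pi) = - sin y :> R by rewrite -[y in RHS](subrK pi) sinDpi opprK.
by rewrite sinDpi sinBpi mulrNN.
Qed.

Lemma C1_bump k : C1fun (bump k).
Proof.
apply: C1_inv => [t|]; first by rewrite gt_eqF// bump_den_gt0.
have hs (q r : R) : C1fun (fun t => sin (q * t + r)).
  by apply: (C1_comp (C1_sin R)); exact: C1_affine.
have C1hump : C1fun hump.
  have -> : hump = (fun t => sin (pi / (s - p) * t + - (pi / (s - p) * p)))
      * (fun t => sin (- (pi / (s - p)) * t + pi / (s - p) * c)).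
    apply/funext => t; rewrite /hump; set u := (X in _ = X).
    have -> : u = sin (pi / (s - p) * t + - (pi / (s - p) * p))
      * sin (- (pi / (s - p)) * t + pi / (s - p) * c) by [].
    by congr (sin _ * sin _); ring.
  by apply: C1_mul; exact: hs.
have := C1_comp (C1_affine k.+1%:R 1)
  (C1_comp (C1_expR R) (C1_comp (C1_affine (- k.+1%:R) 0) C1hump)).
by congr C1fun; apply/funext => t /=; rewrite addr0 addrC.
Qed.

Lemma bump_cvg t : p < t < s -> c < s ->
  bump k t @[k --> \oo] --> ((t < c)%R%:R : R).
Proof.
move=> /andP[pt ts] cs; have sp : 0 < s - p by rewrite subr_gt0.
have w0 : 0 < pi / (s - p) by rewrite divr_gt0// pi_gt0.
have s1 : 0 < sin (pi / (s - p) * (t - p)).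
  apply: sin_gt0_pi; rewrite mulr_gt0 ?subr_gt0//=.
  by rewrite mulrAC ltr_pdivrMr// ltr_pM2l ?pi_gt0//; lra.
have [tc|ct] := ltP t c.
  have s2 : 0 < sin (pi / (s - p) * (c - t)).
    apply: sin_gt0_pi; rewrite mulr_gt0 ?subr_gt0//=.
    by rewrite mulrAC ltr_pdivrMr// ltr_pM2l ?pi_gt0//; lra.
  have h0 : 0 < hump t by rewrite mulr_gt0.
  (* From exp(y/2) >= 1 + y/2 one gets exp(-y) <= 4 / y^2; take y = (k+1) hump(t) and multiply by k
     + 1. *)
  apply: (@cvg_invS _ _ _ (4 / hump t ^+ 2)) => k.
  have k0 : 0 < k.+1%:R :> R by [].
  have d0 := bump_den_gt0 k t.
  have -> : bump k t - 1 = - (k.+1%:R * expR (- k.+1%:R * hump t) * bump k t).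
    by rewrite /bump; field; rewrite gt_eqF.
  rewrite normrN ger0_norm; last by rewrite !mulr_ge0 ?expR_ge0//; case/andP: (bump01 k t).
  apply: (@le_trans _ _ (k.+1%:R * expR (- k.+1%:R * hump t))).
    by rewrite ler_piMr ?mulr_ge0 ?expR_ge0//; case/andP: (bump01 k t).
  have E0 : 0 < expR (k.+1%:R * hump t / 2) by exact: expR_gt0.
  have E1 : 1 + k.+1%:R * hump t / 2 <= expR (k.+1%:R * hump t / 2) by exact: expR_ge1Dx.
  have -> : expR (- k.+1%:R * hump t) = (expR (k.+1%:R * hump t / 2) ^+ 2)^-1.
    by rewrite expr2 -expRD -expRN; congr expR; field.
  have kh : 0 < k.+1%:R * hump t by rewrite mulr_gt0.
  have E2 : (k.+1%:R * hump t / 2) ^+ 2 <= expR (k.+1%:R * hump t / 2) ^+ 2.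
    by rewrite ler_sqr ?nnegrE; lra.
  rewrite ler_pdivrMr ?exprn_gt0//.
  apply: (@le_trans _ _ (4 / hump t ^+ 2 / k.+1%:R * (k.+1%:R * hump t / 2) ^+ 2)).
    by rewrite le_eqVlt; apply/orP; left; apply/eqP; field; rewrite !gt_eqF.
  by apply: ler_wpM2l => //; rewrite !divr_ge0// sqr_ge0.
apply: (@cvg_invS _ _ _ 1) => k; rewrite subr0 mul1r.
have d0 := bump_den_gt0 k t.
rewrite ger0_norm; last by case/andP: (bump01 k t).
rewrite lef_pV2 ?posrE//.
have s2 : sin (pi / (s - p) * (c - t)) <= 0.
  have -> : pi / (s - p) * (c - t) = - (pi / (s - p) * (t - c)) by ring.
  rewrite sinN oppr_le0; apply: sin_ge0_pi; rewrite mulr_ge0 ?subr_ge0 ?(ltW w0)//=.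
  rewrite mulrAC ler_pdivrMr// ler_pM2l ?pi_gt0//; exact: (lerB (ltW ts) (ltW pc)).
have h0 : 0 <= - k.+1%:R * hump t.
  by rewrite mulNr -mulrN mulr_ge0// oppr_ge0 /hump pmulr_rle0.
rewrite -[leLHS]mulr1 -[leLHS]add0r lerD// ler_wpM2l//.
by apply: le_trans (expR_ge1Dx _); rewrite lerDl.
Qed.

End bump.

(* The limit is prescribed in the box only, so that every half-space {x_i < c}
   belongs to this class. *)
Definition test_limit (A : set 'rV[R]_d) := measurable A /\
  exists psi : nat -> 'rV[R]_d -> R,
    [/\ forall k, test_function a b (psi k),
        forall k x, 0 <= psi k x <= 1 &
        forall x, box a b x -> psi k x @[k --> \oo] --> (\1_A x : R)].

Lemma test_limitI : setI_closed test_limit.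
Proof.
move=> A B [mA [f [tf f01 fA]]] [mB [g [tg g01 gB]]]; split; first exact: measurableI.
exists (fun k => f k * g k); split=> [k|k x|x bx].
- exact: test_mul.
- have /andP[? ?] := f01 k x; have /andP[? ?] := g01 k x.
  by rewrite /GRing.mul/= mulr_ge0//= mulr_ile1.
- by rewrite indicI; apply: cvgM; [exact: fA|exact: gB].
Qed.

Lemma test_limit_cst (c : bool) (A : set 'rV[R]_d) : measurable A ->
  (forall x, box a b x -> x \in A = c) -> test_limit A.
Proof.
move=> mA cA; split=> //; exists (fun=> cst c%:R); split=> [k|k x|x bx].
- exact: test_cst.
- by case: c {cA} => /=; rewrite lexx ler01.
- by rewrite indicE cA//; exact: cvg_cst.
Qed.

Lemma test_limit_ray i c : test_limit (rV_coord i @^-1` `]-oo, c[).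
Proof.
have mA : measurable (rV_coord i @^-1` `]-oo, c[ : set 'rV[R]_d).
  by rewrite -[X in measurable X]setTI; apply: measurable_rV_coord.
(* Bumps are built for c strictly inside the i-th edge; otherwise the half-space misses or contains
   the whole box and a constant test function does. *)
have [ca|ac] := leP c (a ord0 i).
  apply: (test_limit_cst (c := false)) => // x bx.
  apply/negbTE; rewrite notin_setE /= in_itv/=; apply/negP; rewrite -leNgt.
  by apply: le_trans ca _; have /andP[/ltW] := bx i.
have [bc|cb] := leP (b ord0 i) c.
  apply: (test_limit_cst (c := true)) => // x bx.
  apply: mem_set; rewrite /= in_itv/=; apply: lt_le_trans bc.
  by have /andP[] := bx i.
split=> //; exists (fun k x => bump (a ord0 i) (b ord0 i) c k (x ord0 i)).
split=> [k|k x|x bx].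
- apply: test_coord; first exact: C1_bump.
  by move=> t; exact: bump_periodic.
- exact: bump01.
- have := @bump_cvg (a ord0 i) (b ord0 i) c (ab i) ac (x ord0 i) (bx i) cb.
  by rewrite indicE mem_setE/=.
Qed.

(** Half-spaces already generate the sigma-algebra, since rays generate that of R in each
    coordinate. *)
Lemma measurable_test_limit : @measurable _ 'rV[R]_d = <<s test_limit >>.
Proof.
apply/seteqP; split; last first.
  by apply: smallest_sub; [exact: sigma_algebra_measurable|move=> A []].
apply: smallest_sub; first exact: smallest_sigma_algebra.
move=> A; rewrite -bigcup_seq => -[i _ [Y mY <-]].
have : measurable_fun setT (rV_coord i : g_sigma_algebraType test_limit -> R).
  apply: (measurability _ (RGenInftyO.measurableE R)).
  move=> _ [_ [c ->] <-]; rewrite setTI; apply: sub_sigma_algebra.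
  exact: test_limit_ray.
by move=> /(_ measurableT _ mY).
Qed.

(** Dominated convergence makes the integral of w vanish on every set of [test_limit], a class
    stable under intersection; Dynkin's theorem extends this to all measurable sets, so w = 0 a.e.
    The finite measure of the box makes w integrable. *)
Lemma test_dense (w : 'rV[R]_d -> R) : L2 a b w ->
  (forall psi, test_function a b psi -> inner a b w psi = 0) ->
  w = cst 0 %[ae mu].
Proof.
move=> wL w0.
have wi : mu.-integrable setT (EFin \o w).
  apply/Lfun1_integrable; apply: Lfun_subset12 wL.
  by rewrite ge0_fin_numE ?measure_ge0// box_measure_fin.
have mw := Lfun2_measurable wL.
have test0 psi : test_function a b psi -> (\int[mu]_x (w x * psi x)%:E = 0)%E.
  move=> tpsi; have pL : L2 a b psi by apply: continuous_L2; exact: test_continuous tpsi.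
  have := w0 _ tpsi; rewrite /inner /Rintegral => h.
  by rewrite -[LHS]fineK ?h// integrable_fin_num//; exact: Lfun2_mul_integrable.
have zero A : measurable A -> (\int[mu]_(x in A) (w x)%:E = 0)%E.
  rewrite measurable_test_limit => mA.
  apply: (dynkin_induction (G := test_limit) (P := fun A => \int[mu]_(x in A) (w x)%:E = 0)%E) mA.
  - exact: measurable_test_limit.
  - exact: test_limitI.
  - have := test0 _ (test_cst a b 1); under eq_integral do rewrite mulr1.
    by [].
  - move=> B [mB [psi [tpsi psi01 psiB]]].
    rewrite integral_mkcond.
    have [| | | | |_ _] := @dominated_convergence _ _ R mu setT measurableT
        (fun k x => (w x * psi k x)%:E) (fun x => (w x * \1_B x)%:E) (fun x => `|(w x)%:E|)%E.
    - move=> k; apply/measurable_EFinP/measurable_funM => //.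
      apply: continuous_measurable_rV; exact: (test_continuous (tpsi k)).
    - by apply/measurable_EFinP/measurable_funM.
    - apply: ae_box => x bx _; apply: cvg_EFin; first exact: nearW.
      by apply: cvgM; [exact: cvg_cst|exact: psiB].
    - exact: integrable_abse.
    - apply: aeW => x k _; rewrite /= lee_fin normrM ler_piMr//.
      by have /andP[p0 p1] := psi01 k x; rewrite ger0_norm.
    under eq_fun do rewrite test0//.
    move=> /(cvg_unique (@ereal_hausdorff R) (cvg_cst 0%E)) H.
    transitivity (\int[mu]_x (w x * \1_B x)%:E)%E; last by rewrite -H.
    apply: eq_integral => x _; rewrite patchE indicE.
    by case: ifPn => _ /=; rewrite ?mulr1 ?mulr0.
  - move=> S mS S0; have := integral_setU mu mS (measurableC mS).
    move=> /(_ (EFin \o w)); rewrite setUv /= S0 add0e => <-.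
    - have := test0 _ (test_cst a b 1); under eq_integral do rewrite mulr1.
      by [].
    - exact/measurable_EFinP.
    - by apply/disj_setPCl.
  - move=> F mF tF F0; rewrite integral_bigcup//.
      by apply: eseries0 => k _ _; exact: F0.
    apply: integrableS wi => //; exact: bigcupT_measurable.
have : ae_eq mu setT (EFin \o w) (cst 0%E).
  apply: integral_ae_eq => // E _ mE.
  by rewrite integral0 zero.
by apply: filterS => x /(_ I) [].
Qed.

End density.

(** * Periodic H^1 *)

Lemma sqr_le_norm (R : realType) (x y z p r : R) : x ^+ 2 <= y * z ->
  0 <= y -> 0 <= z -> 0 <= p -> 0 <= r -> y <= p ^+ 2 -> z <= r ^+ 2 ->
  `|x| <= p * r.
Proof.
move=> xyz y0 z0 p0 r0 yp zr; rewrite -ler_sqr ?nnegrE ?mulr_ge0//.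
rewrite -normrX ger0_norm ?sqr_ge0// exprMn; apply: le_trans xyz _.
exact: ler_pM.
Qed.

Section periodic_H1.
Context (R : realType) (d : nat) (a b : 'rV[R]_d).
Hypothesis ab : forall i, a ord0 i < b ord0 i.
Local Notation mu := (box_measure a b).
Local Notation field := ('rV[R]_d -> R).
Implicit Types u v w psi : field.

Lemma innerE u v : inner a b u v = l2ip mu u v. Proof. by []. Qed.

Lemma L2_lin c u v : L2 a b u -> L2 a b v -> L2 a b (c *: u + v).
Proof. exact: Lfun2_lin. Qed.

Lemma L2_0 : L2 a b 0. Proof. exact: Lfun2_0. Qed.

Lemma inner_lin c u v w : L2 a b u -> L2 a b v -> L2 a b w ->
  inner a b (c *: u + v) w = c * inner a b u w + inner a b v w.
Proof. exact: l2ipP. Qed.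

Lemma test_L2 psi : test_function a b psi -> L2 a b psi.
Proof. by move=> tp; apply: continuous_L2; exact: (test_continuous tp). Qed.

Lemma partial_L2 psi i : test_function a b psi -> L2 a b (partial i psi).
Proof. by move=> [_ pc _]; exact: continuous_L2. Qed.

Lemma weak_partial_unique i u w w' :
  weak_partial a b i u w -> weak_partial a b i u w' -> w = w' %[ae mu].
Proof.
move=> [wL wP] [w'L w'P].
have dL : L2 a b (-1 *: w' + w) by exact: L2_lin.
have : -1 *: w' + w = cst 0 %[ae mu].
  apply: (test_dense ab dL) => psi tp; rewrite inner_lin//; last exact: test_L2.
  by rewrite wP// w'P// mulN1r opprK addrN.
apply: filterS => x /(_ I) h _; move: h.
rewrite (_ : (-1 *: w' + w) x = w x - w' x).
  by move/eqP; rewrite subr_eq0 => /eqP.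
by rewrite scaleN1r addrC.
Qed.

Lemma weak_partial_lin i c u v w z : L2 a b u -> L2 a b v ->
  weak_partial a b i u w -> weak_partial a b i v z ->
  weak_partial a b i (c *: u + v) (c *: w + z).
Proof.
move=> uL vL [wL wP] [zL zP]; split=> [|psi tp]; first exact: L2_lin.
rewrite !inner_lin//; [|exact: partial_L2|exact: test_L2].
by rewrite wP// zP//; ring.
Qed.

Lemma weak_partial_ae i u v w : L2 a b u -> L2 a b v -> u = v %[ae mu] ->
  weak_partial a b i u w -> weak_partial a b i v w.
Proof.
move=> uL vL uv [wL wP]; split=> // psi tp; rewrite wP//; congr (- _).
by apply: l2ip_ae => //; [exact: partial_L2|exact: partial_L2|exact: ae_eq_refl].
Qed.

(** The very choice made by [grad] in its i-th component; it is linear in [u] only almost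
    everywhere, by uniqueness of weak derivatives. *)
Definition wpartial i u : field := xget (cst 0) [set w | weak_partial a b i u w].

Lemma gradE u x i : grad a b u x ord0 i = wpartial i u x.
Proof. by rewrite mxE. Qed.

Lemma wpartialP i u : H1 a b u -> weak_partial a b i u (wpartial i u).
Proof. by move=> [_ /(_ i)[w wP]]; apply: (xgetPex (cst 0)); exists w. Qed.

Lemma wpartial_L2 i u : H1 a b u -> L2 a b (wpartial i u).
Proof. by move=> /(wpartialP i)[]. Qed.

Lemma H1_L2 u : H1 a b u -> L2 a b u. Proof. by case. Qed.

Lemma H1_lin c u v : H1 a b u -> H1 a b v -> H1 a b (c *: u + v).
Proof.
move=> uH vH; split; first by apply: L2_lin; exact: H1_L2.
move=> i; exists (c *: wpartial i u + wpartial i v).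
by apply: weak_partial_lin; [exact: H1_L2|exact: H1_L2|exact: wpartialP|exact: wpartialP].
Qed.

Lemma H1_0 : H1 a b 0.
Proof.
split; first exact: L2_0.
move=> i; exists 0; split; first exact: L2_0.
have z psi : L2 a b psi -> inner a b 0 psi = 0.
  by move=> pL; have := ip0l (X := hL2 mu) pL.
by move=> psi tp; rewrite !z ?oppr0//; [exact: partial_L2|exact: test_L2].
Qed.

Lemma H1_ae u v : L2 a b v -> u = v %[ae mu] -> H1 a b u -> H1 a b v.
Proof.
move=> vL uv uH; split=> // i; exists (wpartial i u).
by apply: (weak_partial_ae _ vL uv); [exact: H1_L2|exact: wpartialP].
Qed.

Lemma wpartial_lin i c u v : H1 a b u -> H1 a b v ->
  wpartial i (c *: u + v) = c *: wpartial i u + wpartial i v %[ae mu].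
Proof.
move=> uH vH; apply: weak_partial_unique; first exact: (wpartialP _ (H1_lin c uH vH)).
by apply: weak_partial_lin; [exact: H1_L2|exact: H1_L2|exact: wpartialP|exact: wpartialP].
Qed.

Definition dirichlet u v := innerv a b (grad a b u) (grad a b v).

Lemma innerv_grad u v : innerv a b (grad a b u) (grad a b v) = dirichlet u v.
Proof. by []. Qed.

Lemma dirichletE u v : H1 a b u -> H1 a b v ->
  dirichlet u v = \sum_i inner a b (wpartial i u) (wpartial i v).
Proof.
move=> uH vH; rewrite /dirichlet /innerv /dotv.
have : forall s : seq 'I_d,
    mu.-integrable setT (EFin \o (fun x => \sum_(i <- s) wpartial i u x * wpartial i v x)) /\
    \int[mu]_x (\sum_(i <- s) wpartial i u x * wpartial i v x) =
    \sum_(i <- s) inner a b (wpartial i u) (wpartial i v).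
  elim=> [|i s [IHi IH]].
    rewrite big_nil; under [in X in Rintegral _ _ X]eq_fun do rewrite big_nil.
    split; last by rewrite Rintegral_cst// mul0r.
    rewrite (_ : EFin \o _ = cst 0%E); first exact: integrable0.
    by apply/funext => x /=; rewrite big_nil.
  have ii : mu.-integrable setT (EFin \o (fun x => wpartial i u x * wpartial i v x)).
    by apply: Lfun2_mul_integrable; exact: wpartial_L2.
  split.
    rewrite (_ : EFin \o _ = fun x => ((wpartial i u x * wpartial i v x)%:E +
        (\sum_(i <- s) wpartial i u x * wpartial i v x)%:E)%E); first exact: integrableD.
    by apply/funext => x /=; rewrite big_cons EFinD.
  rewrite big_cons -IH /inner -RintegralD//.
  by apply: eq_Rintegral => x _; rewrite big_cons.
move=> /(_ (index_enum _))[_ <-]; apply: eq_Rintegral => x _.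
by apply: eq_bigr => i _; rewrite !gradE.
Qed.

Lemma dirichletC u v : dirichlet u v = dirichlet v u.
Proof.
by apply: eq_Rintegral => x _; apply: eq_bigr => i _; rewrite mulrC.
Qed.

Lemma dirichlet_lin c u v w : H1 a b u -> H1 a b v -> H1 a b w ->
  dirichlet (c *: u + v) w = c * dirichlet u w + dirichlet v w.
Proof.
move=> uH vH wH; have uvH := H1_lin c uH vH.
rewrite !dirichletE// mulr_sumr -big_split; apply: eq_bigr => i _ /=.
rewrite -inner_lin; [|exact: wpartial_L2..].
apply: l2ip_ae; [exact: wpartial_L2|exact: wpartial_L2| |exact: wpartial_L2| |exact: ae_eq_refl].
- by apply: L2_lin; exact: wpartial_L2.
- exact: wpartial_lin.
Qed.

Lemma dirichlet_ge0 u : H1 a b u -> 0 <= dirichlet u u.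
Proof. by move=> uH; rewrite dirichletE// sumr_ge0// => i _; exact: l2ip_ge0. Qed.

Lemma dirichlet_ae u u' v : H1 a b u -> H1 a b u' -> H1 a b v ->
  u = u' %[ae mu] -> dirichlet u v = dirichlet u' v.
Proof.
move=> uH u'H vH uu; rewrite (dirichletE uH vH) (dirichletE u'H vH).
apply: eq_bigr => i _.
have wv := wpartial_L2 i vH.
have uu' : wpartial i u = wpartial i u' %[ae mu].
  apply: (weak_partial_unique (i := i) (u := u')); last exact: wpartialP.
  exact: (weak_partial_ae (H1_L2 uH) (H1_L2 u'H) uu (wpartialP i uH)).
exact: (l2ip_ae (wpartial_L2 i uH) wv (wpartial_L2 i u'H) wv uu' (ae_eq_refl _ _ _)).
Qed.

Lemma dirichlet_psd n (K : 'I_n -> 'I_n -> R) (u : 'I_n -> field) :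
  (forall x : 'I_n -> R, 0 <= \sum_i \sum_j K i j * (x i * x j)) ->
  (forall i, H1 a b (u i)) ->
  0 <= \sum_i \sum_j K i j * dirichlet (u i) (u j).
Proof.
move=> K0 uH.
rewrite (eq_bigr (fun i => \sum_j \sum_k
    K i j * inner a b (wpartial k (u i)) (wpartial k (u j)))).
  under eq_bigr do rewrite exchange_big.
  rewrite exchange_big sumr_ge0// => k _.
  by apply: l2ip_psd => // i; exact: wpartial_L2.
by move=> i _; apply: eq_bigr => j _; rewrite dirichletE// mulr_sumr.
Qed.

Definition h1ip u v := inner a b u v + dirichlet u v.

(** The functions and each of their weak derivatives converge in L^2. Against a fixed test function
    the identity defining weak derivatives is continuous in both, so the limit of the derivatives is
    the derivative of the limit. *)
Lemma h1_complete (u : nat -> field) : (forall n, H1 a b (u n)) ->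
  (forall e, 0 < e -> exists N, forall m n, (N <= m)%N -> (N <= n)%N ->
    h1ip (u m - u n) (u m - u n) < e) ->
  exists2 l, H1 a b l & forall e, 0 < e -> exists N, forall n, (N <= n)%N ->
    h1ip (u n - l) (u n - l) < e.
Proof.
move=> uH uC.
have BE f g : f - g = -1 *: g + f :> field by rewrite scaleN1r addrC.
have H1B f g : H1 a b f -> H1 a b g -> H1 a b (f - g).
  by move=> fH gH; rewrite BE; exact: H1_lin.
have wB i f g : H1 a b f -> H1 a b g ->
    inner a b (wpartial i (f - g)) (wpartial i (f - g)) =
    l2ip mu (wpartial i f - wpartial i g) (wpartial i f - wpartial i g).
  move=> fH gH; have e : wpartial i (f - g) = wpartial i f - wpartial i g %[ae mu].
    by rewrite !BE; exact: wpartial_lin.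
  apply: l2ip_ae => //; try exact: (wpartial_L2 i (H1B _ _ fH gH)).
    by rewrite BE; apply: L2_lin; exact: wpartial_L2.
  by rewrite BE; apply: L2_lin; exact: wpartial_L2.
have [|e e0|l lL ul] := @l2_complete _ _ _ mu u.
- by move=> n; exact: H1_L2.
- have [N HN] := uC _ e0; exists N => m n Nm Nn.
  apply: le_lt_trans (HN _ _ Nm Nn); rewrite /h1ip lerDl.
  exact/dirichlet_ge0/H1B.
have dl i : exists w, L2 a b w /\ forall e, 0 < e -> exists N, forall n, (N <= n)%N ->
    l2ip mu (wpartial i (u n) - w) (wpartial i (u n) - w) < e.
  have [|e e0|w wL uw] := @l2_complete _ _ _ mu (fun n => wpartial i (u n)).
  - by move=> n; exact: wpartial_L2.
  - have [N HN] := uC _ e0; exists N => m n Nm Nn.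
    apply: le_lt_trans (HN _ _ Nm Nn); rewrite -wB// /h1ip.
    rewrite dirichletE; [|exact: H1B..].
    rewrite (bigD1 i)//= addrCA lerDl addr_ge0 ?l2ip_ge0//.
    by rewrite sumr_ge0// => j _; exact: l2ip_ge0.
  - by exists w.
have /choice[w wP] := dl.
have wpl i : weak_partial a b i l (w i).
  have [wL uw] := wP i; split=> // psi tp.
  have psiL := test_L2 tp; have dpsiL := partial_L2 i tp.
  apply/eqP; rewrite -subr_eq0 opprK -sqrf_eq0 eq_le sqr_ge0 andbT.
  pose C := l2ip mu psi psi + l2ip mu (partial i psi) (partial i psi).
  (* The defect is a sum of two errors whose squares are at most e |psi|^2 and e |partial psi|^2,
     and the square of a sum is at most twice the sum of the squares. *)
  apply: (@le0_of_small _ (2 * C)).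
    by rewrite mulr_ge0// addr_ge0 ?l2ip_ge0.
  move=> e e0; have [N1 HN1] := uw _ e0; have [N2 HN2] := ul _ e0.
  pose n := maxn N1 N2.
  have := HN1 n (leq_maxl _ _); have := HN2 n (leq_maxr _ _).
  have [dL dP] := wpartialP i (uH n); have uL := H1_L2 (uH n).
  have := ip_cauchy_schwarz (X := hL2 mu) (hdomB (X := hL2 mu) dL wL) psiL.
  have := ip_cauchy_schwarz (X := hL2 mu) (hdomB (X := hL2 mu) uL lL) dpsiL.
  have := dP _ tp; rewrite !innerE.
  rewrite (ipBl (X := hL2 mu) uL lL dpsiL) (ipBl (X := hL2 mu) dL wL psiL) /=.
  have := l2ip_ge0 mu psi; have := l2ip_ge0 mu (partial i psi); rewrite /C.
  set x1 := l2ip mu _ _; set x2 := l2ip mu psi psi.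
  set y1 := l2ip mu (wpartial i (u n)) psi; set y2 := l2ip mu (u n) _.
  set z1 := l2ip mu l _; set z2 := l2ip mu (w i) psi.
  set s1 := l2ip mu (u n - l) _; set s2 := l2ip mu (wpartial i (u n) - w i) _.
  move=> x10 x20 y12 h1 h2 k1 k2.
  have e1 : s1 * x1 <= e * x1 by rewrite ler_wpM2r// ltW.
  have e2 : s2 * x2 <= e * x2 by rewrite ler_wpM2r// ltW.
  have -> : z2 + z1 = - (y1 - z2) - (y2 - z1) by rewrite y12; ring.
  move: (y1 - z2) (y2 - z1) (s1 * x1) (s2 * x2) h1 h2 e1 e2 => r t v1 v2 h1 h2 e1 e2.
  by have := sqr_ge0 (r - t); nra.
have lH : H1 a b l by split=> // i; exists (w i).
exists l => // e e0.
have d1 : 0 < d%:R + 1 :> R by rewrite ltr_wpDl.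
(* One share for the function and one for each of its d derivatives. *)
have ed : 0 < e / (d%:R + 1) by rewrite divr_gt0.
have [N0 HN0] := ul _ ed.
have /choice[N HN] : forall i, exists N, forall n, (N <= n)%N ->
    inner a b (wpartial i (u n - l)) (wpartial i (u n - l)) < e / (d%:R + 1).
  move=> i; have [wL /(_ _ ed)[N HN]] := wP i; exists N => n Nn.
  rewrite wB//; apply: le_lt_trans (HN n Nn).
  rewrite le_eqVlt; apply/orP; left; apply/eqP.
  have wl : wpartial i l = w i %[ae mu].
    by apply: weak_partial_unique (wpl i); exact: wpartialP.
  have e1 : wpartial i (u n) - wpartial i l = wpartial i (u n) - w i %[ae mu].
    apply: filterS wl => x /(_ I) h _.
    by rewrite [LHS](_ : _ = wpartial i (u n) x - wpartial i l x)// h.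
  apply: l2ip_ae => //; rewrite BE; apply: L2_lin => //; exact: wpartial_L2.
exists (maxn N0 (\max_i N i)) => n; rewrite geq_max => /andP[Nn0 Nn].
rewrite /h1ip dirichletE; [|exact: H1B..].
apply: (@lt_le_trans _ _ (e / (d%:R + 1) + \sum_(i < d) e / (d%:R + 1))).
  apply: ltr_leD; first exact: HN0.
  apply: ler_sum => i _; apply/ltW/HN; apply: leq_trans Nn; exact: leq_bigmax.
rewrite sumr_const card_ord -[X in _ + X]mulr_natr -{1}[e / _]mulr1 -mulrDr addrC.
by rewrite mulfVK// gt_eqF.
Qed.

#[local] Opaque dirichlet.

Definition hH1 : hspace field.
Proof.
apply: (@HSpace R field (H1 a b) h1ip).
- exact: H1_0.
- exact: H1_lin.
- move=> c u v w uH vH wH; rewrite /h1ip inner_lin; [|exact: H1_L2..].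
  by rewrite (dirichlet_lin c uH vH wH) mulrDr addrACA.
- by move=> u v _ _; rewrite /h1ip dirichletC innerE l2ipC.
- by move=> u uH; rewrite addr_ge0 ?l2ip_ge0 ?dirichlet_ge0.
- exact: h1_complete.
Defined.

Lemma blin_H1_L2 : blin hH1 (hL2 mu) id.
Proof.
split=> [u []|//|]; first by [].
exists 1 => // u uH; rewrite mul1r ler_wsqrtr// lerDl; exact: dirichlet_ge0.
Qed.

Lemma bform_dirichlet : bform hH1 hH1 dirichlet.
Proof.
split=> [c u v w uH vH wH|c u v w uH vH wH|].
- exact: dirichlet_lin.
- by rewrite dirichletC (dirichlet_lin c vH wH uH) (dirichletC v u) (dirichletC w u).
- exists 1 => // u v uH vH; rewrite mul1r.
  have K t : 0 <= dirichlet u u + 2 * t * dirichlet u v + t ^+ 2 * dirichlet v v.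
    have tvuH := H1_lin t vH uH.
    have := dirichlet_ge0 tvuH; rewrite (dirichlet_lin t vH uH tvuH).
    rewrite (dirichletC v (_ + _)) (dirichletC u (_ + _)).
    rewrite (dirichlet_lin t vH uH vH) (dirichlet_lin t vH uH uH) (dirichletC v u).
    move: (dirichlet u u) (dirichlet u v) (dirichlet v v) => x y z h.
    by apply: le_trans h _; rewrite le_eqVlt; apply/orP; left; apply/eqP; ring.
  apply: (sqr_le_norm (quadratic_ge0_discr (dirichlet_ge0 uH) (dirichlet_ge0 vH) K));
    [exact: dirichlet_ge0|exact: dirichlet_ge0|exact: ipnorm_ge0|exact: ipnorm_ge0| |].
    by rewrite (ipnorm_sqr (X := hH1) uH) lerDr; exact: l2ip_ge0.
  by rewrite (ipnorm_sqr (X := hH1) vH) lerDr; exact: l2ip_ge0.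
Qed.

End periodic_H1.

(** * Runge-Kutta sums and bilinear forms *)

Lemma positive_lower_bound (R : realType) (n : nat) (f : 'I_n -> R) :
  (forall i, 0 < f i) -> exists2 m, 0 < m & forall i, m <= f i.
Proof.
(* The added 1 keeps the bound positive when the index set is empty. *)
move=> f0; exists (1 + \sum_i (f i)^-1)^-1.
  by rewrite invr_gt0 ltr_wpDr// sumr_ge0// => i _; rewrite invr_ge0 ltW.
move=> i; rewrite -[leRHS]invrK lef_pV2 ?posrE ?invr_gt0//; last first.
  by rewrite ltr_wpDr// sumr_ge0// => j _; rewrite invr_ge0 ltW.
rewrite (bigD1 i)//= addrCA lerDl addr_ge0// sumr_ge0// => j _.
by rewrite invr_ge0 ltW.
Qed.

Section runge_kutta_forms.
Context (R : realType) (q : nat) (rk : butcher R q).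
Local Notation A := (alpha rk).
Local Notation b := (beta rk).

Section bilinear.
Context (V : lmodType R) (D : V -> Prop) (s : V -> V -> R).
Hypotheses (D0 : D 0) (Dlin : forall c u v, D u -> D v -> D (c *: u + v)).
Hypothesis s_lin : forall c u v w, D u -> D v -> D w ->
  s (c *: u + v) w = c * s u w + s v w.
Hypothesis s_sym : forall u v, D u -> D v -> s u v = s v u.

Definition stage_sum (w : 'I_q -> V) (i : 'I_q) := \sum_j A i j *: w j.

Lemma form0l w : D w -> s 0 w = 0.
Proof.
move=> wD; have := s_lin 1 D0 D0 wD; rewrite scale1r addr0 mul1r.
by move/eqP; rewrite -subr_eq0 opprD addrA subrr add0r oppr_eq0 => /eqP.
Qed.

Lemma dom_lincomb (c : 'I_q -> R) (w : 'I_q -> V) : (forall i, D (w i)) ->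
  D (\sum_j c j *: w j).
Proof. by move=> wD; elim/big_rec: _ => // j v _ vD; exact: Dlin. Qed.

Lemma form_suml (c : 'I_q -> R) (w : 'I_q -> V) v : (forall i, D (w i)) -> D v ->
  s (\sum_j c j *: w j) v = \sum_j c j * s (w j) v.
Proof.
move=> wD vD; suff [] : D (\sum_j c j *: w j) /\
    s (\sum_j c j *: w j) v = \sum_j c j * s (w j) v by [].
elim/big_rec2: _ => [|j x y _ [yD <-]]; first by split=> //; exact: form0l.
by split; [exact: Dlin|exact: s_lin].
Qed.

Lemma form_sumr (c : 'I_q -> R) (w : 'I_q -> V) v : (forall i, D (w i)) -> D v ->
  s v (\sum_j c j *: w j) = \sum_j c j * s v (w j).
Proof.
move=> wD vD; rewrite s_sym// ?form_suml//; last exact: dom_lincomb.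
by apply: eq_bigr => j _; rewrite s_sym.
Qed.

(** Writes a stage inequality as positivity of a form with scalar matrix coefficients. The matrix
    does not depend on [V] or [s], so the case of products of reals decides the sign in all
    cases. *)
Lemma form_stage_suml (e : 'I_q -> R) (c : R) (w : 'I_q -> V) :
  (forall i, D (w i)) ->
  \sum_i \sum_j (e i * A i j - c * (i == j)%:R) * s (w i) (w j) =
  \sum_i e i * s (stage_sum w i) (w i) - c * \sum_i s (w i) (w i).
Proof.
move=> wD; rewrite mulr_sumr -sumrB; apply: eq_bigr => i _.
rewrite form_suml// mulr_sumr.
under eq_bigr do rewrite mulrBl; rewrite sumrB; congr (_ - _).
  by apply: eq_bigr => j _; rewrite (s_sym (wD i))// mulrA.
rewrite (bigD1 i)//= eqxx mulr1 big1 ?addr0// => j ji.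
by rewrite eq_sym (negbTE ji) mulr0 mul0r.
Qed.

Lemma form_stage_sum_sqr (e : 'I_q -> R) (c : R) (w : 'I_q -> V) :
  (forall i, D (w i)) ->
  \sum_j \sum_k ((\sum_i e i * A i j * A i k) - c * (j == k)%:R) * s (w j) (w k) =
  \sum_i e i * s (stage_sum w i) (stage_sum w i) - c * \sum_i s (w i) (w i).
Proof.
move=> wD.
have -> : \sum_i e i * s (stage_sum w i) (stage_sum w i) =
    \sum_j \sum_k (\sum_i e i * A i j * A i k) * s (w j) (w k).
  under [RHS]eq_bigr => j _ do under eq_bigr do rewrite mulr_suml.
  under [RHS]eq_bigr => j _ do rewrite exchange_big.
  rewrite exchange_big/=; apply: eq_bigr => i _.
  rewrite form_suml//; last exact: dom_lincomb.
  rewrite mulr_sumr; apply: eq_bigr => j _.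
  rewrite form_sumr// !mulr_sumr; apply: eq_bigr => k _; ring.
rewrite mulr_sumr -sumrB; apply: eq_bigr => j _.
under eq_bigr do rewrite mulrBl; rewrite sumrB; congr (_ - _).
rewrite (bigD1 j)//= eqxx mulr1 big1 ?addr0// => k kj.
by rewrite eq_sym (negbTE kj) mulr0 mul0r.
Qed.

(** The identity behind algebraic stability: expand the square of the update, then replace [u0] by
    the stage value in the cross terms. The quadratic terms left over are exactly those of M. *)
Lemma form_step (h : R) (u0 : V) (k : 'I_q -> V) : D u0 -> (forall i, D (k i)) ->
  s (u0 + h *: \sum_i b i *: k i) (u0 + h *: \sum_i b i *: k i) - s u0 u0 =
  2 * h * (\sum_i b i * s (u0 + h *: stage_sum k i) (k i))
  - h ^+ 2 * \sum_i \sum_j stab_mx rk i j * s (k i) (k j).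
Proof.
move=> uD kD.
have lin c u v : D u -> D v -> forall w, D w -> s (u + c *: v) w = s u w + c * s v w.
  by move=> uD' vD w wD; rewrite addrC s_lin// addrC.
have kbD := dom_lincomb b kD.
have ukD : D (u0 + h *: \sum_i b i *: k i) by rewrite addrC; exact: Dlin.
rewrite lin// !(s_sym _ ukD)// !lin//.
have -> : \sum_i b i * s (u0 + h *: stage_sum k i) (k i) =
    \sum_i b i * s u0 (k i) + h * \sum_i \sum_j b i * A i j * s (k i) (k j).
  rewrite mulr_sumr -big_split; apply: eq_bigr => i _ /=.
  rewrite lin//; last exact: dom_lincomb.
  rewrite form_suml// mulrDr; congr (_ + _).
  rewrite mulrCA; congr (_ * _); rewrite mulr_sumr; apply: eq_bigr => j _.
  by rewrite (s_sym (kD i))// mulrA.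
have -> : \sum_i \sum_j stab_mx rk i j * s (k i) (k j) =
    2 * (\sum_i \sum_j b i * A i j * s (k i) (k j))
    - \sum_i \sum_j b i * b j * s (k i) (k j).
  rewrite mulr_natl mulr2n [X in _ + X - _]exchange_big/= -big_split -sumrB.
  apply: eq_bigr => i _ /=; rewrite -big_split -sumrB; apply: eq_bigr => j _ /=.
  by rewrite mxE (s_sym (kD j))//; ring.
have -> : s (\sum_i b i *: k i) (\sum_i b i *: k i) =
    \sum_i \sum_j b i * b j * s (k i) (k j).
  rewrite form_suml//; apply: eq_bigr => i _; rewrite form_sumr// mulr_sumr.
  by apply: eq_bigr => j _; rewrite mulrA.
rewrite (s_sym kbD uD) form_sumr//; ring.
Qed.

End bilinear.

(** * Coercivity of the stages, first for reals and then for positive forms *)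

Hypotheses (q0 : (0 < q)%N) (hrk : algebraically_stable rk).

(** Invertibility of A made quantitative: [w] is the inverse of A applied to its Runge-Kutta sums,
    and Cauchy-Schwarz on each row brings in the squared Frobenius norm of the inverse. *)
Lemma rk_sum_lower : exists2 c, 0 < c &
  forall w, c * (\sum_i w i ^+ 2) <= \sum_i rk_sum rk w i ^+ 2.
Proof.
have [Au _ _ _ _] := hrk.
pose N := invmx A; pose C := 1 + \sum_i \sum_j N i j ^+ 2.
have C0 : 0 < C.
  by rewrite ltr_wpDr// !sumr_ge0// => i _; rewrite sumr_ge0// => j _; exact: sqr_ge0.
exists C^-1 => [|w]; first by rewrite invr_gt0.
rewrite ler_pdivrMl//.
have wE i : w i = \sum_j N i j * rk_sum rk w j.
  have : (N *m (A *m \col_k w k)) i ord0 = w i by rewrite mulmxA mulVmx// mul1mx mxE.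
  rewrite mxE => <-; apply: eq_bigr => j _; rewrite mxE; congr (_ * _).
  by apply: eq_bigr => k _; rewrite mxE.
have z0 : 0 <= \sum_i rk_sum rk w i ^+ 2 by rewrite sumr_ge0// => i _; exact: sqr_ge0.
apply: (@le_trans _ _ ((\sum_i \sum_j N i j ^+ 2) * \sum_i rk_sum rk w i ^+ 2)); last first.
  by rewrite ler_wpM2r// lerDr.
rewrite mulr_suml; apply: ler_sum => i _; rewrite {1}wE.
exact: (@ip_cauchy_schwarz _ _ (hfun 'I_q (hreal R)) (fun j => N i j) (rk_sum rk w)).
Qed.

Definition weight i := b i / gamma rk i.

Lemma weight_gt0 i : 0 < weight i.
Proof. by have [_ b0 _ _ _] := hrk; rewrite divr_gt0// gamma_gt0. Qed.

Lemma rk_coercive : exists2 c, 0 < c & forall w,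
  c * (\sum_i w i ^+ 2) <= \sum_i weight i * (rk_sum rk w i * w i) /\
  c * (\sum_i w i ^+ 2) <= \sum_i weight i * (rk_sum rk w i * rk_sum rk w i).
Proof.
have [c0 c0_gt0 c0P] := rk_sum_lower.
have [_ b0 _ _ _] := hrk.
have [|m1 m1_gt0 m1P] := @positive_lower_bound R q (fun i => 2^-1 * (b i / gamma rk i ^+ 2)).
  by move=> i; rewrite mulr_gt0// divr_gt0// exprn_gt0// gamma_gt0.
have [m2 m2_gt0 m2P] := positive_lower_bound weight_gt0.
pose m := Num.min m1 m2.
have m0 : 0 < m by rewrite lt_min m1_gt0.
exists (m * c0) => [|w]; first exact: mulr_gt0.
have zw : m * c0 * (\sum_i w i ^+ 2) <= m * \sum_i rk_sum rk w i ^+ 2.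
  by rewrite -mulrA ler_pM2l.
split; apply: le_trans zw _.
  apply: le_trans (rk_sum_ge q0 hrk w); rewrite !mulr_sumr; apply: ler_sum => i _.
  by rewrite [leRHS]mulrA ler_wpM2r ?sqr_ge0// (le_trans _ (m1P i))// ge_min lexx.
rewrite !mulr_sumr; apply: ler_sum => i _.
by rewrite expr2 ler_wpM2r -?expr2 ?sqr_ge0// (le_trans _ (m2P i))// ge_min lexx orbT.
Qed.

Section coercive_forms.
Context (V : lmodType R) (D : V -> Prop) (s : V -> V -> R).
Hypotheses (D0 : D 0) (Dlin : forall c u v, D u -> D v -> D (c *: u + v)).
Hypothesis s_lin : forall c u v w, D u -> D v -> D w ->
  s (c *: u + v) w = c * s u w + s v w.
Hypothesis s_sym : forall u v, D u -> D v -> s u v = s v u.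
Hypothesis s_psd : forall (K : 'I_q -> 'I_q -> R) (u : 'I_q -> V),
  (forall x : 'I_q -> R, 0 <= \sum_i \sum_j K i j * (x i * x j)) ->
  (forall i, D (u i)) -> 0 <= \sum_i \sum_j K i j * s (u i) (u j).

(** The scalar hypothesis says that the quadratic form of the matrix weight_i a_ij - c delta_ij is
    nonnegative; [s_psd] carries this to [V]. *)
Lemma weighted_coercive c : (forall w : 'I_q -> R,
    c * (\sum_i w i ^+ 2) <= \sum_i weight i * (rk_sum rk w i * w i)) ->
  forall w, (forall i, D (w i)) ->
  c * (\sum_i s (w i) (w i)) <= \sum_i weight i * s (stage_sum w i) (w i).
Proof.
move=> cP w wD; rewrite -subr_ge0 -(form_stage_suml D0 Dlin s_lin s_sym weight c wD).
apply: s_psd => // x.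
(* The same identity read in R, with the product as form, turns the matrix condition back into the
   scalar hypothesis. *)
rewrite (@form_stage_suml R (fun=> True) (fun x y => x * y))//.
- rewrite subr_ge0; apply: le_trans (cP x).
  by rewrite le_eqVlt; apply/orP; left; apply/eqP; congr (_ * _); apply: eq_bigr.
- by move=> k u v z _ _ _; rewrite mulrDl -mulrA.
- by move=> u v _ _; exact: mulrC.
Qed.

Lemma weighted_coercive_sqr c : (forall w : 'I_q -> R,
    c * (\sum_i w i ^+ 2) <= \sum_i weight i * (rk_sum rk w i * rk_sum rk w i)) ->
  forall w, (forall i, D (w i)) ->
  c * (\sum_i s (w i) (w i)) <=
  \sum_i weight i * s (stage_sum w i) (stage_sum w i).
Proof.
move=> cP w wD; rewrite -subr_ge0 -(form_stage_sum_sqr D0 Dlin s_lin s_sym weight c wD).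
apply: s_psd => // x.
rewrite (@form_stage_sum_sqr R (fun=> True) (fun x y => x * y))//.
- rewrite subr_ge0; apply: le_trans (cP x).
  by rewrite le_eqVlt; apply/orP; left; apply/eqP; congr (_ * _); apply: eq_bigr.
- by move=> k u v z _ _ _; rewrite mulrDl -mulrA.
- by move=> u v _ _; exact: mulrC.
Qed.

Lemma stab_sum_ge0 w : (forall i, D (w i)) ->
  0 <= \sum_i \sum_j stab_mx rk i j * s (w i) (w j).
Proof.
by move=> wD; apply: s_psd => // x; rewrite -stab_formE; exact: stab_form_ge0.
Qed.

Lemma form_step_le (h : R) (u0 : V) (k : 'I_q -> V) : D u0 -> (forall i, D (k i)) ->
  s (u0 + h *: \sum_i b i *: k i) (u0 + h *: \sum_i b i *: k i) - s u0 u0 <=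
  2 * h * (\sum_i b i * s (u0 + h *: stage_sum k i) (k i)).
Proof.
move=> uD kD; rewrite (form_step D0 Dlin s_lin s_sym)// lerBlDr lerDl.
by rewrite mulr_ge0 ?sqr_ge0// stab_sum_ge0.
Qed.

End coercive_forms.

End runge_kutta_forms.

(** * The stage equations in weak form *)

Section weak_scheme.
Context (R : realType) (q : nat) (rk : butcher R q).
Hypotheses (q0 : (0 < q)%N) (hrk : algebraically_stable rk).
Context (V : lmodType R) (X : hspace V) (inn dir : V -> V -> R).
Hypotheses (inn_form : bform X X inn) (dir_form : bform X X dir).
Hypotheses (inn_sym : forall u v, hdom X u -> hdom X v -> inn u v = inn v u)
  (dir_sym : forall u v, hdom X u -> hdom X v -> dir u v = dir v u).
Hypothesis inn_psd : forall (K : 'I_q -> 'I_q -> R) (u : 'I_q -> V),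
  (forall x : 'I_q -> R, 0 <= \sum_i \sum_j K i j * (x i * x j)) ->
  (forall i, hdom X (u i)) -> 0 <= \sum_i \sum_j K i j * inn (u i) (u j).
Hypothesis dir_psd : forall (K : 'I_q -> 'I_q -> R) (u : 'I_q -> V),
  (forall x : 'I_q -> R, 0 <= \sum_i \sum_j K i j * (x i * x j)) ->
  (forall i, hdom X (u i)) -> 0 <= \sum_i \sum_j K i j * dir (u i) (u j).
Hypotheses (inn_ge0 : forall u, hdom X u -> 0 <= inn u u)
  (dir_ge0 : forall u, hdom X u -> 0 <= dir u u).
Hypothesis ipE : forall u v, ip X u v = inn u v + dir u v.
Context (f p : 'I_q -> V -> R).
Hypotheses (f_lin : forall i, blin X (hreal R) (f i))
  (p_lin : forall i, blin X (hreal R) (p i)).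
Context (t c1 c2 l k h : R).
Hypotheses (t0 : 0 < t) (c10 : 0 < c1) (c20 : 0 < c2) (l0 : 0 < l) (k0 : 0 < k)
  (h0 : 0 < h).

Local Notation A := (alpha rk).
Local Notation b := (beta rk).
Local Notation S := (@stage_sum R q rk _).
Local Notation D := (hdom X).

Let inn_lin c u v w : D u -> D v -> D w -> inn (c *: u + v) w = c * inn u w + inn v w.
Proof. by have [H _ _] := inn_form; exact: H. Qed.

Let dir_lin c u v w : D u -> D v -> D w -> dir (c *: u + v) w = c * dir u w + dir v w.
Proof. by have [H _ _] := dir_form; exact: H. Qed.

Definition stage (h : R) (u : V) (m : 'I_q -> V) (i : 'I_q) := u + h *: S m i.

(** The stage equations after integration by parts. In the scheme t = tau, c2 = C_2 / eps^2, l = lam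
    / (2 eps K), k = D, [f i] is the L^2 pairing with G + H and [p i] the one with P; [m], [s], [w]
    are mu and the stage derivatives of T and U. *)
Definition weak_solution (phi T : V) (U : R) (m s : 'I_q -> V) (w : 'I_q -> R) :=
  [/\ forall i v, D v ->
        inn (m i) v + c1 * dir (stage (h / t) phi m i) v
        + c2 * inn (stage (h / t) phi m i) v + (U + h * rk_sum rk w i) * f i v = 0,
      forall i, w i = (2 * t)^-1 * f i (m i) - l * p i (stage h T s i) &
      forall i v, D v ->
        inn (s i) v + k * dir (stage h T s i) v
        - (U + h * rk_sum rk w i) * p i v = 0].

Lemma stage_dom g u m i : D u -> (forall j, D (m j)) -> D (stage g u m i).
Proof.
move=> uD mD; rewrite /stage addrC; apply: hdomP => //.
by apply: (dom_lincomb (hdom0 X) (@hdomP _ _ X)).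
Qed.

Lemma weak_energy phi T U m s w : D phi -> D T -> (forall i, D (m i)) ->
  (forall i, D (s i)) -> weak_solution phi T U m s w ->
  forall phi' T' U', phi' = phi + (h / t) *: \sum_i b i *: m i ->
  T' = T + h *: \sum_i b i *: s i -> U' = U + h * \sum_i b i * w i ->
  c1 / 2 * (dir phi' phi' - dir phi phi) + c2 / 2 * (inn phi' phi' - inn phi phi)
  + l * (inn T' T' - inn T T) + (U' ^+ 2 - U ^+ 2) <= 0.
Proof.
move=> phiD TD mD sD [e1 e2 e3] phi' T' U' phi'E T'E U'E.
have [_ b0 _ _ _] := hrk.
have h1 : 0 < h / t by rewrite divr_gt0.
have Hd := form_step_le hrk (hdom0 X) (@hdomP _ _ X) dir_lin dir_sym dir_psd (h / t) phiD mD.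
have Hi := form_step_le hrk (hdom0 X) (@hdomP _ _ X) inn_lin inn_sym inn_psd (h / t) phiD mD.
have HT := form_step_le hrk (hdom0 X) (@hdomP _ _ X) inn_lin inn_sym inn_psd h TD sD.
have HU : U' ^+ 2 - U ^+ 2 <= 2 * h * (\sum_i b i * ((U + h * rk_sum rk w i) * w i)).
  rewrite U'E !expr2; apply: (@form_step_le R q rk hrk R (fun=> True) (fun x y => x * y)) => //.
  - by move=> c u v z _ _ _; rewrite mulrDl -mulrA.
  - by move=> u v _ _; exact: mulrC.
move: Hd Hi HT HU; rewrite -phi'E -T'E.
set dd := dir phi' phi' - _; set di := inn phi' phi' - _; set dT := inn T' T' - _.
set dU := U' ^+ 2 - _ => Hd Hi HT HU.
have Hd' : c1 / 2 * dd <=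
    c1 / 2 * (2 * (h / t) * \sum_i b i * dir (phi + (h / t) *: S m i) (m i)).
  by apply: ler_wpM2l => //; rewrite divr_ge0// ltW.
have Hi' : c2 / 2 * di <=
    c2 / 2 * (2 * (h / t) * \sum_i b i * inn (phi + (h / t) *: S m i) (m i)).
  by apply: ler_wpM2l => //; rewrite divr_ge0// ltW.
have HT' : l * dT <= l * (2 * h * \sum_i b i * inn (T + h *: S s i) (s i)).
  by apply: ler_wpM2l => //; rewrite ltW.
apply: le_trans (lerD (lerD (lerD Hd' Hi') HT') HU) _.
rewrite !mulr_sumr -!big_split/=; apply: sumr_le0 => i _.
have TiD := stage_dom h i TD sD.
have := e1 i (m i) (mD i); have := e3 i _ TiD; have := e2 i.
rewrite -/(stage (h / t) phi m i) -/(stage h T s i) (inn_sym TiD (sD i)).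
have := inn_ge0 (mD i); have := dir_ge0 TiD.
move: (inn (m i) (m i)) (dir (stage (h / t) phi m i) (m i)) (inn (stage (h / t) phi m i) (m i)).
move: (inn (s i) (stage h T s i)) (dir (stage h T s i) (stage h T s i)).
move: (U + h * rk_sum rk w i) (f i (m i)) (p i (stage h T s i)) (w i) (b i) (b0 i).
move=> u fm pT wi bi bi0 sT dT' mm dp ip_ dT0 mm0 -> Hs Hm.
have -> : sT = u * pT - k * dT' by lra.
(* [sT] has been eliminated by the third equation tested with the stage value of T. The two terms in
   [u * pT] cancel, the parenthesis on the right is the first equation tested with [m i], and what
   is left is the dissipation of stage i. *)
have -> : c1 / 2 * (2 * (h / t) * (bi * dp)) + c2 / 2 * (2 * (h / t) * (bi * ip_))
    + l * (2 * h * (bi * (u * pT - k * dT'))) +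
    2 * h * (bi * (u * ((2 * t)^-1 * fm - l * pT))) =
  (h / t) * bi * (mm + c1 * dp + c2 * ip_ + u * fm) - (h / t) * bi * mm
    - 2 * l * h * k * bi * dT'.
  by field; rewrite gt_eqF.
rewrite Hm mulr0 sub0r -opprD oppr_le0 addr_ge0//.
  by rewrite mulr_ge0// mulr_ge0// ltW.
by rewrite !mulr_ge0// ltW.
Qed.

(** * The variational problem for the stage derivatives *)

Definition unknowns : hspace ((('I_q -> V) * ('I_q -> V)) * ('I_q -> R))%type :=
  hprod (hprod (hfun 'I_q X) (hfun 'I_q X)) (hfun 'I_q (hreal R)).

Local Notation space := ((('I_q -> V) * ('I_q -> V)) * ('I_q -> R))%type.
Implicit Types x y : space.

Let m_lin i : blin unknowns X (fun x => x.1.1 i).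
Proof.
exact: (blin_comp (blin_comp (blin_fst (hprod _ _) _) (blin_fst _ _)) (blin_proj X i)).
Qed.

Let s_lin i : blin unknowns X (fun x => x.1.2 i).
Proof.
exact: (blin_comp (blin_comp (blin_fst (hprod _ _) _) (blin_snd _ _)) (blin_proj X i)).
Qed.

Let w_lin i : blin unknowns (hreal R) (fun x => x.2 i).
Proof. exact: (blin_comp (blin_snd (hprod _ _) _) (blin_proj (hreal R) i)). Qed.

Let Sm_lin i : blin unknowns X (fun x => S x.1.1 i).
Proof. by apply: blin_sum => j; exact: blin_scale. Qed.

Let Ss_lin i : blin unknowns X (fun x => S x.1.2 i).
Proof. by apply: blin_sum => j; exact: blin_scale. Qed.

Let Sw_lin i : blin unknowns (hreal R) (fun x => rk_sum rk x.2 i).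
Proof. by apply: blin_sum => j; exact: blin_scale. Qed.

(** The parts of the three stage equations that are linear in the unknowns; the contributions of
    [phi], [T] and [U] go to [rhs]. *)
Let row1 x i v := inn (x.1.1 i) v + c1 * (h / t) * dir (S x.1.1 i) v
  + c2 * (h / t) * inn (S x.1.1 i) v + h * (rk_sum rk x.2 i * f i v).
Let row2 x i := x.2 i - (2 * t)^-1 * f i (x.1.1 i) + l * h * p i (S x.1.2 i).
Let row3 x i v := inn (x.1.2 i) v + k * h * dir (S x.1.2 i) v
  - h * (rk_sum rk x.2 i * p i v).

(* The test functions are the unknowns themselves in the first equation and
   their Runge-Kutta sums in the two others, with the weights beta_i / gamma_i:
   the trilinear coupling terms then cancel on the diagonal. *)
Let form x y := \sum_i weight rk i * (t^-1 * row1 x i (y.1.1 i)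
  + (2 * h) * (row2 x i * rk_sum rk y.2 i)
  + (2 * l * h) * row3 x i (S y.1.2 i)).

Let rhs phi T U y := \sum_i weight rk i *
  (t^-1 * (- (c1 * dir phi (y.1.1 i) + c2 * inn phi (y.1.1 i) + U * f i (y.1.1 i)))
  + (2 * h) * (- (l * p i T) * rk_sum rk y.2 i)
  + (2 * l * h) * (U * p i (S y.1.2 i) - k * dir T (S y.1.2 i))).

Let form_bform : bform unknowns unknowns form.
Proof.
have fm i : blin unknowns (hreal R) (fun y => f i (y.1.1 i)).
  exact: (blin_comp (m_lin i) (f_lin i)).
have pS i : blin unknowns (hreal R) (fun y => p i (S y.1.2 i)).
  exact: (blin_comp (Ss_lin i) (p_lin i)).
have real_form g g' : blin unknowns (hreal R) g -> blin unknowns (hreal R) g' ->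
    bform unknowns unknowns (fun x y => g x * g' y).
  by move=> gl g'l; exact: (bform_comp gl g'l (bform_ip (hreal R))).
apply: bform_sum => i; apply: bform_scale; apply: bform_add; first apply: bform_add.
- apply: bform_scale; apply: bform_add; first apply: bform_add; first apply: bform_add.
  + exact: (bform_comp (m_lin i) (m_lin i) inn_form).
  + by apply: bform_scale; exact: (bform_comp (Sm_lin i) (m_lin i) dir_form).
  + by apply: bform_scale; exact: (bform_comp (Sm_lin i) (m_lin i) inn_form).
  + by apply: bform_scale; exact: real_form.
- apply: bform_scale; apply: real_form => //.
  apply: blin_add; last by apply: (blin_scale (l * h)).
  by apply: blin_add => //; have := blin_scale (- (2 * t)^-1) (fm i);
    congr blin; apply/funext => x; rewrite scaleNr.
- apply: bform_scale; apply: bform_add; first apply: bform_add.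
  + exact: (bform_comp (s_lin i) (Ss_lin i) inn_form).
  + by apply: bform_scale; exact: (bform_comp (Ss_lin i) (Ss_lin i) dir_form).
  + have := bform_scale (- h) (real_form _ _ (Sw_lin i) (pS i)).
    by congr bform; apply/funext => x; apply/funext => y; rewrite mulNr.
Qed.

Let rhs_lin phi T U : D phi -> D T -> blin unknowns (hreal R) (rhs phi T U).
Proof.
move=> phiD TD.
have fm i : blin unknowns (hreal R) (fun y => f i (y.1.1 i)).
  exact: (blin_comp (m_lin i) (f_lin i)).
have pS i : blin unknowns (hreal R) (fun y => p i (S y.1.2 i)).
  exact: (blin_comp (Ss_lin i) (p_lin i)).
have partial_lin g u : bform X X g -> D u -> blin X (hreal R) (g u).
  move=> [_ gr [C C0 gC]] uD; split=> // [a v w vD wD|].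
    exact: gr.
  exists (C * ipnorm X u) => [|v vD]; first by rewrite mulr_ge0 ?ipnorm_ge0.
  by rewrite /ipnorm /= -expr2 sqrtr_sqr -mulrA; exact: gC.
have scale c g : blin unknowns (hreal R) g -> blin unknowns (hreal R) (fun y => c * g y).
  exact: blin_scale.
have add g g' : blin unknowns (hreal R) g -> blin unknowns (hreal R) g' ->
    blin unknowns (hreal R) (fun y => g y + g' y) by exact: blin_add.
have opp g : blin unknowns (hreal R) g -> blin unknowns (hreal R) (fun y => - g y).
  move=> gl; have := scale (-1) _ gl.
  by congr blin; apply/funext => x; rewrite mulN1r.
apply: blin_sum => i; apply: (scale _ _); apply: (add _ _); first apply: (add _ _).
- apply: (scale _ _); apply: (opp _); apply: (add _ _); last exact: (scale _ _).
  apply: (add _ _); apply: (scale _ _).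
    exact: (blin_comp (m_lin i) (partial_lin _ _ dir_form phiD)).
  exact: (blin_comp (m_lin i) (partial_lin _ _ inn_form phiD)).
- by apply: (scale _ _); exact: (scale _ _).
- apply: (scale _ _); apply: (add _ _); first exact: (scale _ _).
  apply: (opp _); apply: (scale _ _).
  exact: (blin_comp (Ss_lin i) (partial_lin _ _ dir_form TD)).
Qed.

(** On the diagonal the factors [t^-1], [2 * h] and [2 * l * h] of [form] make the couplings cancel:
    (h/t) f(m) against 2h (2t)^-1 f(m), and 2 l h^2 p(S s) against itself. Only forms covered by the
    stage estimates remain. *)
Let system_coercive : exists2 c, 0 < c &
  forall x, hdom unknowns x -> c * ip unknowns x x <= form x x.
Proof.
have [c c_gt0 cP] := rk_coercive q0 hrk.
have [wm wm_gt0 wmP] := positive_lower_bound (weight_gt0 q0 hrk).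
have t1 : 0 < t^-1 by rewrite invr_gt0.
have ht : 0 < h / t by rewrite divr_gt0.
(* In order, these control m in L^2, the gradient of m, the reals w, s in L^2 and the gradient of s;
   the last one comes from the gradient of the Runge-Kutta sums of s. *)
pose e1 := t^-1 * wm; pose e2 := t^-1 * (c1 * (h / t) * c).
pose e3 := 2 * h * c; pose e4 := 2 * l * h * (c * 1); pose e5 := 2 * l * h * (k * h * c).
have e1_gt0 : 0 < e1 by rewrite !mulr_gt0.
have e2_gt0 : 0 < e2 by rewrite !mulr_gt0.
have e3_gt0 : 0 < e3 by rewrite !mulr_gt0.
have e4_gt0 : 0 < e4 by rewrite !mulr_gt0.
have e5_gt0 : 0 < e5 by rewrite !mulr_gt0.
pose e := Num.min e1 (Num.min e2 (Num.min e3 (Num.min e4 e5))).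
exists e => [|[[m s] w] [[mD sD] _]]; first by rewrite !lt_min e1_gt0 e2_gt0 e3_gt0 e4_gt0.
rewrite /= in mD sD.
have Hm := weighted_coercive (hdom0 X) (@hdomP _ _ X) inn_lin inn_sym inn_psd
  (fun w0 => proj1 (cP w0)) mD.
have Hdm := weighted_coercive (hdom0 X) (@hdomP _ _ X) dir_lin dir_sym dir_psd
  (fun w0 => proj1 (cP w0)) mD.
have Hs := weighted_coercive (hdom0 X) (@hdomP _ _ X) inn_lin inn_sym inn_psd
  (fun w0 => proj1 (cP w0)) sD.
have Hds := weighted_coercive_sqr (hdom0 X) (@hdomP _ _ X) dir_lin dir_sym dir_psd
  (fun w0 => proj2 (cP w0)) sD.
have Hw := proj1 (cP w).
have Hmm : wm * \sum_i inn (m i) (m i) <= \sum_i weight rk i * inn (m i) (m i).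
  by rewrite mulr_sumr; apply: ler_sum => i _; rewrite ler_wpM2r ?inn_ge0.
have SsD i : D (S s i) by exact: (dom_lincomb (hdom0 X) (@hdomP _ _ X)).
have -> : form (m, s, w) (m, s, w) =
    t^-1 * (\sum_i weight rk i * inn (m i) (m i))
    + t^-1 * (c1 * (h / t)) * (\sum_i weight rk i * dir (S m i) (m i))
    + t^-1 * (c2 * (h / t)) * (\sum_i weight rk i * inn (S m i) (m i))
    + 2 * h * (\sum_i weight rk i * (rk_sum rk w i * w i))
    + 2 * l * h * (\sum_i weight rk i * inn (S s i) (s i))
    + 2 * l * h * (k * h) * (\sum_i weight rk i * dir (S s i) (S s i)).
  rewrite !mulr_sumr -!big_split/=; apply: eq_bigr => i _.
  rewrite /row1 /row2 /row3 /= (inn_sym (sD i) (SsD i)).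
  by field; rewrite gt_eqF.
have -> : ip unknowns (m, s, w) (m, s, w) =
    \sum_i inn (m i) (m i) + \sum_i dir (m i) (m i)
    + (\sum_i inn (s i) (s i) + \sum_i dir (s i) (s i)) + \sum_i w i ^+ 2.
  have hE (u : 'I_q -> V) : \sum_i inn (u i) (u i) + \sum_i dir (u i) (u i) = hfun_ip X u u.
    by rewrite -big_split; apply: eq_bigr => i _; rewrite ipE.
  by rewrite !hE.
have pos (g : 'I_q -> R) : (forall i, 0 <= g i) -> 0 <= \sum_i g i.
  by move=> g0; rewrite sumr_ge0.
have x1 := pos _ (fun i => inn_ge0 (mD i)); have x2 := pos _ (fun i => dir_ge0 (mD i)).
have x3 := pos _ (fun i => inn_ge0 (sD i)); have x4 := pos _ (fun i => dir_ge0 (sD i)).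
have x5 := pos _ (fun i => sqr_ge0 (w i)).
have ee1 : e <= e1 by rewrite ge_min lexx.
have ee2 : e <= e2 by rewrite !ge_min lexx !orbT.
have ee3 : e <= e3 by rewrite !ge_min lexx !orbT.
have ee4 : e <= e4 by rewrite !ge_min lexx !orbT.
have ee5 : e <= e5 by rewrite !ge_min lexx !orbT.
rewrite !mulrDr.
have b1 : e * \sum_i inn (m i) (m i) <= t^-1 * \sum_i weight rk i * inn (m i) (m i).
  by apply: le_trans (ler_wpM2r x1 ee1) _; rewrite -mulrA ler_wpM2l// ltW.
have b2 : e * \sum_i dir (m i) (m i) <=
    t^-1 * (c1 * (h / t)) * \sum_i weight rk i * dir (S m i) (m i).
  apply: le_trans (ler_wpM2r x2 ee2) _.
  rewrite /e2 [t^-1 * (_ * c)]mulrA -[leLHS]mulrA.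
  by rewrite ler_wpM2l// ltW// !mulr_gt0.
have b3 : e * \sum_i w i ^+ 2 <= 2 * h * \sum_i weight rk i * (rk_sum rk w i * w i).
  apply: le_trans (ler_wpM2r x5 ee3) _; rewrite -[leLHS]mulrA.
  by rewrite ler_wpM2l// ltW// mulr_gt0.
have b4 : e * \sum_i inn (s i) (s i) <= 2 * l * h * \sum_i weight rk i * inn (S s i) (s i).
  apply: le_trans (ler_wpM2r x3 ee4) _; rewrite /e4 mulr1 -[leLHS]mulrA.
  by rewrite ler_wpM2l// ltW// !mulr_gt0.
have b5 : e * \sum_i dir (s i) (s i) <=
    2 * l * h * (k * h) * \sum_i weight rk i * dir (S s i) (S s i).
  apply: le_trans (ler_wpM2r x4 ee5) _.
  rewrite /e5 [2 * l * h * (k * h * c)]mulrA -[leLHS]mulrA.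
  by rewrite ler_wpM2l// ltW// !mulr_gt0.
(* The L^2 norm of m is already controlled by [b1], so this term enters through its sign. *)
have b6 : 0 <= t^-1 * (c2 * (h / t)) * \sum_i weight rk i * inn (S m i) (m i).
  rewrite mulr_ge0//; first by rewrite ltW// !mulr_gt0.
  exact: le_trans (mulr_ge0 (ltW c_gt0) x1) Hm.
by move: b1 b2 b3 b4 b5 b6; lra.
Qed.

Let delta_sum (g : 'I_q -> R) i : \sum_j weight rk j * ((j == i)%:R * g j) = weight rk i * g i.
Proof.
rewrite (bigD1 i)//= eqxx mul1r big1 ?addr0// => j /negbTE ->.
by rewrite mul0r mulr0.
Qed.

(** Test vectors living on one stage isolate each equation. Where the test enters through its
    Runge-Kutta sums, a column of the inverse of A produces sums supported on a single stage. *)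
Let separation (e1 e3 : 'I_q -> V -> R) (e2 : 'I_q -> R) :
  (forall i c v, D v -> e1 i (c *: v) = c * e1 i v) ->
  (forall i c v, D v -> e3 i (c *: v) = c * e3 i v) ->
  (forall y, hdom unknowns y -> \sum_i weight rk i * (t^-1 * e1 i (y.1.1 i)
     + (2 * h) * (e2 i * rk_sum rk y.2 i) + (2 * l * h) * e3 i (S y.1.2 i)) = 0) ->
  [/\ forall i v, D v -> e1 i v = 0, forall i, e2 i = 0 &
      forall i v, D v -> e3 i v = 0].
Proof.
move=> e1Z e3Z H; have [Au _ _ _ _] := hrk; pose N := invmx A.
have w0 i : weight rk i != 0 by rewrite gt_eqF// weight_gt0.
have AN i j : \sum_n A i n * N n j = (i == j)%:R.
  by have := congr1 (fun M : 'M[R]_q => M i j) (mulmxV Au); rewrite !mxE.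
have SN j v i : S (fun n => N n j *: v) i = (i == j)%:R *: v.
  by rewrite /stage_sum -AN scaler_suml; apply: eq_bigr => n _; rewrite scalerA.
have S0 i : S (fun=> 0) i = 0 by rewrite /stage_sum big1// => j _; rewrite scaler0.
have r0 i : rk_sum rk (fun=> 0) i = 0 by rewrite /rk_sum big1// => j _; rewrite mulr0.
have e10 i : e1 i 0 = 0 by rewrite -(scale0r 0) e1Z ?mul0r//; exact: hdom0.
have e30 i : e3 i 0 = 0 by rewrite -(scale0r 0) e3Z ?mul0r//; exact: hdom0.
have D0 : forall i : 'I_q, D ((fun=> 0) i) by move=> _; exact: hdom0.
split.
- move=> i v vD.
  have yD : hdom unknowns ((fun j => (j == i)%:R *: v, fun=> 0), fun=> 0).
    by split=> //; split=> // j; exact: hdomZ.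
  have := H _ yD; rewrite /= (eq_bigr (fun j => weight rk j * ((j == i)%:R * (t^-1 * e1 j v)))).
    rewrite delta_sum => /eqP.
    rewrite mulf_eq0 (negbTE (w0 i)) /= !mulf_eq0 invr_eq0 (gt_eqF t0)/=.
    by move/eqP.
  by move=> j _; rewrite e1Z// r0 S0 e30 !mulr0 !addr0; congr (_ * _); ring.
- move=> i.
  have yD : hdom unknowns ((fun=> 0, fun=> 0), fun n => N n i) by [].
  have := H _ yD; rewrite /= (eq_bigr (fun j => weight rk j * ((j == i)%:R * (2 * h * e2 j)))).
    rewrite delta_sum => /eqP.
    rewrite mulf_eq0 (negbTE (w0 i)) /= !mulf_eq0 (gt_eqF h0) pnatr_eq0/=.
    by move/eqP.
  by move=> j _; rewrite e10 S0 e30 /rk_sum AN; congr (_ * _); ring.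
- move=> i v vD.
  have yD : hdom unknowns ((fun=> 0, fun n => N n i *: v), fun=> 0).
    by split=> //; split=> // j; exact: hdomZ.
  have := H _ yD; rewrite /=.
  rewrite (eq_bigr (fun j => weight rk j * ((j == i)%:R * (2 * l * h * e3 j v)))).
    rewrite delta_sum => /eqP.
    rewrite mulf_eq0 (negbTE (w0 i)) /= !mulf_eq0 (gt_eqF h0) (gt_eqF l0) pnatr_eq0/=.
    by move/eqP.
  by move=> j _; rewrite e10 SN r0 e3Z//; congr (_ * _); ring.
Qed.

Let form_tests phi T U x : D phi -> D T -> hdom unknowns x ->
  (forall y, hdom unknowns y -> form x y = rhs phi T U y) <->
  weak_solution phi T U x.1.1 x.1.2 x.2.
Proof.
move=> phiD TD xX; have [[mD sD] _] := xX.
(* Residuals of the three stage equations; [form] minus [rhs] is their weighted combination. *)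
pose e1 i v := row1 x i v + (c1 * dir phi v + c2 * inn phi v + U * f i v).
pose e2 i := row2 x i + l * p i T.
pose e3 i v := row3 x i v - (U * p i v - k * dir T v).
have SmD i : D (S x.1.1 i) by exact: (dom_lincomb (hdom0 X) (@hdomP _ _ X)).
have SsD i : D (S x.1.2 i) by exact: (dom_lincomb (hdom0 X) (@hdomP _ _ X)).
have lin g u v w c : bform X X g -> D u -> D v -> D w -> g (u + c *: v) w = g u w + c * g v w.
  by move=> [gl _ _] uD vD wD; rewrite addrC gl// addrC.
have rowsE : weak_solution phi T U x.1.1 x.1.2 x.2 <->
    [/\ forall i v, D v -> e1 i v = 0, forall i, e2 i = 0 &
        forall i v, D v -> e3 i v = 0].
  have E1 i v : D v -> e1 i v = inn (x.1.1 i) v + c1 * dir (stage (h / t) phi x.1.1 i) v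
      + c2 * inn (stage (h / t) phi x.1.1 i) v + (U + h * rk_sum rk x.2 i) * f i v.
    by move=> vD; rewrite /stage (lin dir)// (lin inn)// /e1 /row1; ring.
  have E2 i : e2 i = x.2 i - ((2 * t)^-1 * f i (x.1.1 i) - l * p i (stage h T x.1.2 i)).
    have [_ pl _] := p_lin i.
    have -> : p i (stage h T x.1.2 i) = h * p i (S x.1.2 i) + p i T.
      by rewrite /stage [T + _]addrC pl.
    by rewrite /e2 /row2; ring.
  have E3 i v : D v -> e3 i v = inn (x.1.2 i) v + k * dir (stage h T x.1.2 i) v
        - (U + h * rk_sum rk x.2 i) * p i v.
    by move=> vD; rewrite /stage (lin dir)// /e3 /row3; ring.
  split=> -[H1 H2 H3]; split=> [i v vD|i|i v vD].
  - by rewrite E1//; exact: H1.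
  - by rewrite E2 -H2 subrr.
  - by rewrite E3//; exact: H3.
  - by rewrite -E1// H1.
  - by apply/eqP; rewrite -subr_eq0 -E2 H2.
  - by rewrite -E3// H3.
have diffE y : form x y - rhs phi T U y = \sum_i weight rk i * (t^-1 * e1 i (y.1.1 i)
     + (2 * h) * (e2 i * rk_sum rk y.2 i) + (2 * l * h) * e3 i (S y.1.2 i)).
  by rewrite -sumrB; apply: eq_bigr => i _; rewrite /e1 /e2 /e3; ring.
have zform (g : V -> V -> R) u v c : bform X X g -> D u -> D v -> g u (c *: v) = c * g u v.
  move=> [_ gr _] uD vD; have g0 : g u 0 = 0.
    have := gr 1 u 0 0 uD (hdom0 X) (hdom0 X); rewrite scale1r addr0 mul1r.
    by move/eqP; rewrite -subr_eq0 opprD addrA subrr add0r oppr_eq0 => /eqP.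
  by rewrite -[c *: v]addr0 gr// ?g0 ?addr0//; exact: hdom0.
have zlin (g : V -> R) v c : blin X (hreal R) g -> D v -> g (c *: v) = c * g v.
  move=> [_ gr _] vD; have g0 : g 0 = 0.
    have := gr 1 0 0 (hdom0 X) (hdom0 X); rewrite !scale1r addr0.
    by move/eqP; rewrite -subr_eq0 opprD addrA subrr add0r oppr_eq0 => /eqP.
  by rewrite -[c *: v]addr0 gr// ?g0 ?addr0//; exact: hdom0.
split=> [H|/rowsE[H1 H2 H3] y [[ymD ysD] _]].
  apply/rowsE; apply: separation => [i c v vD|i c v vD|y yX].
  - by rewrite /e1 /row1 !zform// zlin//; ring.
  - by rewrite /e3 /row3 !zform// zlin//; ring.
  - by rewrite -diffE H// subrr.
apply/eqP; rewrite -subr_eq0 diffE big1// => i _.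
have SyD : D (S y.1.2 i) by exact: (dom_lincomb (hdom0 X) (@hdomP _ _ X)).
by rewrite H1// H2 H3// mul0r !mulr0 !addr0 mulr0.
Qed.

Lemma weak_exists phi T U : D phi -> D T ->
  exists m s w, [/\ forall i, D (m i), forall i, D (s i) &
    weak_solution phi T U m s w].
Proof.
move=> phiD TD.
have [c c_gt0 cP] := system_coercive.
have [_ rl [C C0 rC]] := rhs_lin U phiD TD.
have lC u : hdom unknowns u -> `|rhs phi T U u| <= C * ipnorm unknowns u.
  by move=> uX; have := rC u uX; rewrite {1}/ipnorm /= -expr2 sqrtr_sqr.
have [[[m s] w] xX xP] := lax_milgram form_bform c_gt0 cP rl C0 lC.
exists m, s, w; have [[mD sD] _] := xX; split=> //.
by have /(_ phiD TD xX)[+ _] := @form_tests phi T U (m, s, w); apply.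
Qed.

(** Coercivity on the difference of two solutions. The fields are determined up to null vectors
    only, while the product on R is definite and gives equality of the reals. *)
Lemma weak_unique phi T U m s w m' s' w' : D phi -> D T ->
  (forall i, D (m i)) -> (forall i, D (s i)) ->
  (forall i, D (m' i)) -> (forall i, D (s' i)) ->
  weak_solution phi T U m s w -> weak_solution phi T U m' s' w' ->
  [/\ forall i, ip X (m i - m' i) (m i - m' i) = 0,
      forall i, ip X (s i - s' i) (s i - s' i) = 0 & w = w'].
Proof.
move=> phiD TD mD sD m'D s'D ms m's'.
have xX : hdom unknowns (m, s, w) by [].
have x'X : hdom unknowns (m', s', w') by [].
have Hx := (@form_tests phi T U _ phiD TD xX).2 ms.
have Hx' := (@form_tests phi T U _ phiD TD x'X).2 m's'.
have [c c_gt0 cP] := system_coercive.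
have zX : hdom unknowns ((m, s, w) - (m', s', w')) by exact: hdomB.
have [fl _ _] := form_bform.
have z0 : ip unknowns ((m, s, w) - (m', s', w')) ((m, s, w) - (m', s', w')) = 0.
  apply/eqP; rewrite eq_le ip_ge0// andbT -(pmulr_rle0 _ c_gt0).
  apply: le_trans (cP _ zX) _.
  have zE : (m, s, w) - (m', s', w') = -1 *: (m', s', w') + (m, s, w) by rewrite scaleN1r addrC.
  by rewrite [X in form X _]zE fl// Hx// Hx'// mulN1r addNr.
have i1 i : 0 <= ip X (m i - m' i) (m i - m' i) by apply/ip_ge0/hdomB.
have i2 i : 0 <= ip X (s i - s' i) (s i - s' i) by apply/ip_ge0/hdomB.
have i3 i : 0 <= (w i - w' i) * (w i - w' i) by rewrite -expr2 sqr_ge0.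
have := z0; rewrite [LHS](_ : _ = \sum_i ip X (m i - m' i) (m i - m' i)
  + \sum_i ip X (s i - s' i) (s i - s' i) + \sum_i (w i - w' i) * (w i - w' i))//.
move/eqP; rewrite !paddr_eq0 ?addr_ge0 ?sumr_ge0//.
move=> /andP[/andP[]].
rewrite !psumr_eq0// => /allP z1 /allP z2 /allP z3.
split=> [i|i|].
- by apply/eqP; exact: (z1 i (mem_index_enum i)).
- by apply/eqP; exact: (z2 i (mem_index_enum i)).
- apply/funext => i; have := z3 i (mem_index_enum i).
  by rewrite /= -expr2 sqrf_eq0 subr_eq0 => /eqP.
Qed.

End weak_scheme.

(** * The scheme *)

Section scheme_weak_form.
Context (R : realType) (d q : nat) (P : model R d) (rk : butcher R q).
Context (t0 dt : R) (n : nat).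
Local Notation field := ('rV[R]_d -> R).
Context (phip Tp mup : 'I_q -> field) (phin Tn : field) (Un : R).
Local Notation mu := (box_measure (lo P) (hi P)).
Local Notation H1 := (H1 (lo P) (hi P)).
Local Notation L2 := (L2 (lo P) (hi P)).
Local Notation inner := (inner (lo P) (hi P)).
Local Notation dirichlet := (dirichlet (lo P) (hi P)).
Hypothesis ab : forall i, lo P ord0 i < hi P ord0 i.
Hypotheses (tau0 : 0 < tau P) (eps0 : 0 < eps P) (lam0 : 0 < lam P)
  (latent0 : 0 < latent P) (diffu0 : 0 < diffu P) (C10 : 0 < C1 P)
  (C20 : 0 < C2 P) (q0 : (0 < q)%N) (dt0 : 0 < dt)
  (hrk : algebraically_stable rk) (phinH : H1 phin) (TnH : H1 Tn).

Local Notation X := (hH1 ab).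
Let Phi := extrapolate rk t0 dt n phip.
Let Th := extrapolate rk t0 dt n Tp.
Let Mu := extrapolate rk t0 dt n mup.
Let G i := opG P (Phi i).
Let H i := opH P (Phi i) (Th i).
Let Pi i := opP P (Phi i) (Mu i).
Hypotheses (GL : forall i, L2 (G i)) (HL : forall i, L2 (H i)) (PL : forall i, L2 (Pi i)).

Let f i v := inner (G i + H i) v.
Let p i v := inner (Pi i) v.
Let c2 := C2 P / eps P ^+ 2.
Let l := lam P / (2 * eps P * latent P).

Let L2D u v : L2 u -> L2 v -> L2 (u + v).
Proof. by move=> uL vL; rewrite -[u]scale1r; exact: L2_lin. Qed.

Let L2Z c u : L2 u -> L2 (c *: u).
Proof. by move=> uL; rewrite -[c *: u]addr0; apply: L2_lin => //; exact: L2_0. Qed.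

Let inner_sym u v : inner u v = inner v u.
Proof. by rewrite !innerE l2ipC. Qed.

Let innerD u v w : L2 u -> L2 v -> L2 w -> inner (u + v) w = inner u w + inner v w.
Proof. by move=> uL vL wL; rewrite -[u in LHS]scale1r inner_lin// mul1r. Qed.

Let innerZ c u w : L2 u -> L2 w -> inner (c *: u) w = c * inner u w.
Proof. by move=> uL wL; exact: (@ipZl _ _ (hL2 mu)). Qed.

Let inner_ae u u' v : L2 u -> L2 u' -> L2 v -> u = u' %[ae mu] ->
  inner u v = inner u' v.
Proof. by move=> uL u'L vL uu; apply: l2ip_ae => //; exact: ae_eq_refl. Qed.

Let inner_form : bform X X inner.
Proof. exact: (bform_comp (blin_H1_L2 ab) (blin_H1_L2 ab) (bform_ip (hL2 mu))). Qed.

Let dir_form : bform X X dirichlet.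
Proof. exact: bform_dirichlet. Qed.

Let inner_blin g : L2 g -> blin X (hreal R) (inner g).
Proof.
move=> gL; split=> // [c u v [uL _] [vL _]|].
  exact: (ipPr (X := hL2 mu)).
exists (ipnorm (hL2 mu) g) => [|u uH]; first exact: ipnorm_ge0.
rewrite {1}/ipnorm /= -expr2 sqrtr_sqr.
apply: le_trans (ip_le_ipnorm (X := hL2 mu) gL (H1_L2 uH)) _.
apply: ler_wpM2l; first exact: ipnorm_ge0.
by rewrite ler_wsqrtr// lerDl; exact: dirichlet_ge0.
Qed.

Let inner_psd_H1 (K : 'I_q -> 'I_q -> R) (u : 'I_q -> field) :
  (forall x : 'I_q -> R, 0 <= \sum_i \sum_j K i j * (x i * x j)) ->
  (forall i, hdom X (u i)) -> 0 <= \sum_i \sum_j K i j * inner (u i) (u j).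
Proof. by move=> K0 uH; apply: l2ip_psd => // i; exact: H1_L2 (uH i). Qed.

Local Notation weak := (@weak_solution R q rk _ X inner dirichlet f p
  (tau P) (C1 P) c2 l (diffu P) dt phin Tn Un).

Lemma step_fieldE (u : field) (c : R) (e : 'I_q -> R) (m : 'I_q -> field) :
  (fun x => u x + c * \sum_j e j * m j x) = u + c *: \sum_j e j *: m j.
Proof.
apply/funext => x; rewrite [RHS](_ : _ = u x + c * (\sum_j e j *: m j) x)//.
by rewrite fct_sumE.
Qed.

Lemma step_field_ae (u : field) (c : R) (e : 'I_q -> R) (m m' : 'I_q -> field) :
  (forall j, m j = m' j %[ae mu]) ->
  u + c *: \sum_j e j *: m j = u + c *: \sum_j e j *: m' j %[ae mu].
Proof.
move=> mm; have : \forall x \ae mu, forall j, m j x = m' j x.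
  apply: filter_forall => j; by apply: filterS (mm j) => x /(_ I).
apply: filterS => x mx _; rewrite -!step_fieldE.
by congr (_ + _ * _); apply: eq_bigr => j _; rewrite mx.
Qed.

Lemma H1_sum (e : 'I_q -> R) (m : 'I_q -> field) : (forall j, H1 (m j)) ->
  H1 (\sum_j e j *: m j).
Proof. by move=> mH; elim/big_rec: _ => [|j v _ vH]; [exact: H1_0|exact: H1_lin]. Qed.

Lemma H1_step u c (e : 'I_q -> R) (m : 'I_q -> field) : H1 u ->
  (forall j, H1 (m j)) -> H1 (u + c *: \sum_j e j *: m j).
Proof. by move=> uH mH; rewrite addrC; apply: H1_lin => //; exact: H1_sum. Qed.

(* A is invertible, so that the stage derivatives are linear combinations of
   the stage values. *)
Lemma stage_derivative_H1 (u : field) (c : R) (m v : 'I_q -> field) : c != 0 ->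
  H1 u -> (forall i, H1 (v i)) -> (forall i, L2 (m i)) ->
  (forall i, v i = stage rk c u m i %[ae mu]) -> forall i, H1 (m i).
Proof.
move=> c0 uH vH mL vE i; have [Au _ _ _ _] := hrk; pose N := invmx (alpha rk).
have : H1 (\sum_j (N i j / c) *: (v j - u)).
  by apply: H1_sum => j; rewrite addrC -scaleN1r; exact: H1_lin.
apply: H1_ae => //.
have : \forall x \ae mu, forall j, v j x = stage rk c u m j x.
  apply: filter_forall => j; by apply: filterS (vE j) => x /(_ I).
apply: filterS => x vx _; rewrite fct_sumE.
rewrite (eq_bigr (fun j => \sum_k N i j * alpha rk j k * m k x)); last first.
  move=> j _; rewrite [LHS](_ : _ = N i j / c * (v j x - u x))// vx.
  rewrite /stage -step_fieldE addrAC subrr add0r mulrA divfK// mulr_sumr.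
  by apply: eq_bigr => k _; rewrite mulrA.
rewrite exchange_big (bigD1 i)//= [X in _ + X]big1 ?addr0.
  rewrite -mulr_suml (_ : \sum_j _ = (N *m alpha rk) i i); last by rewrite mxE.
  by rewrite mulVmx// mxE eqxx mul1r.
move=> k ki; rewrite -mulr_suml (_ : \sum_j _ = (N *m alpha rk) i k); last by rewrite mxE.
by rewrite mulVmx// mxE eq_sym (negbTE ki) mul0r.
Qed.

Lemma laplacian_dirichlet u lap v : weak_laplacian (lo P) (hi P) u lap -> H1 v ->
  inner lap v = - dirichlet u v.
Proof. by move=> [_ [_ _ lapE]]; exact: lapE. Qed.

Lemma grad_L2v u : H1 u -> L2v (lo P) (hi P) (grad (lo P) (hi P) u).
Proof.
move=> uH i; rewrite (_ : (fun x => _) = wpartial (lo P) (hi P) i u); first exact: wpartial_L2.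
by apply/funext => x; rewrite gradE.
Qed.

Local Notation scheme := (scheme P rk t0 dt n phip Tp mup phin Tn Un).

(** The a.e. equations are paired with H^1 functions, the Laplacians becoming Dirichlet forms. The
    stage values are first replaced by the explicit stages, to which they are equal only a.e. *)
Lemma scheme_weak (s : step_data R d q) : scheme s -> H1_class P s ->
  [/\ forall i, H1 (mu_st s i), forall i, H1 (Tdot_st s i) &
      weak (mu_st s) (Tdot_st s) (Udot_st s)].
Proof.
move=> [sphi sU sT _] [_ _ stH stL].
have phiE i : phi_st s i = stage rk (dt / tau P) phin (mu_st s) i %[ae mu].
  by rewrite /stage /stage_sum -(step_fieldE phin); have [] := sphi i.
have TE i : T_st s i = stage rk dt Tn (Tdot_st s) i %[ae mu].
  by rewrite /stage /stage_sum -(step_fieldE Tn); have [] := sT i.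
have mH : forall i, H1 (mu_st s i).
  apply: stage_derivative_H1 phiE => //; first by rewrite gt_eqF// divr_gt0.
    by move=> i; have [] := stH i.
  by move=> i; have [] := stL i.
have TdH : forall i, H1 (Tdot_st s i).
  apply: stage_derivative_H1 TE => //; first by rewrite gt_eqF.
    by move=> i; have [] := stH i.
  by move=> i; have [] := stL i.
split=> //.
have UE i : U_st s i = Un + dt * rk_sum rk (Udot_st s) i by have [] := sU i.
have phiH i : H1 (phi_st s i) by have [] := stH i.
have TH i : H1 (T_st s i) by have [] := stH i.
have sphiH i : H1 (stage rk (dt / tau P) phin (mu_st s) i) by exact: H1_step.
have sTH i : H1 (stage rk dt Tn (Tdot_st s) i) by exact: H1_step.
have dirE u u' v : H1 u -> H1 u' -> H1 v -> u = u' %[ae mu] -> dirichlet u v = dirichlet u' v.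
  exact: dirichlet_ae.
split=> [i v vH|i|i v vH].
- have [[lap lapE muE] _] := sphi i; have vL := H1_L2 vH.
  have lapL : L2 lap by have [_ []] := lapE.
  have phiL := H1_L2 (phiH i).
  rewrite -(dirE _ _ _ (phiH i) (sphiH i) vH (phiE i)).
  rewrite -(inner_ae phiL (H1_L2 (sphiH i)) vL (phiE i)) -UE.
  have {}muE : mu_st s i = C1 P *: lap + ((- c2) *: phi_st s i +
      (- U_st s i) *: (G i + H i)) %[ae mu].
    apply: filterS muE => x /(_ I) muE _; rewrite muE.
    rewrite [RHS](_ : _ = C1 P * lap x + (- c2 * phi_st s i x + - U_st s i * (G i x + H i x)))//.
    rewrite /G /H /c2; ring.
  have GHL : L2 (G i + H i) by exact: L2D.
  have r1L : L2 ((- U_st s i) *: (G i + H i)) by exact: L2Z.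
  have r2L : L2 ((- c2) *: phi_st s i + (- U_st s i) *: (G i + H i)) by exact: L2_lin.
  rewrite (inner_ae (H1_L2 (mH i)) (L2_lin (C1 P) lapL r2L) vL muE).
  rewrite inner_lin// inner_lin// innerZ// (laplacian_dirichlet lapE vH) /f.
  by move: (dirichlet _ _) (inner _ _) (inner _ _) => *; ring.
- have [-> _] := sU i; have TL := H1_L2 (TH i); have mL := H1_L2 (mH i).
  have PiL := PL i.
  rewrite /p (inner_sym (Pi i)) -(inner_ae TL (H1_L2 (sTH i)) PiL (TE i)).
  rewrite (inner_sym (T_st s i)) /f innerD// -/(G i) -/(H i) -/(Pi i).
  rewrite (_ : (fun x => _) = (tau P)^-1 *: mu_st s i)//.
  rewrite (inner_sym (G i) (_ *: _)) innerZ// (inner_sym (mu_st s i)) -/l.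
  by move: (inner _ _) (inner _ _) (inner _ _) => *; field; rewrite gt_eqF.
- have [[lap lapE TdE] _] := sT i; have vL := H1_L2 vH.
  have lapL : L2 lap by have [_ []] := lapE.
  rewrite -(dirE _ _ _ (TH i) (sTH i) vH (TE i)) -UE.
  have {}TdE : Tdot_st s i = diffu P *: lap + U_st s i *: Pi i %[ae mu].
    by apply: filterS TdE => x /(_ I) TdE _; rewrite TdE.
  have r1L : L2 (U_st s i *: Pi i) by exact: L2Z.
  rewrite (inner_ae (H1_L2 (TdH i)) (L2_lin (diffu P) lapL r1L) vL TdE).
  rewrite inner_lin// innerZ// (laplacian_dirichlet lapE vH) /p.
  by move: (dirichlet _ _) (inner _ _) => *; ring.
Qed.

Definition step_of (m s : 'I_q -> field) (w : 'I_q -> R) : step_data R d q :=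
  StepData (stage rk (dt / tau P) phin m) m (stage rk dt Tn s) s
    (fun i => Un + dt * rk_sum rk w i) w
    (phin + (dt / tau P) *: \sum_i beta rk i *: m i)
    (Tn + dt *: \sum_i beta rk i *: s i)
    (Un + dt * \sum_i beta rk i * w i).

Let weak_laplacianP u lap : H1 u -> L2 lap ->
  (forall v, H1 v -> inner lap v = - dirichlet u v) ->
  weak_laplacian (lo P) (hi P) u lap.
Proof. by move=> uH lapL lapE; split=> //; split=> //; exact: grad_L2v. Qed.

(** Solving the stage equation for the Laplacian gives an L^2 candidate, and the weak equation is
    precisely the variational identity that this candidate must satisfy. *)
Lemma weak_scheme_step m s w : (forall i, H1 (m i)) -> (forall i, H1 (s i)) ->
  weak m s w -> scheme (step_of m s w) /\ H1_class P (step_of m s w).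
Proof.
move=> mH sH [e1 e2 e3].
have sphiH i : H1 (stage rk (dt / tau P) phin m i) by exact: H1_step.
have sTH i : H1 (stage rk dt Tn s i) by exact: H1_step.
have C1n : C1 P != 0 by rewrite gt_eqF.
have kn : diffu P != 0 by rewrite gt_eqF.
split; last first.
  split=> [||i|i]; [exact: H1_step|exact: H1_step|by split; [exact: sphiH|exact: sTH]|].
  by split; exact: H1_L2.
split=> [i|i|i|] /=.
- split; last first.
    rewrite /stage /stage_sum -(step_fieldE phin); exact: ae_eq_refl.
  have GHL : L2 (G i + H i) by exact: L2D.
  have phiL := H1_L2 (sphiH i); have mL := H1_L2 (mH i).
  pose u := Un + dt * rk_sum rk w i.
  (* Equation (a) solved for the Laplacian; C_1 > 0 permits the division. *)
  pose lap := (C1 P)^-1 *: (m i + (c2 *: stage rk (dt / tau P) phin m i + u *: (G i + H i))).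
  have r1L : L2 (u *: (G i + H i)) by exact: L2Z.
  have r2L : L2 (c2 *: stage rk (dt / tau P) phin m i + u *: (G i + H i)) by exact: L2_lin.
  have r3L : L2 (m i + (c2 *: stage rk (dt / tau P) phin m i + u *: (G i + H i))) by exact: L2D.
  exists lap.
    apply: weak_laplacianP; [exact: sphiH|exact: L2Z|].
    move=> v vH; have vL := H1_L2 vH.
    rewrite /lap innerZ// innerD// inner_lin// innerZ//.
    have := e1 i v vH; rewrite -/u /f.
    move: (inner (m i) v) (dirichlet _ v) (inner (stage _ _ _ _ _) v) (inner (G i + H i) v).
    move=> x1 x2 x3 x4 E.
    have -> : x1 + (c2 * x3 + u * x4) = - (C1 P * x2) by move: E; lra.
    by rewrite mulrN mulrA mulVf// mul1r.
  apply: aeW => x _.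
  rewrite [lap x](_ : _ = (C1 P)^-1 * (m i x + (c2 * stage rk (dt / tau P) phin m i x
    + u * (G i x + H i x))))//.
  rewrite mulrA mulfV// mul1r /G /H /u /c2; ring.
- split=> //; rewrite e2.
  have TL := H1_L2 (sTH i); have mL := H1_L2 (mH i); have PiL := PL i.
  rewrite /f /p innerD// -/(G i) -/(H i) -/(Pi i).
  rewrite (_ : (fun x => (tau P)^-1 * m i x) = (tau P)^-1 *: m i)//.
  rewrite (inner_sym (G i) (_ *: _)) innerZ// (inner_sym (m i)) -/l.
  by move: (inner _ _) (inner _ _) (inner _ _) => *; field; rewrite gt_eqF.
- split; last first.
    rewrite /stage /stage_sum -(step_fieldE Tn); exact: ae_eq_refl.
  have sL := H1_L2 (sH i).
  pose u := Un + dt * rk_sum rk w i.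
  pose lap := (diffu P)^-1 *: ((- u) *: Pi i + s i).
  have r1L : L2 ((- u) *: Pi i + s i) by exact: L2_lin.
  exists lap.
    apply: weak_laplacianP; [exact: sTH|exact: L2Z|].
    move=> v vH; have vL := H1_L2 vH.
    rewrite /lap innerZ// inner_lin//.
    have := e3 i v vH; rewrite -/u /p.
    move: (inner (s i) v) (dirichlet _ v) (inner (Pi i) v) => x1 x2 x3 E.
    have -> : - u * x3 + x1 = - (diffu P * x2) by move: E; lra.
    by rewrite mulrN mulrA mulVf// mul1r.
  apply: aeW => x _.
  rewrite [lap x](_ : _ = (diffu P)^-1 * (- u * Pi i x + s i x))//.
  rewrite mulrA mulfV// mul1r /Pi /u; ring.
- split=> //.
    rewrite -(step_fieldE phin); exact: ae_eq_refl.
  rewrite -(step_fieldE Tn); exact: ae_eq_refl.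
Qed.

Let t_gt0 : 0 < tau P := tau0.
Let c2_gt0 : 0 < c2. Proof. by rewrite divr_gt0// exprn_gt0. Qed.
Let l_gt0 : 0 < l. Proof. by rewrite divr_gt0// !mulr_gt0. Qed.

Let dir_sym u v : hdom X u -> hdom X v -> dirichlet u v = dirichlet v u.
Proof. by move=> _ _; exact: dirichletC. Qed.

Let f_blin i : blin X (hreal R) (f i). Proof. by apply: inner_blin; exact: L2D. Qed.
Let p_blin i : blin X (hreal R) (p i). Proof. exact: inner_blin. Qed.

Let null_ae u v : H1 u -> H1 v -> ip X (u - v) (u - v) = 0 -> u = v %[ae mu].
Proof.
move=> uH vH; have uvH : H1 (u - v) by rewrite addrC -scaleN1r; exact: H1_lin.
rewrite /= /h1ip => /eqP; rewrite paddr_eq0; [|exact: l2ip_ge0|exact: dirichlet_ge0].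
move=> /andP[/eqP uv _].
apply: filterS (l2ip_eq0 (H1_L2 uvH) uv) => x /(_ I) h _.
by apply/eqP; rewrite -subr_eq0; apply/eqP.
Qed.

Lemma same_stepP (s : step_data R d q) m e w :
  (forall i, H1 (m i)) -> (forall i, H1 (e i)) -> weak m e w ->
  scheme s -> H1_class P s -> same_step P (step_of m e w) s.
Proof.
move=> mH eH weake ss sH; have [m'H e'H weak'] := scheme_weak ss sH.
have [mm ee ww] := weak_unique q0 hrk inner_form dir_form
  (fun u v _ _ => inner_sym u v) dir_sym inner_psd_H1
  (fun K u K0 uH => dirichlet_psd K0 uH)
  (fun u _ => l2ip_ge0 mu u) (fun u uH => dirichlet_ge0 uH) (fun u v => erefl)
  f_blin p_blin t_gt0 C10 c2_gt0 l_gt0 diffu0 dt0 phinH TnH mH eH m'H e'H weake weak'.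
have mE i : m i = mu_st s i %[ae mu] by apply: null_ae; [exact: mH|exact: m'H|exact: mm].
have eE i : e i = Tdot_st s i %[ae mu] by apply: null_ae; [exact: eH|exact: e'H|exact: ee].
have ae_sym_trans (u v z : field) : u = v %[ae mu] -> z = v %[ae mu] -> u = z %[ae mu].
  by move=> uv zv; apply: filterS2 uv zv => x /(_ I) -> /(_ I) ->.
have [sphi sU sT [sphi' sU' sT']] := ss.
split.
- split=> /=.
  + apply: ae_sym_trans (step_field_ae _ _ _ mE) _; rewrite -(step_fieldE phin); exact: sphi'.
  + apply: ae_sym_trans (step_field_ae _ _ _ eE) _; rewrite -(step_fieldE Tn); exact: sT'.
  + by rewrite sU' ww.
- move=> i; split=> //=.
  + apply: ae_sym_trans (step_field_ae _ _ _ mE) _; rewrite -(step_fieldE phin).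
    by have [] := sphi i.
  + apply: ae_sym_trans (step_field_ae _ _ _ eE) _; rewrite -(step_fieldE Tn).
    by have [] := sT i.
- by move=> i /=; have [_ ->] := sU i; rewrite ww.
Qed.

Theorem scheme_unique_solution : exists s : step_data R d q,
  [/\ scheme s, H1_class P s &
    forall s', scheme s' -> H1_class P s' -> same_step P s s'].
Proof.
have [m [e [w [mH eH weake]]]] := weak_exists q0 hrk inner_form dir_form
  (fun u v _ _ => inner_sym u v) dir_sym inner_psd_H1
  (fun K u K0 uH => dirichlet_psd K0 uH)
  (fun u _ => l2ip_ge0 mu u) (fun u uH => dirichlet_ge0 uH) (fun u v => erefl)
  f_blin p_blin t_gt0 C10 c2_gt0 l_gt0 diffu0 dt0 Un phinH TnH.
have [ss sH] := weak_scheme_step mH eH weake.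
by exists (step_of m e w); split=> // s'; exact: same_stepP.
Qed.

(** The energy depends on the updated fields only up to null sets, so they may be replaced by the
    explicit updates to which [weak_energy] applies. *)
Theorem scheme_energy_le (s : step_data R d q) : scheme s -> H1_class P s ->
  energy P (phi_next s) (T_next s) (U_next s) - energy P phin Tn Un <= 0.
Proof.
move=> ss sH; have [mH eH weake] := scheme_weak ss sH.
have [_ _ _ [sphi' sU' sT']] := ss; have [phi'H T'H _ _] := sH.
have := weak_energy hrk inner_form dir_form
  (fun u v _ _ => inner_sym u v) dir_sym inner_psd_H1
  (fun K u K0 uH => dirichlet_psd K0 uH)
  (fun u _ => l2ip_ge0 mu u) (fun u uH => dirichlet_ge0 uH)
  t_gt0 C10 c2_gt0 l_gt0 diffu0 dt0 phinH TnH mH eH weake erefl erefl erefl.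
rewrite -(step_fieldE phin) -(step_fieldE Tn) -sU'.
set phi' := fun x => phin x + _; set T' := fun x => Tn x + _ => E.
have phi'E : phi_next s = phi' %[ae mu] := sphi'.
have T'E : T_next s = T' %[ae mu] := sT'.
have phi'H' : H1 phi' by rewrite /phi' (step_fieldE phin); exact: H1_step.
have T'H' : H1 T' by rewrite /T' (step_fieldE Tn); exact: H1_step.
rewrite /energy !innerv_grad.
have -> : dirichlet (phi_next s) (phi_next s) = dirichlet phi' phi'.
  rewrite (dirichlet_ae ab phi'H phi'H' phi'H phi'E) dirichletC.
  exact: (dirichlet_ae ab phi'H phi'H' phi'H' phi'E).
have -> : inner (phi_next s) (phi_next s) = inner phi' phi'.
  by apply: l2ip_ae => //; exact: H1_L2.
have -> : inner (T_next s) (T_next s) = inner T' T'.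
  by apply: l2ip_ae => //; exact: H1_L2.
rewrite !real_normK ?num_real//.
have -> : C2 P / (2 * eps P ^+ 2) = c2 / 2 by rewrite /c2; field; rewrite gt_eqF.
rewrite -/l; move: E.
move: (dirichlet phi' phi') (dirichlet phin phin) (inner phi' phi') (inner phin phin).
move: (inner T' T') (inner Tn Tn) (U_next s) => y1 y2 u x1 x2 x3 x4 E.
by apply: le_trans E; rewrite le_eqVlt; apply/orP; left; apply/eqP; ring.
Qed.

End scheme_weak_form.

Unset Implicit Arguments.

Theorem theorem3p2 (R : realType) (d q : nat) (P : model R d)
    (rk : butcher R q) (t0 dt : R) (n : nat)
    (phip Tp mup : 'I_q -> 'rV[R]_d -> R) (phin Tn : 'rV[R]_d -> R) (Un : R)
    (hd : d = 2%N \/ d = 3%N)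
    (hbox : forall i, lo P ord0 i < hi P ord0 i)
    (htau : 0 < tau P) (heps : 0 < eps P) (hlam : 0 < lam P)
    (hlatent : 0 < latent P) (hdiffu : 0 < diffu P)
    (heps4 : 0 <= eps4 P < 1)
    (hC1 : 0 < C1 P < (1 - eps4 P) ^+ 2) (hC2 : 0 < C2 P)
    (hq : (0 < q)%N) (hdt : 0 < dt)
    (hrk : algebraically_stable rk)
    (hphin : H1 (lo P) (hi P) phin) (hTn : H1 (lo P) (hi P) Tn)
    (hprev : forall i, admissible P (extrapolate rk t0 dt n phip i)
                                    (extrapolate rk t0 dt n Tp i)
                                    (extrapolate rk t0 dt n mup i)) :
  (exists s : step_data R d q,
     [/\ scheme P rk t0 dt n phip Tp mup phin Tn Un s,
         H1_class P s &
         forall s' : step_data R d q,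
           scheme P rk t0 dt n phip Tp mup phin Tn Un s' ->
           H1_class P s' -> same_step P s s']) /\
  (forall s : step_data R d q,
     scheme P rk t0 dt n phip Tp mup phin Tn Un s ->
     H1_class P s ->
     energy P (phi_next s) (T_next s) (U_next s) - energy P phin Tn Un <= 0).
Proof.
have C1_gt0 : 0 < C1 P by case/andP: hC1.
have GL i : L2 (lo P) (hi P) (opG P (extrapolate rk t0 dt n phip i)).
  by have [_ _ _ []] := hprev i.
have HL i : L2 (lo P) (hi P) (opH P (extrapolate rk t0 dt n phip i)
    (extrapolate rk t0 dt n Tp i)) by have [_ _ _ []] := hprev i.
have PL i : L2 (lo P) (hi P) (opP P (extrapolate rk t0 dt n phip i)
    (extrapolate rk t0 dt n mup i)) by have [_ _ _ []] := hprev i.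
split; first exact: scheme_unique_solution.
by move=> s; exact: scheme_energy_le.
Qed.
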